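(* Verification of proof net correctness is linear in the number of leaves: given a leaf function $f$ on a cut sequent $\Gamma$ of multiplicative linear logic with units, determining whether $f$ is a proof net on $\Gamma$ can be done in time linear in the number of leaves of $\Gamma$.
   Context: Formulas (MLL) are built from literals (propositional variables $P,Q,\dots$ and their duals $P^\bot,Q^\bot,\dots$) and units $1,\bot$ by the binary connectives $\otimes$ (tensor) and $\wp$ (par, the multiplicative disjunction of linear logic). An atom is a literal or a unit. Negation $(-)^\bot$ extends to all formulas by $P^{\bot\bot}=P$, $\bot^\bot=1$, $1^\bot=\bot$, $(A\otimes B)^\bot=A^\bot\wp B^\bot$, $(A\wp B)^\bot=A^\bot\otimes B^\bot$. A formula is identified with its parse tree (leaves labelled by atoms, internal vertices by connectives). A leaf is positive if labelled by a propositional variable or $1$, and negative if labelled by a dual $P^\bot$ or by $\bot$. A sequent is a non-empty disjoint union of formulas (a labelled forest). A cut pair on $A$ is the disjoint union of $A$ and $A^\bot$ together with an undirected edge (a cut) between their roots. A cut sequent is a disjoint union of a sequent and zero or more cut pairs. A switching of a cut sequent is any subgraph obtained by deleting, for each $\wp$ vertex, one of its two argument edges. A leaf function on a cut sequent is a function from its negative leaves to its positive leaves. A proof net on a cut sequent $\Gamma$ is a leaf function $f$ on $\Gamma$ such that: (Matching) for every propositional variable $P$, $f$ restricts to a bijection between the $P^\bot$-labelled leaves and the $P$-labelled leaves of $\Gamma$; (Switching) for every switching $\Gamma'$ of $\Gamma$, the undirected graph obtained by adding the edges $\{l,f(l)\}$ of $f$ to $\Gamma'$ is a tree (acyclic and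 connected; parallel edges count as a cycle). *)

(* Defs.v *)
From mathcomp Require Import all_boot.

Set Implicit Arguments.
Unset Strict Implicit.
Unset Printing Implicit Defensive.

(** * Formulas and cut sequents *)

(* Propositional variables are named by natural numbers. *)
Inductive atom :=
  | Var of nat
  | Dual of nat
  | One
  | Bot.

Inductive formula :=
  | Atom of atom
  | Tensor of formula & formula
  | Par of formula & formula.

Definition dual_atom (a : atom) : atom :=
  match a with
  | Var P => Dual P
  | Dual P => Var P
  | One => Bot
  | Bot => One
  end.

Fixpoint dual (A : formula) : formula :=
  match A with
  | Atom a => Atom (dual_atom a)
  | Tensor A B => Par (dual A) (dual B)
  | Par A B => Tensor (dual A) (dual B)
  end.

(* Each [A] in [cuts] stands for the cut pair consisting of [A], [dual A] and
   the cut between their roots. *)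
Record cut_sequent := CutSequent {
  concls : seq formula;
  cuts : seq formula;
  concls_neq0 : 0 < size concls
}.

Definition components (G : cut_sequent) : seq formula :=
  concls G ++ flatten [seq [:: A; dual A] | A <- cuts G].

(** * The forest of a cut sequent *)

Inductive label :=
  | LAtom of atom
  | LTensor
  | LPar.

(* The labels of the parse tree in prefix order.  A vertex is identified with
   its position in this order: below the connective at position [o], the left
   argument is at [o.+1] and the right one comes after the whole left subtree. *)
Fixpoint tree_labels (A : formula) : seq label :=
  match A with
  | Atom a => [:: LAtom a]
  | Tensor A B => LTensor :: tree_labels A ++ tree_labels B
  | Par A B => LPar :: tree_labels A ++ tree_labels B
  end.

Definition tree_size (A : formula) : nat := size (tree_labels A).

Definition labels (G : cut_sequent) : seq label :=
  flatten [seq tree_labels A | A <- components G].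

Definition vertex (G : cut_sequent) := 'I_(size (labels G)).

Definition label_of (G : cut_sequent) (v : vertex G) : label :=
  tnth (in_tuple (labels G)) v.

Definition is_leaf (l : label) : bool := if l is LAtom _ then true else false.

Definition is_pos (l : label) : bool :=
  match l with LAtom (Var _) | LAtom One => true | _ => false end.

Definition is_neg (l : label) : bool :=
  match l with LAtom (Dual _) | LAtom Bot => true | _ => false end.

Definition num_leaves (G : cut_sequent) : nat := count is_leaf (labels G).

Definition pos_leaf (G : cut_sequent) := {v : vertex G | is_pos (label_of v)}.
Definition neg_leaf (G : cut_sequent) := {v : vertex G | is_neg (label_of v)}.

Definition leaf_function (G : cut_sequent) := neg_leaf G -> pos_leaf G.

(** * Undirected multigraphs *)

(* A multigraph on the vertices [0, ..., n-1] is given by the list of its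
   edges; two occurrences of the same pair are two parallel edges. *)
Definition joins (e : nat * nat) (u v : nat) : bool :=
  (e == (u, v)) || (e == (v, u)).

Definition connected (n : nat) (es : seq (nat * nat)) : Prop :=
  forall u v : 'I_n,
    connect (fun x y : 'I_n => has (fun e => joins e x y) es) u v.

(* [xs] lists the distinct vertices of a cycle and [cs] the distinct indices in
   [es] of its edges, the i-th edge leading from the i-th vertex to the next.
   Size 1 is a loop, size 2 a pair of parallel edges. *)
Definition is_cycle (es : seq (nat * nat)) (xs cs : seq nat) : Prop :=
  [/\ 0 < size xs, size cs = size xs, uniq xs, uniq cs &
      forall i, i < size xs ->
        nth 0 cs i < size es /\
        joins (nth (0, 0) es (nth 0 cs i))
              (nth 0 xs i) (nth 0 xs (i.+1 %% size xs))].

Definition acyclic (es : seq (nat * nat)) : Prop :=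
  forall xs cs, ~ is_cycle es xs cs.

Definition is_tree (n : nat) (es : seq (nat * nat)) : Prop :=
  acyclic es /\ connected n es.

(** * Proof nets *)

(* A switching is given by [s : nat -> bool], whose value at a par vertex tells
   whether the left argument edge is the one kept; its values at the other
   vertices are irrelevant.  The root of [A] is the vertex [o]. *)
Fixpoint switched_tree (s : nat -> bool) (o : nat) (A : formula)
    : seq (nat * nat) :=
  match A with
  | Atom _ => [::]
  | Tensor A B =>
      let l := o.+1 in let r := o.+1 + tree_size A in
      [:: (o, l); (o, r)] ++ switched_tree s l A ++ switched_tree s r B
  | Par A B =>
      let l := o.+1 in let r := o.+1 + tree_size A in
      (o, if s o then l else r) :: switched_tree s l A ++ switched_tree s r B
  end.

Fixpoint switched_forest (s : nat -> bool) (o : nat) (As : seq formula)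
    : seq (nat * nat) :=
  if As is A :: As' then
    switched_tree s o A ++ switched_forest s (o + tree_size A) As'
  else [::].

Fixpoint cut_edges_from (o : nat) (As : seq formula) : seq (nat * nat) :=
  if As is A :: As' then
    (o, o + tree_size A)
      :: cut_edges_from (o + tree_size A + tree_size (dual A)) As'
  else [::].

Definition cut_edges (G : cut_sequent) : seq (nat * nat) :=
  cut_edges_from (sumn [seq tree_size A | A <- concls G]) (cuts G).

Definition switching_edges (G : cut_sequent) (s : nat -> bool)
    : seq (nat * nat) :=
  switched_forest s 0 (components G) ++ cut_edges G.

Definition leaf_function_edges (G : cut_sequent) (f : leaf_function G)
    : seq (nat * nat) :=
  [seq (nat_of_ord (val l), nat_of_ord (val (f l))) | l <- enum {: neg_leaf G}].

Definition matching (G : cut_sequent) (f : leaf_function G) : Prop :=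
  forall P : nat,
    [/\ forall l, label_of (val l) = LAtom (Dual P) ->
          label_of (val (f l)) = LAtom (Var P),
        forall l l', label_of (val l) = LAtom (Dual P) ->
          label_of (val l') = LAtom (Dual P) -> f l = f l' -> l = l' &
        forall r : pos_leaf G, label_of (val r) = LAtom (Var P) ->
          exists2 l, label_of (val l) = LAtom (Dual P) & f l = r].

Definition switching (G : cut_sequent) (f : leaf_function G) : Prop :=
  forall s : nat -> bool,
    is_tree (size (labels G)) (switching_edges G s ++ leaf_function_edges f).

Definition proof_net (G : cut_sequent) (f : leaf_function G) : Prop :=
  matching f /\ switching f.

(** * Random access machines *)

(* Programs of a word RAM with unit-cost instructions, in structured form.
   The machine has registers and banks of memory, both indexed by natural
   numbers; a program mentions finitely many registers and banks, but addresses
   the cells of a bank indirectly. *)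
Inductive binop := Add | Sub | Mul | Div.

Definition eval_binop (op : binop) : nat -> nat -> nat :=
  match op with Add => addn | Sub => subn | Mul => muln | Div => divn end.

Inductive program :=
  | Skip
  | Const of nat & nat                (* r_x := k *)
  | Op of binop & nat & nat & nat     (* r_x := r_y op r_z *)
  | Get of nat & nat & nat           (* r_x := m_a[r_y] *)
  | Put of nat & nat & nat          (* m_a[r_x] := r_y *)
  | Seq of program & program
  | If of nat & program & program     (* test r_x != 0 *)
  | While of nat & program.           (* while r_x != 0 *)

Record state := State {
  reg : nat -> nat;
  mem : nat -> nat -> nat
}.

Definition set_reg (st : state) (x v : nat) : state :=
  State (fun y => if y == x then v else reg st y) (mem st).

Definition set_mem (st : state) (a i v : nat) : state :=
  State (reg st)
    (fun b j => if (b == a) && (j == i) then v else mem st b j).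

(* [exec W p st st' t]: started in [st], [p] halts in [st'] after [t] steps,
   and no number computed on the way exceeds the word range [0, ..., W-1].
   There is no rule for overflows: a program that overflows has no execution. *)
Inductive exec (W : nat) : program -> state -> state -> nat -> Prop :=
  | ExecSkip st :
      exec W Skip st st 1
  | ExecConst st x k of k < W :
      exec W (Const x k) st (set_reg st x k) 1
  | ExecOp st op x y z of eval_binop op (reg st y) (reg st z) < W :
      exec W (Op op x y z) st
        (set_reg st x (eval_binop op (reg st y) (reg st z))) 1
  | ExecGet st x a y :
      exec W (Get x a y) st (set_reg st x (mem st a (reg st y))) 1
  | ExecPut st a x y :
      exec W (Put a x y) st (set_mem st a (reg st x) (reg st y)) 1
  | ExecSeq st st1 st2 p q t1 t2 of
      exec W p st st1 t1 & exec W q st1 st2 t2 :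
      exec W (Seq p q) st st2 (t1 + t2)
  | ExecIfTrue st st1 x p q t of reg st x != 0 & exec W p st st1 t :
      exec W (If x p q) st st1 t.+1
  | ExecIfFalse st st1 x p q t of reg st x = 0 & exec W q st st1 t :
      exec W (If x p q) st st1 t.+1
  | ExecWhileTrue st st1 st2 x p t1 t2 of
      reg st x != 0 & exec W p st st1 t1 & exec W (While x p) st1 st2 t2 :
      exec W (While x p) st st2 (t1 + t2).+1
  | ExecWhileFalse st x p of reg st x = 0 :
      exec W (While x p) st st 1.

(** * Presenting a leaf function to a machine *)

Definition code (l : label) : nat :=
  match l with
  | LAtom (Var _) => 0
  | LAtom (Dual _) => 1
  | LAtom One => 2
  | LAtom Bot => 3
  | LTensor => 4
  | LPar => 5
  end.

Definition name (l : label) : nat :=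
  match l with LAtom (Var P) | LAtom (Dual P) => P | _ => 0 end.

Definition target (G : cut_sequent) (f : leaf_function G) (i : nat) : nat :=
  if [pick l : neg_leaf G | nat_of_ord (val l) == i] is Some l
  then nat_of_ord (val (f l)) else 0.

(* Registers 0, 1, 2 hold the numbers of vertices, of conclusions and of cut
   pairs.  Banks 0 and 1 hold the forest in Polish notation, as the label code
   and the variable name of each vertex in prefix order, and bank 2 holds the
   position of the image of each negative leaf.  Everything else is 0. *)
Definition input (G : cut_sequent) (f : leaf_function G) : state :=
  State
    (nth 0 [:: size (labels G); size (concls G); size (cuts G)])
    (fun a => match a with
              | 0 => nth 0 [seq code l | l <- labels G]
              | 1 => nth 0 [seq name l | l <- labels G]
              | 2 => target f
              | _ => fun=> 0
              end).

(* Words have O(log N) bits, where N accounts for the number of leaves and for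
   the largest variable name, which has to fit in a word. *)
Definition word_range (k : nat) (G : cut_sequent) : nat :=
  (num_leaves G + \max_(l <- labels G) name l + 2) ^ k.

(* Main.v *)
(* All switchings have the same number of edges, so they are trees iff that number
   is right and each of them is connected.  Connectedness is decided by exploring
   the net along its plain edges (tensor, cut and leaf edges).  The visited
   vertices form a stack of regions, each of which is connected, by edges between
   its own vertices, in every switching; a region is an interval of visit numbers.
   A par whose premises have both been visited is added to the lower of their two
   regions.  A par visited before its left premise opens a new region there, which
   is merged into the one below as soon as it contains the right premise too.  If
   the top region can neither grow nor be merged, then either some edge is redundant
   in the switching that keeps all left premises, or a suitable switching cuts the
   top region off.  Each region operation takes constant time: finding the region
   of a visit number is a range minimum query over the history of the stack height,
   answered with blocks of logarithmic length, bit masks and a sparse table over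
   the blocks. *)

Require Import Defs.
From mathcomp Require Import all_boot.
From mathcomp Require Import zify.
From Stdlib Require Import FunctionalExtensionality.

Set Implicit Arguments.
Unset Strict Implicit.
Unset Printing Implicit Defensive.

(** * Counting connected components *)

(** There are exponentially many switchings, so a region has to be certified for all of them at
    once. This works because a par is absorbed only when both its premises are in hand: whichever
    edge a switching keeps, it leads into the region. Rejection rests on the count: a connected
    graph with [n - 1] edges can spare none of them. So, if all switchings were connected, no plain
    edge could leave the top region of a stuck exploration, and that region would contain a par
    exactly when it contains both premises; some switching then keeps no edge across its border.
    Linear time comes from a potential that every pass through the loop lowers. The delicate
    operation is to locate the region of a premise visited long ago. As regions are opened and
    merged only at the top of the stack, no union-find structure is needed: the region of a visit
    number is the least height of the stack since that visit. Blocks of length [L] with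
    [n < 2 ^ L <= 2 * n] make a mask fit in a word, and tables indexed up to [2 * n] replace bit
    operations. *)

Inductive linked (e : nat -> nat -> Prop) : nat -> nat -> Prop :=
  | linked_step x y of e x y : linked e x y
  | linked_refl x : linked e x x
  | linked_sym x y of linked e x y : linked e y x
  | linked_trans x y z of linked e x y & linked e y z : linked e x z.

Definition edge_rel (es : seq (nat * nat)) (x y : nat) : Prop := (x, y) \in es.

Lemma linked_mono (e e' : nat -> nat -> Prop) x y :
  (forall a b, e a b -> linked e' a b) -> linked e x y -> linked e' x y.
Proof.
move=> sub; elim=> {x y} [x y /sub //|x|x y _|x y z _ h1 _ h2].
- exact: linked_refl.
- exact: linked_sym.
- exact: linked_trans h1 h2.
Qed.

Lemma linked_invariant (e : nat -> nat -> Prop) (T : Type) (g : nat -> T) x y :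
  (forall a b, e a b -> g a = g b) -> linked e x y -> g x = g y.
Proof.
by move=> eg; elim=> {x y} [x y /eg//|//|x y _ ->//|x y z _ -> _ ->].
Qed.

Definition endpoints_below (n : nat) (es : seq (nat * nat)) : bool :=
  all (fun e => (e.1 < n) && (e.2 < n)) es.

(** Each edge renames the class of its first end to that of its second. A computed representative
    turns the number of components into a number of distinct values. *)
Fixpoint comp_label (es : seq (nat * nat)) (x : nat) : nat :=
  if es is e :: es' then
    if comp_label es' x == comp_label es' e.1 then comp_label es' e.2
    else comp_label es' x
  else x.

Lemma linked_consW e es x y :
  linked (edge_rel es) x y -> linked (edge_rel (e :: es)) x y.
Proof.
by apply: linked_mono => a b ab; apply: linked_step; rewrite /edge_rel inE ab orbT.
Qed.

Lemma linked_comp_label es x : linked (edge_rel es) x (comp_label es x).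
Proof.
elim: es x => [|[a b] es IH] x /=; first exact: linked_refl.
case: eqP => [eq_x|_]; last exact/linked_consW/IH.
apply: linked_trans (linked_consW _ (IH x)) _; rewrite eq_x.
apply: linked_trans (linked_sym (linked_consW _ (IH a))) _.
apply: linked_trans (linked_consW _ (IH b)).
by apply: linked_step; rewrite /edge_rel inE eqxx.
Qed.

Lemma comp_labelP es x y :
  comp_label es x = comp_label es y <-> linked (edge_rel es) x y.
Proof.
split=> [eq_xy|].
  apply: linked_trans (linked_comp_label es x) _; rewrite eq_xy.
  exact/linked_sym/linked_comp_label.
apply: linked_invariant => a b; elim: es => [|[c d] es IH] //.
rewrite /edge_rel inE => /predU1P[[<- <-]|/IH /= -> //] /=.
by rewrite eqxx; case: eqP.
Qed.

Definition num_comps (n : nat) (es : seq (nat * nat)) : nat :=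
  size (undup [seq comp_label es x | x <- iota 0 n]).

Lemma num_comps_cons n e es :
  e.1 < n -> e.2 < n ->
  num_comps n es =
  num_comps n (e :: es) + (comp_label es e.1 != comp_label es e.2).
Proof.
case: e => a b /= an bn; rewrite /num_comps /=.
set f := comp_label es; set g := fun x => if x == f a then f b else x.
rewrite -[X in _ = size (undup X) + _]/(map (g \o f) (iota 0 n)) map_comp.
have sa : f a \in map f (iota 0 n) by apply: map_f; rewrite mem_iota.
have sb : f b \in map f (iota 0 n) by apply: map_f; rewrite mem_iota.
move: (map f _) sa sb => s sa sb.
have [eq_ab|neq_ab] := eqVneq (f a) (f b).
  rewrite addn0; congr (size (undup _)); rewrite -[LHS]map_id.
  by apply: eq_map => x; rewrite /g eq_ab; case: eqP.
(* The renaming [g] loses exactly the value [f a]; its image [f b] was present before. *)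
suff /perm_size -> : perm_eq (undup s) (f a :: undup (map g s)).
  by rewrite /= addn1.
apply: uniq_perm; rewrite /= ?undup_uniq //.
  rewrite andbT mem_undup; apply/mapP => -[x _].
  by rewrite /g; case: eqP => [_ /eqP|ne /esym //]; rewrite (negPf neq_ab).
move=> x; rewrite mem_undup inE mem_undup.
have [->|ne] := eqVneq x (f a); first by rewrite sa.
apply/idP/mapP => [xs|[y ys ->]]; first by exists x; rewrite // /g (negPf ne).
by rewrite /g; case: eqP.
Qed.

Lemma num_comps0 n : num_comps n [::] = n.
Proof. by rewrite /num_comps map_id undup_id ?iota_uniq // size_iota. Qed.

Lemma leq_num_comps n es : endpoints_below n es -> n <= num_comps n es + size es.
Proof.
elim: es => [_|e es IH /=/andP[/andP[e1 e2] /IH]]; first by rewrite num_comps0 addn0.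
by rewrite (num_comps_cons es e1 e2); case: (_ != _); lia.
Qed.

Lemma num_comps_gt0 n es : 0 < n -> 0 < num_comps n es.
Proof.
case: n => // n _; rewrite /num_comps /=; case: ifP => //= h.
by case: (undup _) (mem_undup (map (comp_label es) (iota 1 n)) (comp_label es 0)) => //; rewrite h.
Qed.

Lemma leq_num_comps1 n es :
  (forall u v, u < n -> v < n -> linked (edge_rel es) u v) -> num_comps n es <= 1.
Proof.
move=> con; rewrite /num_comps.
case: n con => // n con.
rewrite -(size_nseq 1 (comp_label es 0)); apply: uniq_leq_size; first exact: undup_uniq.
move=> x; rewrite mem_undup => /mapP[y]; rewrite mem_iota add0n => yn ->.
by rewrite inE; apply/eqP/comp_labelP/con.
Qed.

(** Each edge merges at most two components, and only one is left in the end. This is the bound that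
    makes every edge of a net indispensable. *)
Lemma linked_size n es : endpoints_below n es ->
  (forall u v, u < n -> v < n -> linked (edge_rel es) u v) -> n <= (size es).+1.
Proof.
by move=> /leq_num_comps + /leq_num_comps1; lia.
Qed.

(** * Trees as connected graphs with one edge fewer than vertices *)

Lemma joinsC e u v : joins e u v = joins e v u.
Proof. by rewrite /joins orbC. Qed.

Lemma joins_linked es e u v : e \in es -> joins e u v -> linked (edge_rel es) u v.
Proof.
case: e => a b ein /orP[] /eqP[? ?]; subst.
  exact: linked_step.
exact/linked_sym/linked_step.
Qed.

Lemma linked_connect n es (u v : 'I_n) : endpoints_below n es ->
  linked (edge_rel es) u v ->
  connect (fun x y : 'I_n => has (fun e => joins e x y) es) u v.
Proof.
move=> /allP ends luv; set R := (fun x y : 'I_n => _).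
have symR : connect_sym R.
  by apply: sym_connect_sym => x y; apply: eq_has => e; rewrite joinsC.
(* A derivation of [linked] may use reflexivity at numbers outside ['I_n]; the left alternative
   absorbs this in the induction. *)
suff: nat_of_ord u = v \/ exists u' v' : 'I_n,
    [/\ nat_of_ord u' = u, nat_of_ord v' = v & connect R u' v'].
  by case=> [/val_inj->|[u' [v' [/val_inj-> /val_inj->]]]] //; apply: connect0.
elim: luv => [x y exy|x|x y _ [->|[x' [y' [? ? c]]]]|x y z _ [->//|[x' [y' [? <- c]]]] _ [<-|[y'' [z' [/val_inj ? <- c']]]]].
- have /andP[/= xn yn] := ends _ exy.
  right; exists (Ordinal xn), (Ordinal yn); split=> //; apply: connect1.
  by apply/hasP; exists (x, y); rewrite // /joins eqxx.
- by left.
- by left.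
- by right; exists y', x'; rewrite symR.
- by right; exists x', y'.
- by right; exists x', z'; split=> //; apply: connect_trans c _; subst.
Qed.

Lemma connected_linked n es : endpoints_below n es ->
  connected n es <-> forall u v, u < n -> v < n -> linked (edge_rel es) u v.
Proof.
move=> ends; split=> con u v; last first.
  exact/linked_connect/con.
have walk p x : path (fun x y : 'I_n => has (fun e => joins e x y) es) x p ->
    linked (edge_rel es) x (last x p).
  elim: p x => [|w p IH] x /=; first by move=> _; apply: linked_refl.
  move=> /andP[/hasP[e ein ej] /IH]; apply: linked_trans.
  exact: joins_linked ej.
move=> un vn; have /connectP[p /walk] := con (Ordinal un) (Ordinal vn).
by move=> + eq_last; rewrite -eq_last.
Qed.

Lemma acyclic_behead e es : acyclic (e :: es) -> acyclic es.
Proof.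
move=> acyc xs cs [xs0 szc ux uc cyc]; apply: (acyc xs (map S cs)).
split; rewrite ?size_map ?(map_inj_uniq succn_inj) //.
move=> i ix; rewrite (nth_map 0) ?szc //.
by have [h1 h2] := cyc i ix.
Qed.

Lemma nth_joins_inj e x y x' y' : joins e x y -> joins e x' y' ->
  (x = x' /\ y = y') \/ (x = y' /\ y = x').
Proof.
by case: e => a b /orP[] /eqP[-> ->] /orP[] /eqP[-> ->]; [left|right|right|left].
Qed.

(** A path in [es] between the ends of [e], shortened so as to repeat no vertex, would be closed by
    [e] into a cycle. *)
Lemma acyclic_unlinked e es n : endpoints_below n (e :: es) -> acyclic (e :: es) ->
  ~ linked (edge_rel es) e.1 e.2.
Proof.
move=> /= /andP[/andP[e1n e2n] ends] acyc con.
set R := fun x y : 'I_n => has (fun e => joins e x y) es.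
have := linked_connect (u := Ordinal e1n) (v := Ordinal e2n) ends con.
case/connectP=> p0 /shortenP[p pth up _] lst {p0}.
pose xs := [seq nat_of_ord i | i <- Ordinal e1n :: p].
have szx : size xs = (size p).+1 by rewrite size_map.
have ux : uniq xs by rewrite map_inj_uniq //; apply: val_inj.
pose idx j := find (fun e => joins e (nth 0 xs j) (nth 0 xs j.+1)) es.
have idxP j : j < size p -> idx j < size es /\
    joins (nth (0, 0) es (idx j)) (nth 0 xs j) (nth 0 xs j.+1).
  move=> jp; have /pathP - /(_ (Ordinal e1n)) /(_ j jp) := pth.
  rewrite /R /idx.
  rewrite !(nth_map (Ordinal e1n)) /= ?(leqW jp) ?ltnS // => hs.
  by rewrite -has_find hs; split=> //; apply: (nth_find (0, 0) hs).
(* In [e :: es] the indices of [es] are shifted by one. The edge [e] itself has index 0 and comes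
   last, since it leads from the end of the path back to its start. *)
apply: (acyc xs (rcons [seq (idx j).+1 | j <- iota 0 (size p)] 0)).
split=> //.
- by rewrite size_rcons size_map size_iota szx.
- rewrite rcons_uniq; apply/andP; split; first by apply/mapP => -[].
  (* Two steps along the same edge would have the same pair of ends, which a path without repeated
     vertices excludes. *)
  rewrite map_inj_in_uniq ?iota_uniq // => i j; rewrite !mem_iota !add0n => ip jp [eij].
  have [_ ji] := idxP i ip; have [_ jj] := idxP j jp; rewrite eij in ji.
  have nx k : k <= size p -> k < size xs by rewrite szx.
  have [[/eqP + _]|[/eqP + /eqP]] := nth_joins_inj ji jj.
    by rewrite (nth_uniq 0) ?nx ?(ltnW ip) ?(ltnW jp) // => /eqP.
  rewrite !(nth_uniq 0) ?nx ?(ltnW ip) ?(ltnW jp) // => /eqP-> /eqP; lia.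
- move=> i; rewrite szx ltnS => ip; rewrite nth_rcons size_map size_iota.
  move: ip; rewrite leq_eqVlt => /predU1P[->|ip].
    rewrite ltnn eqxx modnn; split=> //.
    rewrite (_ : nth 0 xs (size p) = e.2); last first.
      by rewrite (nth_map (Ordinal e1n)) //= -last_nth -lst.
    by rewrite /= /joins; case: (e) => a b /=; rewrite eqxx orbT.
  rewrite ip (nth_map 0) ?size_iota // (nth_iota 0 0 ip) modn_small //.
  by have [h1 h2] := idxP i ip.
Qed.

Lemma acyclic_num_comps n es : endpoints_below n es -> acyclic es ->
  num_comps n es + size es = n.
Proof.
elim: es => [_ _|e es IH ends acyc]; first by rewrite num_comps0 addn0.
have nl := acyclic_unlinked ends acyc.
move: ends => /=/andP[/andP[e1 e2] ends].
have := IH ends (acyclic_behead acyc); rewrite (num_comps_cons es e1 e2).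
case: eqP => [/comp_labelP/nl//|_] /=; lia.
Qed.

(** The rest of the cycle still joins the ends of its first edge. The edge is removed by its
    position, so that a parallel copy survives. *)
Lemma is_cycle_redundant es xs cs : is_cycle es xs cs ->
  exists e es1 es2, es = es1 ++ e :: es2 /\ linked (edge_rel (es1 ++ es2)) e.1 e.2.
Proof.
move=> [xs0 szc ux uc cyc]; pose c := nth 0 cs 0; pose e := nth (0, 0) es c.
have [ces j0] := cyc 0 xs0.
exists e, (take c es), (drop c.+1 es).
rewrite -drop_nth // cat_take_drop; split=> //.
set rest := _ ++ _.
have inrest i : i < size es -> i != c -> nth (0, 0) es i \in rest.
  move=> ies; rewrite mem_cat neq_ltn => /orP[ic|ci]; apply/orP; [left|right].
    by rewrite -(nth_take _ ic) mem_nth // size_take ces.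
  rewrite -[i](subnKC ci) -nth_drop mem_nth // size_drop ltn_sub2r //.
  exact: leq_ltn_trans ci ies.
have step i : i.+1 < size xs -> linked (edge_rel rest) (nth 0 xs i.+1) (nth 0 xs (i.+2 %% size xs)).
  move=> ix; have [h1 h2] := cyc _ ix; apply: joins_linked h2; apply: inrest => //.
  by rewrite /c nth_uniq // szc.
have walk i : i.+1 < size xs -> linked (edge_rel rest) (nth 0 xs 1) (nth 0 xs i.+1).
  elim: i => [_|i IH ix]; first exact: linked_refl.
  apply: linked_trans (IH (ltnW ix)) _.
  by have := step i (ltnW ix); rewrite modn_small.
suff l01 : linked (edge_rel rest) (nth 0 xs 0) (nth 0 xs (1 %% size xs)).
  move: j0; rewrite -/c -/e; case: (e) => a b /orP[] /eqP[-> ->] //; exact: linked_sym.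
(* On a loop, the vertex after the first one is the first one again. *)
case: (ltngtP 1 (size xs)) => [s1|s1|<-]; [|lia|by rewrite modnn; apply: linked_refl].
rewrite modn_small //; apply: linked_sym.
have [m szm] : exists m, size xs = m.+2 by exists (size xs - 2); lia.
have := step m; have := walk m; rewrite szm modnn => w st.
exact: linked_trans (w _) (st _).
Qed.

(** Otherwise the graph would stay connected without [e], with fewer than [n - 1] edges. *)
Lemma redundant_edge n e es1 es2 : endpoints_below n (es1 ++ e :: es2) ->
  (forall u v, u < n -> v < n -> linked (edge_rel (es1 ++ e :: es2)) u v) ->
  (size (es1 ++ e :: es2)).+1 <= n -> ~ linked (edge_rel (es1 ++ es2)) e.1 e.2.
Proof.
move=> ends con sz le.
have: n <= (size (es1 ++ es2)).+1; last by move: sz; rewrite !size_cat /=; lia.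
apply: linked_size => [|u v un vn].
  by move: ends; rewrite /endpoints_below !all_cat /= => /and3P[-> _ ->].
apply: linked_mono (con _ _ un vn) => a b.
rewrite /edge_rel mem_cat inE => /or3P[h|/eqP eq_e|h].
- by apply: linked_step; rewrite /edge_rel mem_cat h.
- by rewrite -eq_e in le.
- by apply: linked_step; rewrite /edge_rel mem_cat h orbT.
Qed.

(** All switchings have equally many edges; one count therefore replaces the search for cycles in
    each of them. *)
Theorem is_treeP n es : 0 < n -> endpoints_below n es ->
  is_tree n es <-> (size es).+1 = n /\
    forall u v, u < n -> v < n -> linked (edge_rel es) u v.
Proof.
move=> n0 ends; rewrite /is_tree connected_linked //; split=> -[].
  move=> acyc con; split=> //; have := acyclic_num_comps ends acyc.
  by have := leq_num_comps1 con; have := num_comps_gt0 es n0; lia.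
move=> sz con; split=> // xs cs /is_cycle_redundant[e [es1 [es2 [Ees le]]]].
by rewrite Ees in ends con sz; apply: (redundant_edge ends con _ le); rewrite sz.
Qed.

(** * Exploration by a stack of regions *)

Definition upd (f : nat -> nat) (i x : nat) : nat -> nat :=
  fun j => if j == i then x else f j.

Definition updl (f : nat -> seq nat) (i : nat) (x : seq nat) : nat -> seq nat :=
  fun j => if j == i then x else f j.

(* [num] holds the visit numbers, 0 meaning unvisited, and [cnt] the last one.
   Region [i <= lev] starts at visit number [bnd i] and was opened by the par
   [apx i].  The vertices waiting to enter it are the list of [item]s that starts at
   cell [hd i] and is linked by [nnx]; [fr] is the next free cell.  For the last
   vertex visited, [vtx], there remain to be handled: its arcs from [cur] on; its par
   [o], if [pj = o.+1]; and its left premise [ap], if it is a par.  [seen o] is the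
   visit number of the first visited premise of [o]. *)
Record explore := Explore {
  cnt : nat; lev : nat; cur : nat; pj : nat; ap : nat; vtx : nat; fr : nat;
  num : nat -> nat; seen : nat -> nat; bnd : nat -> nat; apx : nat -> nat;
  hd : nat -> nat; item : nat -> nat; nnx : nat -> nat
}.

Fixpoint chain (item nnx : nat -> nat) (fr h : nat) (s : seq nat) : Prop :=
  if s is w :: s' then
    [/\ 0 < h, h < fr, item h = w & chain item nnx fr (nnx h) s']
  else h = 0.

Lemma chain_upd item nnx fr h s x y : chain item nnx fr h s ->
  chain (upd item fr x) (upd nnx fr y) fr.+1 h s.
Proof.
elim: s h => //= w s IH h [h0 hf <- /IH c].
by rewrite /upd (ltn_eqF hf); split=> //; apply: leqW.
Qed.

Lemma chain_nil item nnx fr h s : chain item nnx fr h s -> h = 0 <-> s = [::].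
Proof. by case: s => [|w s] /= => [->|[]] // h0 *; split=> // h_eq; move: h0; rewrite h_eq. Qed.

(** Every plain edge is stored as two opposite arcs. The sources [src] exist in the proof only: the
    machine always reaches an arc from its source. *)
Definition arcs_in (pl : seq (nat * nat)) (A : nat) (src tgt : nat -> nat) : Prop :=
  forall e, 0 < e <= A -> (src e, tgt e) \in pl \/ (tgt e, src e) \in pl.

Definition arcs_cover (pl : seq (nat * nat)) (A : nat) (src tgt : nat -> nat) : Prop :=
  forall x y, (x, y) \in pl ->
    (exists2 e, 0 < e <= A & src e = x /\ tgt e = y) /\
    (exists2 e, 0 < e <= A & src e = y /\ tgt e = x).

Section Exploration.

Variables (n : nat) (pl : seq (nat * nat)) (pars : seq nat) (lft rgt : nat -> nat).

Definition switch (s : nat -> bool) : seq (nat * nat) :=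
  pl ++ [seq (o, if s o then lft o else rgt o) | o <- pars].

Definition premise (o y : nat) : Prop := y = lft o \/ y = rgt o.

(** [0 < lft o] allows the value 0 of [ap] to mean that no left premise is pending. [pg_size] is the
    edge count, checked before the exploration; rejection relies on it. *)
Record par_graph (pa : nat -> nat) : Prop := ParGraph {
  pg_n : 0 < n;
  pg_pl : endpoints_below n pl;
  pg_pars : forall o, o \in pars -> [/\ o < n, 0 < lft o, lft o < n & rgt o < n];
  pg_neq : forall o, o \in pars -> lft o <> rgt o;
  pg_pa : forall y o, pa y = o.+1 -> o \in pars /\ premise o y;
  pg_pa_premise : forall o y, o \in pars -> premise o y -> pa y = o.+1;
  pg_size : (size pl + size pars).+1 = n
}.

(** The arcs with a given source form a list in decreasing order. The arcs of the current vertex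
    still to be handled are thus those numbered at most [cur], the form in which [pending_arc]
    counts them. *)
Record adjacency (A : nat) (src head nxt : nat -> nat) : Prop := Adjacency {
  ad_headA : forall u, head u <= A;
  ad_head : forall u, head u != 0 -> src (head u) = u;
  ad_head_max : forall e, 0 < e <= A -> e <= head (src e);
  ad_nxt_lt : forall e, 0 < e <= A -> nxt e < e;
  ad_nxt : forall e, 0 < e <= A -> nxt e != 0 -> src (nxt e) = src e;
  ad_nxt_max : forall e e', 0 < e <= A -> e' < e -> src e' = src e -> e' <= nxt e
}.

Variables (pa : nat -> nat) (A : nat) (src tgt head nxt : nat -> nat).
Hypothesis graph : par_graph pa.
Hypothesis adj : adjacency A src head nxt.
Hypothesis arc_pl : arcs_in pl A src tgt.
Hypothesis pl_arc : arcs_cover pl A src tgt.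

Implicit Type S : explore.

Definition inR S i w : Prop :=
  [/\ bnd S i <= num S w, 0 < num S w & i < lev S -> num S w < bnd S i.+1].

(* The edges that certify a region: plain edges inside it, and the selected
   edge of any par whose conclusion and premises all lie in it. *)
Definition inner S i (s : nat -> bool) x y : Prop :=
  [/\ inR S i x, inR S i y &
      (x, y) \in pl \/
      [/\ x \in pars, y = (if s x then lft x else rgt x),
          inR S i (lft x) & inR S i (rgt x)]].

(* The region [lev] has just been opened and contains no vertex yet. *)
Definition fresh S : Prop := bnd S (lev S) = (cnt S).+1.

Definition pending_arc S e := (num S (src e) == 0) || ((src e == vtx S) && (e <= cur S)).

Definition arcs_left S := count (pending_arc S) (iota 1 A).

(** [wl] is a ghost: [wl i] is the content of the list at [hd i]. The witnesses in [i_cand] need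
    visit numbers from [bnd i] on, not membership in region [i]: a vertex leaves a list only when
    its region is on top, and then all these numbers belong to it. [i_arc] and [i_par] say that no
    handled arc and no completed par is forgotten; once the top list is empty, they close the top
    region. [i_fr] charges the list cells still to be allocated in advance, which bounds the
    addresses. *)
Record inv (K : nat) S (wl : nat -> seq nat) : Prop := Inv {
  i_num : forall w, num S w != 0 -> w < n /\ num S w <= cnt S;
  i_cnt : count (fun w => num S w != 0) (iota 0 n) = cnt S;
  i_bnd0 : bnd S 0 = 1;
  i_bnd : forall i, i < lev S -> bnd S i < bnd S i.+1;
  i_bndl : bnd S (lev S) <= (cnt S).+1;
  i_apx : forall i, i < lev S ->
    [/\ apx S i.+1 \in pars, inR S i (apx S i.+1) &
        inR S i.+1 (lft (apx S i.+1)) \/ i.+1 = lev S /\ fresh S];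
  i_fresh : fresh S -> [/\ cur S = 0, pj S = 0, ap S = 0 &
    exists l, [/\ wl (lev S) = [:: l], num S l = 0 & 0 < lev S -> l = lft (apx S (lev S))]];
  i_chain : forall i, chain (item S) (nnx S) (fr S) (hd S i) (wl i);
  i_above : forall i, lev S < i -> wl i = [::];
  i_cand : forall i w, i <= lev S -> w \in wl i -> w < n /\
    [\/ i = lev S /\ fresh S,
        exists2 x, bnd S i <= num S x & (x, w) \in pl \/ (w, x) \in pl |
        [/\ w \in pars, bnd S i <= num S (lft w) & bnd S i <= num S (rgt w)]];
  i_conn : forall i s x y, i <= lev S -> inR S i x -> inR S i y -> linked (inner S i s) x y;
  i_arc : forall e, 0 < e <= A -> ~~ pending_arc S e ->
    num S (tgt e) != 0 \/ exists i, [/\ i <= lev S, inR S i (src e) & tgt e \in wl i];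
  i_par : forall o, o \in pars -> pj S <> o.+1 ->
    num S (lft o) != 0 -> num S (rgt o) != 0 ->
    num S o != 0 \/ exists i, [/\ i <= lev S, o \in wl i & inR S i (lft o) \/ inR S i (rgt o)];
  i_apex : forall o, o \in pars -> num S o != 0 -> ~ (ap S != 0 /\ o = vtx S) ->
    num S (lft o) != 0 \/ [/\ fresh S, 0 < lev S & o = apx S (lev S)];
  i_unseen : forall o y, o \in pars -> premise o y -> seen S o = 0 ->
    num S y != 0 -> pj S = o.+1 /\ y = vtx S;
  i_seen : forall o, o \in pars -> seen S o != 0 ->
    exists y, [/\ premise o y, seen S o = num S y & ~ (pj S = o.+1 /\ y = vtx S)];
  i_cur : cur S <= A /\ (cur S != 0 -> src (cur S) = vtx S);
  i_pj : pj S != 0 -> exists o, [/\ o \in pars, pj S = o.+1 & premise o (vtx S)];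
  i_ap : ap S != 0 -> vtx S \in pars /\ ap S = lft (vtx S);
  i_vtx : ~~ [&& cur S == 0, pj S == 0 & ap S == 0] -> inR S (lev S) (vtx S);
  i_fr : 0 < fr S /\
    fr S + arcs_left S + (ap S != 0) + (pj S != 0) + 3 * (n - cnt S) <= K
}.

(** The weights let every step pay for what it creates: a handled arc (2) for a list cell (1), an
    opened region (3) for a cell and a level, a completed par (2) for a cell, a visit (6) for the
    par (2) and the left premise (3) that it may leave pending. *)
Definition potential S (wl : nat -> seq nat) : nat :=
  2 * arcs_left S + \sum_(i < (lev S).+1) size (wl i) + lev S +
  2 * (pj S != 0) + 3 * (ap S != 0) + 6 * (n - cnt S).

Section Facts.

Variables (K : nat) (S : explore) (wl : nat -> seq nat).
Hypothesis I : inv K S wl.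

Lemma bnd_mono i j : i <= j -> j <= lev S -> bnd S i <= bnd S j.
Proof.
elim: j => [|j IH]; first by rewrite leqn0 => /eqP->.
rewrite leq_eqVlt => /predU1P[->//|ij] jl.
exact: leq_trans (IH ij (ltnW jl)) (ltnW (i_bnd I jl)).
Qed.

Lemma bnd_gt0 i : i <= lev S -> 0 < bnd S i.
Proof. by move=> il; rewrite -(i_bnd0 I); apply: bnd_mono. Qed.

Lemma leq_num w : num S w <= cnt S.
Proof. by case: (posnP (num S w)) => [->//|]; rewrite lt0n => /(i_num I)[]. Qed.

Lemma inR_uniq i j x : i <= lev S -> j <= lev S -> inR S i x -> inR S j x -> i = j.
Proof.
move=> il jl [a1 _ a2] [b1 _ b2]; case: (ltngtP i j) => // ij.
  have := bnd_mono ij jl; have := a2 (leq_trans ij jl); lia.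
have := bnd_mono ij il; have := b2 (leq_trans ij il); lia.
Qed.

Lemma inR_ex x : num S x != 0 -> exists2 i, i <= lev S & inR S i x.
Proof.
rewrite -lt0n => x0.
have ex0 : exists i, (i <= lev S) && (bnd S i <= num S x).
  by exists 0; rewrite (i_bnd0 I).
have ub i : (i <= lev S) && (bnd S i <= num S x) -> i <= lev S by case/andP.
case: (ex_maxnP ex0 ub) => i /andP[il ix] max.
exists i => //; split=> // i_lt; rewrite ltnNge; apply/negP => h.
by have := max i.+1; rewrite i_lt h ltnn => /(_ isT).
Qed.

Lemma inR_top x : bnd S (lev S) <= num S x -> inR S (lev S) x.
Proof. by move=> h; split=> //; [apply: leq_trans (bnd_gt0 _) h | rewrite ltnn]. Qed.

End Facts.

(** * Each step of the exploration preserves the invariant and lowers the potential *)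

Lemma count_upd (f g : nat -> nat) w :
  w < n -> (forall x, x != w -> (f x != 0) = (g x != 0)) -> f w = 0 -> g w != 0 ->
  count (fun x => g x != 0) (iota 0 n) = (count (fun x => f x != 0) (iota 0 n)).+1.
Proof.
move=> wn eq_fg fw gw.
have -> : count (fun x => g x != 0) (iota 0 n) =
  count (predU (pred1 w) (fun x => f x != 0)) (iota 0 n).
  apply: eq_count => x /=; have [->|ne] := eqVneq x w; first by rewrite gw.
  by rewrite -eq_fg.
have := count_predUI (pred1 w) (fun x => f x != 0) (iota 0 n).
rewrite (@eq_count _ (predI _ _) pred0) ?count_pred0; last first.
  by move=> x /=; case: eqP => // ->; rewrite fw.
by rewrite addn0 => ->; rewrite count_uniq_mem ?iota_uniq // mem_iota add0n wn leq0n add1n.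
Qed.

Definition do_arc S := Explore (cnt S) (lev S) (nxt (cur S)) (pj S) (ap S) (vtx S)
  (fr S).+1 (num S) (seen S) (bnd S) (apx S) (upd (hd S) (lev S) (fr S))
  (upd (item S) (fr S) (tgt (cur S))) (upd (nnx S) (fr S) (hd S (lev S))).

Lemma chain_push S wl i w (j : nat) :
  (forall i, chain (item S) (nnx S) (fr S) (hd S i) (wl i)) -> 0 < fr S ->
  chain (upd (item S) (fr S) w) (upd (nnx S) (fr S) (hd S i)) (fr S).+1
    (upd (hd S) i (fr S) j) (updl wl i (w :: wl i) j).
Proof.
move=> ch fr0; rewrite /updl [upd (hd S) i _ j]/upd; case: eqP => [_|_]; last exact: chain_upd.
by split=> //; rewrite /upd eqxx //; apply: chain_upd.
Qed.

Lemma sum_updl wl i w l : i <= l ->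
  \sum_(j < l.+1) size (updl wl i (w :: wl i) j) = (\sum_(j < l.+1) size (wl j)).+1.
Proof.
move=> il; rewrite (bigD1 (Ordinal (il : i < l.+1))) //=.
rewrite [in RHS](bigD1 (Ordinal (il : i < l.+1))) //= /updl eqxx /=.
by congr (_.+1 + _); apply: eq_bigr => j; rewrite -val_eqE /= => /negPf->.
Qed.

Lemma updl_mem wl i w j x :
  x \in updl wl i (w :: wl i) j -> (j = i /\ x = w) \/ x \in wl j.
Proof.
rewrite /updl; case: eqP => [->|_]; last by right.
by rewrite inE => /predU1P[->|]; [left|right].
Qed.

Lemma mem_updl wl i w j x : x \in wl j -> x \in updl wl i (w :: wl i) j.
Proof. by rewrite /updl; case: eqP => // -> h; rewrite inE h orbT. Qed.

Lemma mem_updl_head wl i w : w \in updl wl i (w :: wl i) i.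
Proof. by rewrite /updl eqxx inE eqxx. Qed.

Lemma count_lt (P Q : pred nat) (s : seq nat) x :
  {subset P <= Q} -> x \in s -> ~~ P x -> Q x -> count P s < count Q s.
Proof.
move=> sub; elim: s => //= y s IH; rewrite inE => /predU1P[<-|xs] nP Qx.
  by rewrite (negPf nP) Qx ltnS; apply: sub_count.
have := IH xs nP Qx; have := sub y; rewrite /in_mem /=.
by case: (P y); case: (Q y) => // h; lia.
Qed.

Lemma inv_arc K S wl : inv K S wl -> cur S != 0 ->
  let wl' := updl wl (lev S) (tgt (cur S) :: wl (lev S)) in
  inv K (do_arc S) wl' /\ potential (do_arc S) wl' < potential S wl.
Proof.
move=> I c0 wl'.
have [cA srcc] := i_cur I; have vtxR : inR S (lev S) (vtx S).
  by apply: (i_vtx I); rewrite (negPf c0).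
have cr : 0 < cur S <= A by rewrite lt0n c0.
have nfr : ~ fresh S by move=> /(i_fresh I)[h]; rewrite h in c0.
have pend e : pending_arc (do_arc S) e -> pending_arc S e.
  rewrite /pending_arc /= => /orP[->//|/andP[-> h]]; rewrite (leq_trans h) ?orbT //.
  exact/ltnW/(ad_nxt_lt adj).
have npend : ~~ pending_arc (do_arc S) (cur S).
  rewrite /pending_arc /= srcc // eqxx /= negb_or -lt0n -ltnNge.
  by case: vtxR => _ -> _; apply: (ad_nxt_lt adj).
have lt_left : arcs_left (do_arc S) < arcs_left S.
  apply: (@count_lt _ _ _ (cur S)); first exact: pend.
  - by rewrite mem_iota; lia.
  - exact: npend.
  - by rewrite /pending_arc srcc // eqxx leqnn orbT.
split; last first.
  rewrite /potential /wl' /= sum_updl //; move: (\sum_(j < _) _) lt_left => s; lia.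
split=> //=.
- exact: (i_num I).
- exact: (i_cnt I).
- exact: (i_bnd0 I).
- exact: (i_bnd I).
- exact: (i_bndl I).
- exact: (i_apx I).
- by move=> j; apply: chain_push; [apply: (i_chain I) | case: (i_fr I)].
- by move=> i li; rewrite /wl' /updl gtn_eqF // (i_above I).
- move=> i w il /updl_mem[[-> ->]|/(i_cand I il)//]; split.
    have /allP h := pg_pl graph.
    by case: (arc_pl cr) => /h /andP[].
  apply: Or32; exists (vtx S); first by case: vtxR.
  by rewrite -srcc //; apply: arc_pl.
- exact: (i_conn I).
- move=> e eA ne; have [pe|npe] := boolP (pending_arc S e).
    right; exists (lev S); split=> //; last first.
      (* No other arc ceases to be pending, because [nxt] skips no arc with the same source. *)
      suff -> : e = cur S by apply: mem_updl_head.
      move: pe ne; rewrite /pending_arc /= => /orP[->//|/andP[/eqP se ec]].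
      rewrite negb_or se eqxx /= -ltnNge => /andP[_ h].
      apply/eqP; rewrite eqn_leq ec leqNgt /=; apply/negP => h'.
      have := ad_nxt_max adj cr h'; rewrite se srcc // => /(_ erefl); lia.
    by move: pe ne; rewrite /pending_arc /= => /orP[->//|/andP[/eqP-> _]].
  have [->|[i [il ri ti]]] := i_arc I eA npe; first by left.
  by right; exists i; split=> //; apply: mem_updl.
- move=> o op pjo l0 r0; have [h|[i [il oi h]]] := i_par I op pjo l0 r0; first by left.
  by right; exists i; split=> //; apply: mem_updl.
- exact: (i_apex I).
- exact: (i_unseen I).
- exact: (i_seen I).
- split; first by have := ad_nxt_lt adj cr; lia.
  by move=> h; rewrite (ad_nxt adj) // srcc.
- exact: (i_pj I).
- exact: (i_ap I).
- by have [f0 f1] := i_fr I; split=> //; lia.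
Qed.

Lemma inner_mono S S' i j s x y :
  (forall w, inR S i w -> inR S' j w) -> linked (inner S i s) x y ->
  linked (inner S' j s) x y.
Proof.
move=> sub; apply: linked_mono => a b [ra rb h]; apply: linked_step; split; auto.
by case: h => [h|[h1 h2 h3 h4]]; [left|right; split; auto].
Qed.

Definition do_ap0 S := Explore (cnt S) (lev S) (cur S) (pj S) 0 (vtx S) (fr S)
  (num S) (seen S) (bnd S) (apx S) (hd S) (item S) (nnx S).

Lemma inv_ap0 K S wl : inv K S wl -> cur S = 0 -> pj S = 0 -> ap S != 0 ->
  num S (ap S) != 0 ->
  inv K (do_ap0 S) wl /\ potential (do_ap0 S) wl < potential S wl.
Proof.
move=> I c0 p0 a0 na.
have nfr : ~ fresh S by move=> /(i_fresh I)[_ _ h]; rewrite h in a0.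
have [vp apE] := i_ap I a0.
split.
  2: by rewrite /potential /arcs_left /pending_arc /= a0; move: (count _ _) (\sum_(_ < _) _) => c s; lia.
split=> //=; try by case: I.
- move=> o op no _; have [->|/eqP ne] := eqVneq o (vtx S); first by left; rewrite -apE.
  by apply: (i_apex I) => // -[].
- by rewrite c0 p0.
- by have [f0 f1] := i_fr I; split=> //; move: f1; rewrite a0 /arcs_left /pending_arc /=; lia.
Qed.

Definition do_push S := Explore (cnt S) (lev S).+1 (cur S) (pj S) 0 (vtx S) (fr S).+1
  (num S) (seen S) (upd (bnd S) (lev S).+1 (cnt S).+1)
  (upd (apx S) (lev S).+1 (vtx S)) (upd (hd S) (lev S).+1 (fr S))
  (upd (item S) (fr S) (ap S)) (upd (nnx S) (fr S) (hd S (lev S).+1)).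

(** The new bound exceeds all visit numbers, so the former top region loses nothing. *)
Lemma inR_push K S wl i w : inv K S wl -> i <= lev S ->
  inR (do_push S) i w <-> inR S i w.
Proof.
move=> I il; rewrite /inR /do_push /= /upd (ltn_eqF (il : i < (lev S).+1)) eqSS ltnS.
have [->|/negPf ne] := eqVneq i (lev S).
  by rewrite ltnn ltnS leqnn (leq_num I); split=> -[h1 h2 _].
by rewrite (ltn_neqAle i) ne il.
Qed.

Lemma inv_push K S wl : inv K S wl -> cur S = 0 -> pj S = 0 -> ap S != 0 ->
  num S (ap S) = 0 ->
  let wl' := updl wl (lev S).+1 (ap S :: wl (lev S).+1) in
  inv K (do_push S) wl' /\ potential (do_push S) wl' < potential S wl.
Proof.
move=> I c0 p0 a0 na wl'.
have nfr : ~ fresh S by move=> /(i_fresh I)[_ _ h]; rewrite h in a0.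
have vtxR : inR S (lev S) (vtx S) by apply: (i_vtx I); rewrite (negPf a0) !andbF.
have [vp apE] := i_ap I a0; have wl0 : wl (lev S).+1 = [::] by apply: (i_above I).
have RP i w : i <= lev S -> inR (do_push S) i w <-> inR S i w by apply: (inR_push _ I).
have frP : fresh (do_push S) by rewrite /fresh /do_push /= /upd eqxx.
have wlE i : i <= lev S -> wl' i = wl i by move=> il; rewrite /wl' /updl ltn_eqF.
have bE i : i <= lev S -> upd (bnd S) (lev S).+1 (cnt S).+1 i = bnd S i.
  by move=> il; rewrite /upd ltn_eqF.
split; last first.
  rewrite /potential /do_push /= big_ord_recr /= {2}/wl' /updl eqxx wl0 /= a0.
  rewrite (eq_bigr (fun i : 'I_(lev S).+1 => size (wl i))); last first.
    by move=> i _; rewrite wlE // -ltnS.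
  by rewrite /arcs_left /pending_arc /=; move: (count _ _) (\sum_(_ < _) _) => s t; lia.
split=> //=.
- exact: (i_num I).
- exact: (i_cnt I).
- by rewrite bE // (i_bnd0 I).
- move=> i; rewrite ltnS leq_eqVlt => /predU1P[->|il].
    by rewrite bE // /upd eqxx ltn_neqAle (i_bndl I) andbT; apply/eqP.
  by rewrite !bE ?(i_bnd I) // ltnW.
- by rewrite /upd eqxx.
- move=> i; rewrite ltnS leq_eqVlt => /predU1P[->|il].
    by rewrite /upd eqxx; split=> //; [apply/RP | right].
  rewrite /upd eqSS (ltn_eqF il); have [h1 h2 h3] := i_apx I il.
  split=> //; first by apply/RP => //; exact: ltnW.
  by case: h3 => [h|[_ /nfr//]]; left; apply/RP.
- move=> _; split=> //; exists (ap S); rewrite /wl' /updl /upd eqxx wl0; split=> //.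
- by move=> j; apply: chain_push; [apply: (i_chain I) | case: (i_fr I)].
- by move=> i li; rewrite /wl' /updl gtn_eqF // (i_above I) // ltnW.
- move=> i w; rewrite leq_eqVlt => /predU1P[->|il].
    rewrite /wl' /updl eqxx wl0 inE => /eqP->; split; last exact: Or31.
    by rewrite apE; case: (pg_pars graph vp).
  rewrite wlE // => /(i_cand I il)[wn h]; split=> //; rewrite bE //.
  by case: h => [[_ /nfr//]|h|h]; [apply: Or32|apply: Or33].
- move=> i s x y; rewrite leq_eqVlt => /predU1P[->|il].
    by case=> /=; rewrite /upd eqxx; have := leq_num I x; lia.
  move=> /(RP _ _ il) rx /(RP _ _ il) ry; have := i_conn I s il rx ry.
  by apply: inner_mono => w /RP; apply.
- move=> e eA ne; have [h|[i [il ri ti]]] := i_arc I eA ne; first by left.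
  by right; exists i; split; [apply: leqW | apply/RP | rewrite wlE].
- move=> o op pjo l0 r0; have [h|[i [il oi h]]] := i_par I op pjo l0 r0; first by left.
  right; exists i; split; [exact: leqW | by rewrite wlE |].
  by case: h => h; [left|right]; apply/RP.
- move=> o op no _; have [->|/eqP ne] := eqVneq o (vtx S).
    by right; rewrite /upd eqxx.
  by case: (i_apex I op no) => [[]//|h|[]//]; left.
- exact: (i_unseen I).
- exact: (i_seen I).
- exact: (i_cur I).
- by rewrite p0.
- by rewrite c0 p0.
- by have [f0 f1] := i_fr I; split=> //; rewrite /arcs_left /pending_arc /= in f1 *; lia.
Qed.

Lemma chain_pop K S wl w r : inv K S wl -> wl (lev S) = w :: r -> forall j,
  chain (item S) (nnx S) (fr S) (upd (hd S) (lev S) (nnx S (hd S (lev S))) j)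
    (updl wl (lev S) r j).
Proof.
move=> I wlE j; rewrite /updl [upd _ _ _ j]/upd; case: eqP => [_|_]; last exact: (i_chain I).
by have := i_chain I (lev S); rewrite wlE => -[].
Qed.

Lemma sum_pop wl w r l : wl l = w :: r ->
  \sum_(j < l.+1) size (wl j) = (\sum_(j < l.+1) size (updl wl l r j)).+1.
Proof.
move=> wlE; rewrite !big_ord_recr /= [in RHS]/updl eqxx wlE /= addnS; congr (_ + _).+1.
by apply: eq_bigr => j _; rewrite ltn_eqF.
Qed.

Lemma mem_pop wl w r l i x : wl l = w :: r -> x \in wl i ->
  x = w \/ x \in updl wl l r i.
Proof.
move=> wlE; rewrite /updl; case: eqP => [->|_]; last by right.
by rewrite wlE inE => /predU1P[->|]; [left|right].
Qed.

Lemma pop_mem wl w r l i x : wl l = w :: r -> x \in updl wl l r i -> x \in wl i.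
Proof.
by move=> wlE; rewrite /updl; case: eqP => // -> xr; rewrite wlE inE xr orbT.
Qed.

Definition do_skip S := Explore (cnt S) (lev S) (cur S) (pj S) (ap S) (vtx S) (fr S)
  (num S) (seen S) (bnd S) (apx S) (upd (hd S) (lev S) (nnx S (hd S (lev S))))
  (item S) (nnx S).

(** A vertex may wait in several cells, one for each arc handled towards it, and so may have been
    visited in the meantime. *)
Lemma inv_skip K S wl w r : inv K S wl -> wl (lev S) = w :: r -> num S w != 0 ->
  inv K (do_skip S) (updl wl (lev S) r) /\
  potential (do_skip S) (updl wl (lev S) r) < potential S wl.
Proof.
move=> I wlE nw.
have nfr : ~ fresh S.
  by move=> /(i_fresh I)[_ _ _ [l [lE nl _]]]; move: nw; rewrite wlE in lE; case: lE => -> _; rewrite nl.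
split; last first.
  rewrite /potential /arcs_left /pending_arc /= (sum_pop wlE).
  by move: (count _ _) (\sum_(_ < _) _) => c s; lia.
split=> //=; try by case: I.
- exact: chain_pop I wlE.
- by move=> i li; rewrite /updl gtn_eqF // (i_above I).
- by move=> i x il /(pop_mem wlE); apply: (i_cand I).
- move=> e eA ne; have [h|[i [il ri ti]]] := i_arc I eA ne; first by left.
  by have [->|] := mem_pop wlE ti; [left|right; exists i].
- move=> o op pjo l0 r0; have [h|[i [il oi h]]] := i_par I op pjo l0 r0; first by left.
  by have [->|] := mem_pop wlE oi; [left|right; exists i].
Qed.

Definition do_visit w S := Explore (cnt S).+1 (lev S) (head w) (pa w)
  (if w \in pars then lft w else 0) w (fr S)
  (upd (num S) w (cnt S).+1) (seen S) (bnd S) (apx S)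
  (upd (hd S) (lev S) (nnx S (hd S (lev S)))) (item S) (nnx S).

Lemma inv_visit K S wl w r : inv K S wl -> wl (lev S) = w :: r -> num S w = 0 ->
  cur S = 0 -> pj S = 0 -> ap S = 0 ->
  inv K (do_visit w S) (updl wl (lev S) r) /\
  potential (do_visit w S) (updl wl (lev S) r) < potential S wl.
Proof.
move=> I wlE nw c0 p0 a0.
have wmem : w \in wl (lev S) by rewrite wlE inE eqxx.
have [wn cand] := i_cand I (leqnn _) wmem.
have nE x : num S x != 0 -> upd (num S) w (cnt S).+1 x = num S x.
  by move=> x0; rewrite /upd; have [xw|//] := eqVneq x w; rewrite xw nw in x0.
have nwE : upd (num S) w (cnt S).+1 w = (cnt S).+1 by rewrite /upd eqxx.
have n0 x : num S x != 0 -> upd (num S) w (cnt S).+1 x != 0 by move=> h; rewrite nE.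
have n1 x : upd (num S) w (cnt S).+1 x != 0 -> x <> w -> num S x != 0.
  by rewrite /upd; have [->|] := eqVneq x w.
have Rup i x : inR S i x -> inR (do_visit w S) i x.
  by case=> h1 h2 h3; split; rewrite /= nE // -lt0n.
have Rw : inR (do_visit w S) (lev S) w.
  by split; rewrite /= ?nwE ?ltnn // (i_bndl I).
have Rdown i x : i <= lev S -> inR (do_visit w S) i x ->
    inR S i x \/ i = lev S /\ x = w.
  move=> il [/=]; rewrite /upd; case: eqP => [->|ne] h1 h2 h3; last by left.
  right; split=> //; apply/eqP; rewrite eqn_leq il leqNgt; apply/negP => il'.
  have := h3 il'; rewrite ltnNge => /negP; apply.
  exact: leq_trans (bnd_mono I il' (leqnn _)) (i_bndl I).
have nfr' : ~ fresh (do_visit w S).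
  by rewrite /fresh /= => h; have := i_bndl I; rewrite h ltnn.
have frE : fresh S -> r = [::] /\ (0 < lev S -> w = lft (apx S (lev S))).
  by move=> /(i_fresh I)[_ _ _ [l [lE _ h]]]; move: lE h; rewrite wlE => -[-> ->].
have cntE : count (fun x => upd (num S) w (cnt S).+1 x != 0) (iota 0 n) = (cnt S).+1.
  rewrite -(i_cnt I) (@count_upd (num S) _ w) ?(i_cnt I) ?nwE // => x.
  by rewrite /upd => /negPf->.
have cnt_n : cnt S < n.
  by rewrite -cntE -[n in _ <= n](size_iota 0 n) count_size.
(* The arcs from [w] were pending because [w] was unvisited; now they are because [head w] is the
   largest of them. *)
have arcsE : arcs_left (do_visit w S) = arcs_left S.
  apply: eq_in_count => e; rewrite mem_iota add1n ltnS => eA.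
  have e0 : (e <= 0) = false by case/andP: eA => h _; apply/negbTE; rewrite -ltnNge.
  rewrite /pending_arc /= c0 e0 andbF orbF /upd.
  have [se|_] := eqVneq (src e) w; last by rewrite orbF.
  by have := ad_head_max adj eA; rewrite se nw => ->; rewrite orbT.
split; last first.
  rewrite /potential arcsE /= (sum_pop wlE) /=.
  move: (arcs_left S) (\sum_(_ < _) _) => c s.
  by case: (_ != 0); case: (_ != 0); lia.
split=> //=.
- move=> x; rewrite /upd; have [->//|_ x0] := eqVneq x w.
  by have [h1 h2] := i_num I x0; split=> //; apply: leqW.
- exact: (i_bnd0 I).
- exact: (i_bnd I).
- exact/leqW/(i_bndl I).
- move=> i il; have [h1 h2 h3] := i_apx I il; split=> //; first exact: Rup.
  left; case: h3 => [h|[eq_l /frE[_ h]]]; first exact: Rup.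
  by rewrite eq_l -h //; lia.
- exact: chain_pop I wlE.
- by move=> i li; rewrite /updl gtn_eqF // (i_above I).
- move=> i x il xi; have xi' := pop_mem wlE xi.
  have [xn h] := i_cand I il xi'; split=> //.
  have bP y : bnd S i <= num S y -> bnd S i <= upd (num S) w (cnt S).+1 y.
    by move=> h'; rewrite nE // -lt0n; apply: leq_trans (bnd_gt0 I il) h'.
  case: h => [[iE /frE[r0 _]]|[y y1 y2]|[h1 h2 h3]].
  + by move: xi; rewrite iE /updl eqxx r0.
  + by apply: Or32; exists y; [apply: bP|].
  + by apply: Or33; split=> //; apply: bP.
- move=> i s x y il rx ry.
  (* Only the top region grows, so its old vertices have to be linked to [w]. The witness in
     [i_cand] does this: a plain neighbour, or, for a par, whichever premise [s] keeps. *)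
  have lw z : inR (do_visit w S) i z -> i = lev S -> linked (inner (do_visit w S) i s) z w.
    move=> rz iE; subst i; case: (Rdown _ _ il rz) => [{}rz|[_ ->]]; last exact: linked_refl.
    have to_w y0 : inR S (lev S) y0 -> linked (inner (do_visit w S) (lev S) s) y0 w ->
        linked (inner (do_visit w S) (lev S) s) z w.
      by move=> ry0; apply: linked_trans; apply: inner_mono _ (i_conn I s il rz ry0); auto.
    case: cand => [[_ fre]|[y0 y1 y2]|[h1 h2 h3]].
    + by case: rz => h1 _ _; have := leq_num I z; rewrite fre in h1; lia.
    + have ry0 := inR_top I y1; apply: (to_w _ ry0).
      case: y2 => h; last apply: linked_sym; apply: linked_step; split; auto.
    + have rl := inR_top I h2; have rr := inR_top I h3.
      have rc : inR S (lev S) (if s w then lft w else rgt w) by case: ifP.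
      apply: (to_w _ rc); apply: linked_sym; apply: linked_step; split; auto.
      by right; split; auto.
  case: (Rdown _ _ il rx) => [rx'|[iE _]].
    case: (Rdown _ _ il ry) => [ry'|[iE _]].
      by apply: inner_mono _ (i_conn I s il rx' ry'); auto.
    by apply: linked_trans (lw _ rx iE) (linked_sym (lw _ ry iE)).
  by apply: linked_trans (lw _ rx iE) (linked_sym (lw _ ry iE)).
- move=> e eA; rewrite /pending_arc /= negb_or => /andP[s0 s1].
  have sw : src e <> w by move=> h; move: s1; rewrite h eqxx /= -h (ad_head_max adj eA).
  have ne : ~~ pending_arc S e.
    rewrite /pending_arc negb_or (n1 _ s0 sw) c0 leqn0 negb_and.
    by rewrite -(lt0n e); case/andP: eA => -> _; rewrite orbT.
  have [h|[i [il ri ti]]] := i_arc I eA ne; first by left; apply: n0.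
  have [->|h] := mem_pop wlE ti; first by left; rewrite nwE.
  by right; exists i; split; auto.
- move=> o op pjo l0 r0.
  have lw : lft o <> w by move=> h; apply: pjo; rewrite (pg_pa_premise graph op) //; left.
  have rw : rgt o <> w by move=> h; apply: pjo; rewrite (pg_pa_premise graph op) //; right.
  have pj0 : pj S <> o.+1 by rewrite p0.
  have [h|[i [il oi h]]] := i_par I op pj0 (n1 _ l0 lw) (n1 _ r0 rw); first by left; apply: n0.
  have [->|h'] := mem_pop wlE oi; first by left; rewrite nwE.
  right; exists i; split=> //; case: h; auto.
- move=> o op no apo; left.
  have ow : o <> w.
    move=> h; apply: apo; split=> //; rewrite -h op -lt0n.
    by case: (pg_pars graph op).
  have [|h|[/frE[_ h] l0 ->]] := i_apex I op (n1 _ no ow).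
  + by rewrite a0; case.
  + exact: n0.
  + by rewrite -h // nwE.
- move=> o y op py so; have [yw|/eqP ne] := eqVneq y w.
    by move=> _; split=> //; rewrite -yw; apply: (pg_pa_premise graph op).
  by move=> /n1/(_ ne)/(i_unseen I op py so); rewrite p0; case.
- move=> o op so; have [y [h1 h2 _]] := i_seen I op so; exists y.
  have y0 : num S y != 0 by rewrite -h2.
  by split; rewrite ?nE // => -[_ yw]; rewrite yw nw in y0.
- by split; [apply: (ad_headA adj) | apply: (ad_head adj)].
- case E: (pa w) => [//|o] _; have [h1 h2] := pg_pa graph E.
  by exists o.
- by case: ifP.
- have [f0 f1] := i_fr I; split=> //; rewrite arcsE; move: f1; rewrite p0 a0 /=.
  by case: (_ != 0); case: (_ != 0); lia.
Qed.

Definition do_seen o S := Explore (cnt S) (lev S) (cur S) 0 (ap S) (vtx S) (fr S)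
  (num S) (upd (seen S) o (num S (vtx S))) (bnd S) (apx S) (hd S) (item S) (nnx S).

Lemma inv_seen K S wl o : inv K S wl -> pj S = o.+1 -> seen S o = 0 ->
  inv K (do_seen o S) wl /\ potential (do_seen o S) wl < potential S wl.
Proof.
move=> I pjE so; have pj0 : pj S != 0 by rewrite pjE.
have [o' [op pjE' pv]] := i_pj I pj0.
have eo : o' = o by move: pjE'; rewrite pjE => -[].
move: op pv; rewrite {o' pjE'}eo => op pv.
have nfr : ~ fresh S by move=> /(i_fresh I)[_ h]; rewrite h in pj0.
have vR : inR S (lev S) (vtx S) by apply: (i_vtx I); rewrite (negPf pj0) !andbF.
have v0 : num S (vtx S) != 0 by case: vR => _; rewrite lt0n.
(* As [seen o] is still 0, a visited premise of [o] can only be the current vertex; the two premises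
   cannot both be visited yet. *)
have other y : premise o y -> num S y != 0 -> y = vtx S.
  by move=> py ny; case: (i_unseen I op py so ny).
split; last first.
  rewrite /potential /arcs_left /pending_arc /= pj0.
  by move: (count _ _) (\sum_(_ < _) _) => c s; lia.
split=> //=; try by case: I.
- move=> o1 op1 _ l0 r0; have [eo|/eqP ne] := eqVneq o1 o.
    subst o1; case: (pg_neq graph op).
    have e1 := other _ (or_introl erefl) l0; have e2 := other _ (or_intror erefl) r0.
    by rewrite e1 e2.
  by apply: (i_par I op1) => //; rewrite pjE => -[] /esym.
- move=> o1 y op1 py; rewrite /upd; have [_ vE|ne so1 y0] := eqVneq o1 o.
    by rewrite vE in v0.
  have [] := i_unseen I op1 py so1 y0; rewrite pjE => -[eo].
  by rewrite eo eqxx in ne.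
- move=> o1 op1; rewrite /upd; have [-> _|ne so1] := eqVneq o1 o.
    by exists (vtx S); split=> // -[].
  have [y [h1 h2 h3]] := i_seen I op1 so1; exists y; split=> //.
  by case.
- by have [f0 f1] := i_fr I; split=> //; move: f1; rewrite pj0 /arcs_left /pending_arc /=; lia.
Qed.

Definition do_wait o j S := Explore (cnt S) (lev S) (cur S) 0 (ap S) (vtx S) (fr S).+1
  (num S) (seen S) (bnd S) (apx S) (upd (hd S) j (fr S))
  (upd (item S) (fr S) o) (upd (nnx S) (fr S) (hd S j)).

(** [j] is the region of the premise visited first. The other premise is the current vertex, in the
    top region, so both visit numbers are at least [bnd j]. They lie in one region by the time
    region [j] is on top. *)
Lemma inv_wait K S wl o j : inv K S wl -> pj S = o.+1 -> seen S o != 0 ->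
  j <= lev S -> bnd S j <= seen S o -> (j < lev S -> seen S o < bnd S j.+1) ->
  inv K (do_wait o j S) (updl wl j (o :: wl j)) /\
  potential (do_wait o j S) (updl wl j (o :: wl j)) < potential S wl.
Proof.
move=> I pjE so jl jb jb'; have pj0 : pj S != 0 by rewrite pjE.
have [o' [op pjE' pv]] := i_pj I pj0.
have eo : o' = o by move: pjE'; rewrite pjE => -[].
move: op pv; rewrite {o' pjE'}eo => op pv.
have nfr : ~ fresh S by move=> /(i_fresh I)[_ h]; rewrite h in pj0.
have vR : inR S (lev S) (vtx S) by apply: (i_vtx I); rewrite (negPf pj0) !andbF.
have [y [py sy ny]] := i_seen I op so.
have jv : bnd S j <= num S (vtx S).
  by case: vR => h _ _; apply: leq_trans (bnd_mono I jl _) h.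
have jy : bnd S j <= num S y by rewrite -sy.
have nyv : y <> vtx S by move=> h; apply: ny.
have [jlft jrgt] : bnd S j <= num S (lft o) /\ bnd S j <= num S (rgt o).
  case: py => yE; case: pv => vE; try by case: nyv; rewrite yE vE.
    by rewrite -yE -vE.
  by rewrite -yE -vE.
have Ry : inR S j (lft o) \/ inR S j (rgt o).
  have h : inR S j y by split; rewrite -?sy // lt0n.
  by case: py => <-; [left|right].
split; last first.
  rewrite /potential /arcs_left /pending_arc /= sum_updl // pj0.
  by move: (count _ _) (\sum_(_ < _) _) => c s; lia.
split=> //=; try by case: I.
- by move=> i; apply: chain_push; [apply: (i_chain I) | case: (i_fr I)].
- move=> i li; rewrite /updl gtn_eqF ?(i_above I) //; exact: leq_ltn_trans jl li.
- move=> i w il /updl_mem[[-> ->]|/(i_cand I il)//]; split; last exact: Or33.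
  by case: (pg_pars graph op).
- move=> e eA ne; have [h|[i [il ri ti]]] := i_arc I eA ne; first by left.
  by right; exists i; split=> //; apply: mem_updl.
- move=> o1 op1 _ l0 r0; have [->|/eqP ne] := eqVneq o1 o.
    by right; exists j; split=> //; apply: mem_updl_head.
  have pjn : pj S <> o1.+1 by rewrite pjE => -[] /esym.
  have [h|[i [il oi h]]] := i_par I op1 pjn l0 r0; first by left.
  by right; exists i; split=> //; apply: mem_updl.
- move=> o1 z op1 pz so1 z0.
  have [] := i_unseen I op1 pz so1 z0; rewrite pjE => -[eo].
  by rewrite eo so1 in so.
- move=> o1 op1 so1; have [z [h1 h2 h3]] := i_seen I op1 so1; exists z; split=> //.
  by case.
- by have [f0 f1] := i_fr I; split=> //; move: f1; rewrite pj0 /arcs_left /pending_arc /=; lia.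
Qed.

Definition do_pop S := Explore (cnt S) (lev S).-1 (cur S) (pj S) (ap S) (vtx S) (fr S)
  (num S) (seen S) (bnd S) (apx S) (hd S) (item S) (nnx S).

(** The par that opened the top region lies in the region below and has both premises in the top
    one. Whichever of its edges a switching keeps, this edge joins the two regions. *)
Lemma inv_pop K S wl : inv K S wl -> wl (lev S) = [::] -> 0 < lev S ->
  cur S = 0 -> pj S = 0 -> ap S = 0 ->
  bnd S (lev S) <= num S (rgt (apx S (lev S))) ->
  inv K (do_pop S) wl /\ potential (do_pop S) wl < potential S wl.
Proof.
move=> I wl0 l0 c0 p0 a0 br.
have nfr : ~ fresh S by move=> /(i_fresh I)[_ _ _ [l [lE]]]; rewrite wl0 in lE.
have [k kE] : exists k, lev S = k.+1 by exists (lev S).-1; lia.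
have kl : k < lev S by rewrite kE.
have Rup i x : i <= k -> inR S i x -> inR (do_pop S) i x.
  by move=> ik [h1 h2 h3]; split=> //=; rewrite kE /= => h; apply: h3; lia.
have Rup' x : inR S (lev S) x -> inR (do_pop S) k x.
  move=> [h1 h2 h3]; split=> //=; last by rewrite kE ltnn.
  exact: leq_trans (bnd_mono I (ltnW kl) _) h1.
have Rdown i x : i <= k -> inR (do_pop S) i x -> inR S i x \/ i = k /\ inR S (lev S) x.
  move=> ik; rewrite /inR /= kE /= => -[h1 h2 h3].
  have [ik'|ik'] := ltnP i k; first by left; split=> // _; apply: h3.
  have {ik'}ik : i = k by lia.
  subst i; have [h|h] := ltnP (num S x) (bnd S k.+1); first by left.
  by right; split=> //; split=> //; rewrite ltnn.
have nfr' : ~ fresh (do_pop S).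
  rewrite /fresh /= kE /= => h; have := i_bnd I kl; have := i_bndl I.
  by rewrite kE h; lia.
have [po oR lR] := i_apx I kl.
have {}lR : inR S (lev S) (lft (apx S k.+1)) by case: lR => [|[_ /nfr//]]; rewrite kE.
have rR : inR S (lev S) (rgt (apx S k.+1)) by rewrite -kE; apply: (inR_top I).
have le_k i : i <= lev S -> wl i <> [::] -> i <= k.
  move=> il wi; rewrite -ltnS -kE ltn_neqAle il andbT; apply/eqP => iE.
  by rewrite iE in wi.
have nn x i : x \in wl i -> wl i <> [::] by move=> h e; rewrite e in h.
split; last first.
  rewrite /potential /arcs_left /pending_arc /= (prednK l0) [X in _ < _ + X + _ + _ + _ + _]big_ord_recr /= wl0 addn0.
  by move: (count _ _) (\sum_(_ < _) _) => c s; lia.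
split=> //=; try by case: I.
- by move=> i; rewrite kE /= => ik; apply: (i_bnd I); lia.
- by rewrite kE /=; have := i_bnd I kl; have := i_bndl I; rewrite kE; lia.
- move=> i; rewrite kE /= => ik; have il : i < lev S by lia.
  have [h1 h2 h3] := i_apx I il; split=> //; first by apply: Rup => //; lia.
  by left; case: h3 => [h|[_ /nfr//]]; apply: Rup.
- move=> i; rewrite kE /= => ik; have [->|ne] := eqVneq i (lev S); first by [].
  by apply: (i_above I); lia.
- move=> i w; rewrite kE /= => ik wi; have il : i <= lev S by lia.
  have [h1 h2] := i_cand I il wi; split=> //.
  by case: h2 => [[_ /nfr//]|h|h]; [apply: Or32|apply: Or33].
- move=> i s x y; rewrite kE /= => ik rx ry; have il : i <= lev S by lia.
  have to_o z : inR (do_pop S) k z -> linked (inner (do_pop S) k s) z (apx S k.+1).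
    move=> /(Rdown _ _ (leqnn _))[rz|[_ rz]].
      by apply: inner_mono _ (i_conn I s (ltnW kl) rz oR); auto.
    have rc : inR S (lev S) (if s (apx S k.+1) then lft (apx S k.+1) else rgt (apx S k.+1)).
      by case: ifP.
    apply: linked_trans (inner_mono _ (i_conn I s (leqnn _) rz rc)) _; first by auto.
    by apply: linked_sym; apply: linked_step; split; auto; right; split; auto.
  case: (Rdown _ _ ik rx) => [rx'|[iE rx']].
    case: (Rdown _ _ ik ry) => [ry'|[iE ry']].
      by apply: inner_mono _ (i_conn I s il rx' ry'); auto.
    by subst i; apply: linked_trans (to_o _ rx) (linked_sym (to_o _ ry)).
  by subst i; apply: linked_trans (to_o _ rx) (linked_sym (to_o _ ry)).
- move=> e eA ne; have [h|[i [il ri ti]]] := i_arc I eA ne; first by left.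
  have ik := le_k _ il (nn _ _ ti).
  by right; exists i; rewrite kE /=; split; auto.
- move=> o op pjo lf0 r0; have [h|[i [il oi h]]] := i_par I op pjo lf0 r0; first by left.
  have ik := le_k _ il (nn _ _ oi).
  by right; exists i; rewrite kE /=; split=> //; case: h => h; auto.
- move=> o op no apo; left.
  by case: (i_apex I op no apo) => [//|[/nfr//]].
- by rewrite c0 p0 a0.
Qed.

Definition start_lists i : seq nat := if i == 0 then [:: 0] else [::].

(** Region 0 starts out fresh, with vertex 0 as its seed in cell 1. The potential is bounded by two
    for each arc, six for each vertex and one for the seed. *)
Lemma inv_start K v num0 seen0 bnd0 apx0 hd0 item0 nnx0 :
  (forall x, num0 x = 0) -> (forall x, seen0 x = 0) -> bnd0 0 = 1 -> hd0 0 = 1 ->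
  (forall i, 0 < i -> hd0 i = 0) -> item0 1 = 0 -> nnx0 1 = 0 -> A + 3 * n + 2 <= K ->
  let S := Explore 0 0 0 0 0 v 2 num0 seen0 bnd0 apx0 hd0 item0 nnx0 in
  inv K S start_lists /\ potential S start_lists <= 2 * A + 6 * n + 1.
Proof.
move=> num_0 seen_0 b0 h0 hi it nn AK S.
have nR i w : ~ inR S i w by case=> _; rewrite /= num_0.
have leftA : arcs_left S <= A.
  by rewrite -[X in _ <= X](size_iota 1 A) count_size.
split; last first.
  by rewrite /potential /= big_ord_recr big_ord0 /=; lia.
split=> //=.
- by move=> w; rewrite num_0.
- by rewrite (eq_count (a2 := pred0)) ?count_pred0 // => w; rewrite /= num_0.
- by rewrite b0.
- by move=> _; split=> //; exists 0; split.
- by case=> [|i] /=; [split; rewrite ?h0 | apply: hi].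
- by case.
- move=> i w; rewrite leqn0 => /eqP->; rewrite inE => /eqP->; split; first exact: (pg_n graph).
  by apply: Or31; split=> //; rewrite /fresh /= b0.
- by move=> i s x y _ /nR.
- by move=> e _; rewrite /pending_arc /= num_0.
- by move=> o _ _; rewrite num_0.
- by move=> o _; rewrite num_0.
- by move=> o y _ _ _; rewrite num_0.
- by move=> o _; rewrite seen_0.
- by split=> //; lia.
Qed.

(** * The outcomes of the exploration: acceptance and rejection *)

Lemma inner_switch S i s x y : inner S i s x y -> edge_rel (switch s) x y.
Proof.
case=> _ _ [h|[xp -> _ _]]; rewrite /edge_rel mem_cat; first by rewrite h.
by rewrite map_f ?orbT.
Qed.

Lemma accept_linked K S wl : inv K S wl -> lev S = 0 -> cnt S = n ->
  forall s u v, u < n -> v < n -> linked (edge_rel (switch s)) u v.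
Proof.
move=> I l0 cn s u v un vn.
have vis x : x < n -> inR S 0 x.
  move=> xn; suff: inR S (lev S) x by rewrite l0.
  apply: (inR_top I); rewrite l0 (i_bnd0 I) lt0n.
  have /allP/(_ x) : all (fun w => num S w != 0) (iota 0 n).
    by rewrite all_count (i_cnt I) size_iota cn.
  by rewrite mem_iota => /(_ xn).
apply: linked_mono (i_conn I s _ (vis _ un) (vis _ vn)) => // a b /inner_switch.
exact: linked_step.
Qed.

Lemma switch_below s : endpoints_below n (switch s).
Proof.
have := pg_pl graph; rewrite /endpoints_below all_cat => -> /=.
rewrite all_map; apply/allP => o /= op.
by case: (pg_pars graph op) => -> _ h1 h2; case: ifP.
Qed.

Lemma size_switch s : (size (switch s)).+1 = n.
Proof. by rewrite size_cat size_map (pg_size graph). Qed.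

Section Stuck.

Variables (K : nat) (S : explore) (wl : nat -> seq nat).
Hypothesis I : inv K S wl.
Hypotheses (c0 : cur S = 0) (p0 : pj S = 0) (a0 : ap S = 0).
Hypothesis wl0 : wl (lev S) = [::].
Hypothesis stuck : (lev S = 0 /\ cnt S <> n) \/
  (0 < lev S /\ num S (rgt (apx S (lev S))) < bnd S (lev S)).
Hypothesis linked_all :
  forall s u v, u < n -> v < n -> linked (edge_rel (switch s)) u v.

Lemma stuck_nfresh : ~ fresh S.
Proof. by move=> /(i_fresh I)[_ _ _ [l [lE]]]; rewrite wl0 in lE. Qed.

(* Keeping the left premise of every open par joins all the regions on the stack. *)
Lemma linked_regions (E : nat -> nat -> Prop) j x y :
  (forall i a b, i <= lev S -> inner S i (fun=> true) a b -> E a b) ->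
  (forall i, i < lev S -> j <= i -> E (apx S i.+1) (lft (apx S i.+1))) ->
  j <= lev S -> inR S j x -> inR S (lev S) y -> linked E x y.
Proof.
move=> Ein Eap jl; move: x; move kE : (lev S - j) => k.
have in_reg i a b : i <= lev S -> inR S i a -> inR S i b -> linked E a b.
  move=> il ra rb; apply: linked_mono (i_conn I (fun=> true) il ra rb) => u v h.
  exact: linked_step (Ein _ _ _ il h).
elim: k j jl kE Eap => [|k IH] j jl kE Eap x rx ry.
  have jE : j = lev S by lia.
  by subst j; apply: in_reg ry.
have jl' : j < lev S by lia.
have [po oR lR] := i_apx I jl'.
have {}lR : inR S j.+1 (lft (apx S j.+1)) by case: lR => // -[_ /stuck_nfresh].
apply: linked_trans (in_reg _ _ _ jl rx oR) _.
apply: linked_trans (linked_step (Eap j jl' (leqnn _))) _.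
by apply: (IH j.+1) lR ry => //; [lia | move=> i il ji; apply: Eap; lia].
Qed.

Lemma mem_split (T : eqType) (x : T) (s : seq T) :
  x \in s -> exists s1 s2, s = s1 ++ x :: s2.
Proof. by case/splitPr => s1 s2; exists s1, s2. Qed.

(** In the switching that keeps all left premises, the regions are already joined along the pars
    that opened them; a plain edge from the top to a lower region could be spared. *)
Lemma plain_redundant x y j : (x, y) \in pl \/ (y, x) \in pl ->
  inR S (lev S) x -> j < lev S -> inR S j y -> False.
Proof.
move=> xy rx jl ry.
have [e el ee] : exists2 e, e \in pl & e = (x, y) \/ e = (y, x).
  by case: xy => h; [exists (x, y)|exists (y, x)]; auto.
have [p1 [p2 plE]] := mem_split el.
pose pe := [seq (o, lft o) | o <- pars].
have swE : switch (fun=> true) = p1 ++ e :: (p2 ++ pe) by rewrite /switch plE -catA.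
have ends := switch_below (fun=> true); have con := linked_all (fun=> true).
have sz := size_switch (fun=> true); rewrite swE in ends con sz.
apply: (redundant_edge ends con); first by rewrite sz.
suff yx : linked (edge_rel (p1 ++ p2 ++ pe)) y x.
  by case: ee => -> //=; apply: linked_sym.
apply: (linked_regions _ _ (ltnW jl) ry rx) => [i a b il [ra rb h]|i il ji]; last first.
  by have [po _ _] := i_apx I il; rewrite /edge_rel !mem_cat map_f ?orbT.
case: h => [|[ap -> _ _]]; last by rewrite /edge_rel !mem_cat map_f ?orbT.
(* An edge inside a region differs from [e], whose ends lie in different regions. *)
rewrite plE /edge_rel !mem_cat inE => /or3P[->//|/eqP abE|->]; last by rewrite orbT.
have xi : inR S i x by move: abE ra rb; case: ee => -> [-> ->].
have yi : inR S i y by move: abE ra rb; case: ee => -> [-> ->].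
have := inR_uniq I il (leqnn _) xi rx; have := inR_uniq I il (ltnW jl) yi ry; lia.
Qed.

(** Here it is the left edge of [o] that could be spared. The last two premises say that it is in
    use neither as an edge certifying a region nor as a link between consecutive regions. *)
Lemma par_redundant o a b : o \in pars -> a <= lev S -> b <= lev S ->
  inR S a o -> inR S b (lft o) -> a = lev S \/ b = lev S ->
  (forall i, i <= lev S -> inR S i o -> inR S i (lft o) -> inR S i (rgt o) -> False) ->
  (forall i, i < lev S -> minn a b <= i -> apx S i.+1 <> o) -> False.
Proof.
move=> op al bl ra rb ab nfull napx.
have [q1 [q2 qE]] := mem_split op.
pose pe := map (fun o => (o, lft o)).
have swE : switch (fun=> true) = (pl ++ pe q1) ++ (o, lft o) :: pe q2.
  by rewrite /switch qE map_cat catA.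
have ends := switch_below (fun=> true); have con := linked_all (fun=> true).
have sz := size_switch (fun=> true); rewrite swE in ends con sz.
apply: (redundant_edge ends con); first by rewrite sz.
have inpe x : x \in pars -> x <> o -> edge_rel ((pl ++ pe q1) ++ pe q2) x (lft x).
  rewrite qE /edge_rel !mem_cat inE => /or3P[h|/eqP//|h] _.
    by rewrite [(x, _) \in pe q1]map_f ?orbT.
  by rewrite [(x, _) \in pe q2]map_f ?orbT.
have Ein i u v : i <= lev S -> inner S i (fun=> true) u v ->
    edge_rel ((pl ++ pe q1) ++ pe q2) u v.
  move=> il [ru rv [h|[up -> rl rr]]]; first by rewrite /edge_rel !mem_cat h.
  by apply: inpe => // uo; subst u; apply: (nfull i).
have Eap i : i < lev S -> minn a b <= i ->
    edge_rel ((pl ++ pe q1) ++ pe q2) (apx S i.+1) (lft (apx S i.+1)).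
  by move=> il ji; apply: inpe; [case: (i_apx I il) | apply: napx].
case: ab => [aE|bE] /=.
  apply: linked_sym; rewrite aE in ra *.
  by apply: linked_regions Ein _ bl rb ra => i il bi; apply: Eap => //; rewrite geq_min bi orbT.
rewrite bE in rb.
by apply: linked_regions Ein _ al ra rb => i il bi; apply: Eap => //; rewrite geq_min bi.
Qed.

Let top x := bnd S (lev S) <= num S x.

Lemma topR x : top x -> inR S (lev S) x.
Proof. by move=> tx; apply: (inR_top I). Qed.

Lemma topW x j : j <= lev S -> inR S j x -> j = lev S -> top x.
Proof. by move=> _ [h _ _] jE; rewrite jE in h. Qed.

(** No arc is pending and the top list is empty, so [y] has been visited; in a lower region it would
    make the edge redundant. *)
Lemma plain_top x y : (x, y) \in pl \/ (y, x) \in pl -> top x -> top y.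
Proof.
move=> xy tx; have rx := topR tx.
have [e eA [se te]] : exists2 e, 0 < e <= A & src e = x /\ tgt e = y.
  by case: xy => /pl_arc[].
have ne : ~~ pending_arc S e.
  rewrite /pending_arc negb_or se c0 negb_and -(ltnNge 0).
  by case: rx => _; rewrite lt0n => -> _; case/andP: eA => -> _; rewrite orbT.
have y0 : num S y != 0.
  have [|[i [il ri]]] := i_arc I eA ne; rewrite te //.
  by rewrite (inR_uniq I il (leqnn _) ri (_ : inR S _ _)) ?wl0 // se.
have [j jl ry] := inR_ex I y0.
move: jl; rewrite leq_eqVlt => /predU1P[jE|jl]; first by apply: topW ry _; rewrite ?jE.
by case: (plain_redundant xy rx jl ry).
Qed.

(** The left premise of a visited par has been visited. Unless both premises are in the top region,
    the left edge of [o] certifies no region and is redundant, even if it runs inside the top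
    region. *)
Lemma par_top o : o \in pars -> top o -> top (lft o) && top (rgt o).
Proof.
move=> op to; have ro := topR to; apply/negPn/negP => nt.
have o0 : num S o != 0 by case: ro => _; rewrite lt0n.
have [|l0|[/stuck_nfresh//]] := i_apex I op o0; first by rewrite a0; case.
have [j jl rl] := inR_ex I l0.
apply: (par_redundant op (leqnn _) jl ro rl); first by left.
  move=> i il ri rli rri; have iE := inR_uniq I il (leqnn _) ri ro.
  by move/negP: nt; apply; rewrite (topW il rli iE) (topW il rri iE).
move=> i il _ oE; have [_ h _] := i_apx I il; rewrite oE in h.
by have := inR_uniq I (ltnW il) (leqnn _) h ro; lia.
Qed.

(** With both premises in the top region, whose list is empty, [o] has been visited, in a lower
    region. Its left edge is then redundant unless [o] opened the top region; but that par has its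
    right premise elsewhere, by [stuck]. *)
Lemma par_ntop o : o \in pars -> ~~ top o -> ~~ (top (lft o) && top (rgt o)).
Proof.
move=> op nto; apply/negP => /andP[tl tr]; have rl := topR tl; have rr := topR tr.
have l0 : num S (lft o) != 0 by case: rl => _; rewrite lt0n.
have r0 : num S (rgt o) != 0 by case: rr => _; rewrite lt0n.
have pj0 : pj S <> o.+1 by rewrite p0.
have o0 : num S o != 0.
  have [//|[i [il oi h]]] := i_par I op pj0 l0 r0.
  suff iE : i = lev S by rewrite iE wl0 in oi.
  by case: h => h; [apply: (inR_uniq I il (leqnn _) h rl) | apply: (inR_uniq I il (leqnn _) h rr)].
have [j jl ro] := inR_ex I o0.
have jl' : j < lev S.
  by rewrite ltn_neqAle jl andbT; apply: contra nto => /eqP; apply: topW ro.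
apply: (par_redundant op jl (leqnn _) ro rl); first by right.
  move=> i il ri rli _.
  have := inR_uniq I il (leqnn _) rli rl; have := inR_uniq I il jl ri ro; lia.
move=> i il _ oE; have [_ h lR] := i_apx I il; rewrite oE in h lR.
have {}lR : inR S i.+1 (lft o) by case: lR => // -[_ /stuck_nfresh].
have iE := inR_uniq I il (leqnn _) lR rl.
case: stuck => [[lE]|[_]]; first by rewrite lE in il.
by rewrite -iE oE iE ltnNge => /negP; apply.
Qed.

Lemma stuck_not_linked : False.
Proof.
(* A par outside the top region keeps a premise outside it, which exists by [par_ntop]; for a par
   inside, either choice stays inside by [par_top]. So no edge crosses the border of [top]. *)
pose s o := top o || ~~ top (lft o).
have inv_top a b : edge_rel (switch s) a b -> top a = top b.
  rewrite /edge_rel mem_cat => /orP[h|/mapP[o op [-> ->]]].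
    by apply/idP/idP; apply: plain_top; [left|right].
  case to: (top o); first by case/andP: (par_top op to) => h1 h2; case: ifP.
  rewrite /s to; have := par_ntop op (negbT to).
  by case tl: (top (lft o)) => /= h; apply/esym; rewrite ?tl //; apply: negbTE.
have same u v : u < n -> v < n -> top u = top v.
  by move=> un vn; apply: linked_invariant inv_top (linked_all s un vn).
have bl : bnd S (lev S) <= cnt S.
  by have := i_bndl I; rewrite leq_eqVlt => /predU1P[/stuck_nfresh|].
(* Both sides of the border are inhabited. With one region, some but not all vertices have been
   visited; otherwise the par that opened the top region and its left premise lie on different
   sides. *)
case: stuck => [[lE cn]|[l0 _]].
  have top0 x : top x = (num S x != 0) by rewrite /top lE (i_bnd0 I) lt0n.
  have h0 : 0 < n := pg_n graph.
  have := i_cnt I; have : 0 < cnt S by move: bl; rewrite lE (i_bnd0 I).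
  rewrite (@eq_in_count _ _ (fun=> top 0)) => [|x].
    by case: (top 0); rewrite ?count_predT ?count_pred0 ?size_iota; lia.
  by rewrite mem_iota -top0 => xn; apply: same.
have kl : (lev S).-1 < lev S by lia.
have [po oR lR] := i_apx I kl; have kE : (lev S).-1.+1 = lev S by lia.
rewrite kE in po oR lR.
have {}lR : inR S (lev S) (lft (apx S (lev S))) by case: lR => // -[_ /stuck_nfresh].
have [on _ ln _] := pg_pars graph po.
have := same _ _ on ln; have -> : top (lft (apx S (lev S))) by case: lR.
case/idP => /topR h; have := inR_uniq I (ltnW kl) (leqnn _) oR h; lia.
Qed.

End Stuck.

End Exploration.

(** * Locating the region of a vertex in constant time *)

(** The sum is a binary number whose highest bit is [e b]; the logarithm of a mask therefore finds
    the last bound in it. *)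
Lemma sum_pow_lt (e : nat -> nat) a b : a < b ->
  (forall i, a < i -> i < b -> e i < e i.+1) ->
  \sum_(a.+1 <= i < b.+1) 2 ^ e i < 2 ^ (e b).+1.
Proof.
elim: b => // b IH; rewrite ltnS leq_eqVlt => /predU1P[<- _|ab inc].
  by rewrite big_nat1 ltn_exp2l.
rewrite big_nat_recr /=; last by rewrite ltnW.
have h : e b < e b.+1 by apply: inc.
have {}IH := IH ab (fun i ai ib => inc i ai (ltnW ib)).
have : 2 ^ (e b).+1 <= 2 ^ e b.+1 by rewrite leq_exp2l.
by rewrite [2 ^ (e b.+1).+1]expnS; lia.
Qed.

(** Reduction modulo a power of two cuts off the bounds from a given offset on. *)
Lemma modn_sum_pow (e : nat -> nat) a j b k : a <= j <= b ->
  (forall i, j < i <= b -> k <= e i) ->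
  \sum_(a.+1 <= i < j.+1) 2 ^ e i < 2 ^ k ->
  (\sum_(a.+1 <= i < b.+1) 2 ^ e i) %% 2 ^ k = \sum_(a.+1 <= i < j.+1) 2 ^ e i.
Proof.
move=> /andP[aj jb] ge lt; rewrite (big_cat_nat_idem _ (n := j.+1)) //=.
have /eqP h : 2 ^ k %| \sum_(j.+1 <= i < b.+1) 2 ^ e i.
  rewrite big_nat; apply: dvdn_sum => i /andP[ji ib].
  by apply: dvdn_exp2l; apply: ge; rewrite ji -ltnS.
by rewrite -modnDmr h addn0 modn_small.
Qed.

Section Find.

Variable L : nat.
Hypothesis L_gt0 : 0 < L.

(** The only facts about the exploration on which the search for regions depends. *)
Record levels (cnt lev : nat) (bnd : nat -> nat) : Prop := Levels {
  lv_bnd0 : bnd 0 = 1;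
  lv_bnd : forall i, i < lev -> bnd i < bnd i.+1;
  lv_bndl : bnd lev <= cnt.+1
}.

(** The exponent [(x %% L).+1] keeps the bounds of the block up to [x] itself. The highest bit left
    is the start of the region of [x], whose level is in [levAt]. If no bit is left, that region
    began before the block, and [M] gives its level. *)
Definition mask_level (levAt WM M : nat -> nat) x :=
  let m := WM (x %/ L) %% 2 ^ (x %% L).+1 in
  if m != 0 then levAt (x %/ L * L + trunc_log 2 m) else M (x %/ L).

(* Ticks are grouped into blocks of length [L]; the current block [cb] is that
   of the next visit number.  [WM b] is the bit mask of the region bounds in
   block [b], [M b] the least level attained during block [b], and [ST] the
   sparse table of minima of [M], whose row for a block is filled during the
   following block, one entry per tick. *)
Record finv (cnt lev : nat) (bnd levAt WM M ST : nat -> nat) : Prop := FInv {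
  f_mcur : M (cnt.+1 %/ L) <= lev;
  f_hi : forall i, M (cnt.+1 %/ L) < i <= lev ->
    cnt.+1 %/ L * L <= bnd i /\ levAt (bnd i) = i;
  f_lo : forall i, 0 < i <= M (cnt.+1 %/ L) -> bnd i < cnt.+1 %/ L * L;
  f_mask : WM (cnt.+1 %/ L) =
    \sum_((M (cnt.+1 %/ L)).+1 <= i < lev.+1) 2 ^ (bnd i - cnt.+1 %/ L * L);
  f_future : forall b, cnt.+1 %/ L < b -> WM b = 0;
  f_query : forall x y, 0 < x -> x %/ L < cnt.+1 %/ L ->
    (y <= lev /\ bnd y <= x) <->
    (y <= mask_level levAt WM M x /\
     forall g, x %/ L < g <= cnt.+1 %/ L -> y <= M g);
  f_st : forall g i, i < L -> 2 ^ i <= g.+1 ->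
    g.+1 < cnt.+1 %/ L \/ (g.+1 = cnt.+1 %/ L /\ i <= cnt.+1 %% L) ->
    forall y, y <= ST (g * L + i) <-> (forall d, g < d + 2 ^ i -> d <= g -> y <= M d)
}.

(** The current block and the one before are treated one by one, as the row of the latter may still
    be incomplete. The blocks from there back to that of [x] are covered by two overlapping ranges
    of [2 ^ k] blocks. The subtractions are in the form in which the machine performs them. *)
Definition find_level cnt (levAt WM M ST : nat -> nat) x :=
  let cb := cnt.+1 %/ L in let bx := x %/ L in
  let r1 := mask_level levAt WM M x in
  if cb - bx == 0 then r1 else
  let r2 := minn r1 (M cb) in
  if cb - 1 - bx == 0 then r2 else
  let r3 := minn r2 (M (cb - 1)) in
  let len := cb - 1 - 1 - bx in
  if len == 0 then r3 else
  let k := trunc_log 2 len in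
  minn (minn r3 (ST ((cb - 1 - 1) * L + k))) (ST ((bx + 2 ^ k) * L + k)).

Lemma blockP x : [/\ x %/ L * L <= x, x < x %/ L * L + L & x = x %/ L * L + x %% L].
Proof. by have := divn_eq x L; have := ltn_pmod x L_gt0; split; lia. Qed.

Lemma block_lt x y : x %/ L < y %/ L -> x < y %/ L * L.
Proof.
move=> h; have [_ h1 _] := blockP x.
by apply: leq_trans h1 _; rewrite -mulSnr leq_mul2r h orbT.
Qed.

Section Query.

Variables (cnt lev : nat) (bnd levAt WM M ST : nat -> nat).
Hypothesis LV : levels cnt lev bnd.
Hypothesis F : finv cnt lev bnd levAt WM M ST.
Let cb := cnt.+1 %/ L.

Lemma lv_mono i j : i <= j -> j <= lev -> bnd i <= bnd j.
Proof.
elim: j => [|j IH]; first by rewrite leqn0 => /eqP->.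
rewrite leq_eqVlt => /predU1P[->//|ij] jl.
exact: leq_trans (IH ij (ltnW jl)) (ltnW (lv_bnd LV jl)).
Qed.

(** The mask of the current block records exactly the open regions that start in it, so the greatest
    [j] with [bnd j <= x] can be read off from its bits. *)
Lemma mask_level_current x : 0 < x -> x %/ L = cb ->
  [/\ mask_level levAt WM M x <= lev, bnd (mask_level levAt WM M x) <= x &
      mask_level levAt WM M x < lev -> x < bnd (mask_level levAt WM M x).+1].
Proof.
move=> x0 xb.
have ex0 : exists i, (i <= lev) && (bnd i <= x) by exists 0; rewrite (lv_bnd0 LV).
have ub i : (i <= lev) && (bnd i <= x) -> i <= lev by case/andP.
case: (ex_maxnP ex0 ub) => j /andP[jl jx] max.
suff -> : mask_level levAt WM M x = j.
  split=> // jl'; rewrite ltnNge; apply/negP => h.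
  by have := max j.+1; rewrite jl' h ltnn => /(_ isT).
have gtx i : j < i <= lev -> x < bnd i.
  move=> /andP[ji il]; rewrite ltnNge; apply/negP => h.
  by have := max i; rewrite il h leqNgt ji => /(_ isT).
have [bx1 bx2 bx3] := blockP x; rewrite xb in bx1 bx2 bx3.
have Mj : M cb <= j.
  have [M0|M0] := posnP (M cb); first by rewrite M0.
  apply: max; rewrite (f_mcur F) /=; apply: leq_trans (ltnW (f_lo F _)) bx1.
  by rewrite M0 leqnn.
rewrite /mask_level xb (f_mask F) -/cb.
set e := fun i => bnd i - cb * L.
have lt_sum : \sum_((M cb).+1 <= i < j.+1) 2 ^ e i < 2 ^ (x %% L).+1.
  move: Mj; rewrite leq_eqVlt => /predU1P[->|Mj].
    by rewrite big_geq ?expn_gt0.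
  apply: leq_trans (sum_pow_lt Mj _) _ => [i Mi ij|].
    have il : i < lev by apply: leq_trans jl.
    have := lv_bnd LV il; have [//|+ _] := f_hi F (i := i); first by rewrite Mi ltnW.
    by rewrite /e; lia.
  by rewrite leq_exp2l // ltnS /e; lia.
rewrite (@modn_sum_pow e (M cb) j) //; first last.
- by move=> i /gtx; rewrite /e; lia.
- by rewrite Mj.
move: Mj; rewrite leq_eqVlt => /predU1P[<-|Mj]; first by rewrite big_geq.
have mj : M cb < j <= lev by rewrite Mj.
have [bj lj] := f_hi F mj.
have : 2 ^ e j <= \sum_((M cb).+1 <= i < j.+1) 2 ^ e i.
  by rewrite big_nat_recr //= leq_addl.
have : \sum_((M cb).+1 <= i < j.+1) 2 ^ e i < 2 ^ (e j).+1.
  apply: sum_pow_lt => // i Mi ij.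
  have il : i < lev by apply: leq_trans jl.
  have := lv_bnd LV il; have [//|+ _] := f_hi F (i := i); first by rewrite Mi ltnW.
  by rewrite /e; lia.
move: (\sum_(_ <= i < _) _) => m hi lo.
have -> : m != 0 by rewrite -lt0n; apply: leq_trans lo; rewrite expn_gt0.
rewrite (@trunc_log_eq 2 (e j)) // ?lo //.
by rewrite /e subnKC.
Qed.

Lemma find_levelP x : 0 < x -> x <= cnt -> cnt < 2 ^ L ->
  let j := find_level cnt levAt WM M ST x in
  [/\ j <= lev, bnd j <= x & j < lev -> x < bnd j.+1].
Proof.
move=> x0 xc cL.
have xb : x %/ L <= cb by apply: leq_div2r; apply: leqW.
rewrite /find_level -/cb.
have [e|ne] := eqVneq (cb - x %/ L) 0.
  by apply: mask_level_current; lia.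
have xb' : x %/ L < cb by lia.
set j := (X in [/\ X <= _, _ & _]).
(* The condition [y <= j] turns minima into conjunctions, the form in which [f_query] and [f_st] are
   stated. *)
suff galois y : y <= j <-> y <= lev /\ bnd y <= x.
  have [j1 j2] := (galois j).1 (leqnn _); split=> // jl.
  rewrite ltnNge; apply/negP => h.
  by have := (galois j.+1).2 (conj jl h); rewrite ltnn.
have cbL : cb <= cnt.+1 by apply: leq_div.
rewrite (f_query F y x0 xb') -/cb {}/j.
move: (x %/ L) ne xb xb' => q ne xb xb'.
have cases : q < cb - 1 \/ cb = (q).+1 by lia.
have [e|ne1] := eqVneq (cb - 1 - q) 0.
  rewrite leq_min; split=> [/andP[h1 h2]|[h1 h2]].
    by split=> // g h; have -> : g = cb by lia.
  by rewrite h1 h2 // xb' leqnn.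
have [e|ne2] := eqVneq (cb - 1 - 1 - q) 0.
  rewrite !leq_min; split=> [/andP[/andP[h1 h2] h3]|[h1 h2]].
    by split=> // g h; have [->|->] : g = cb \/ g = cb - 1 by lia.
  by rewrite h1 !h2 //; lia.
have len0 : 0 < cb - 1 - 1 - q by lia.
move kE : (trunc_log 2 _) => k.
have k1 : 2 ^ k <= cb - 1 - 1 - q by rewrite -kE; apply: trunc_logP.
have k2 : cb - 1 - 1 - q < 2 ^ k.+1 by rewrite -kE; apply: trunc_log_ltn.
(* A row of the sparse table has only [L] entries. *)
have kL : k < L.
  rewrite -(ltn_exp2l _ _ (isT : 1 < 2)); apply: leq_ltn_trans k1 _; apply: leq_ltn_trans cL; lia.
rewrite expnS in k2.
have k0 : 0 < 2 ^ k by rewrite expn_gt0.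
have st := f_st F kL; move: (2 ^ k) k0 k1 k2 st => P k0 k1 k2 st.
have ltc d : 0 < d -> d <= cb - 1 - 1 -> d.+1 < cb by lia.
have p4 : P <= (cb - 1 - 1).+1 by lia.
have r4 : 0 < cb - 1 - 1 by lia.
have st4 := st _ p4 (or_introl (ltc _ r4 (leqnn _))) y.
have p5 : P <= (q + P).+1 by lia.
have q5 : q + P <= cb - 1 - 1 by lia.
have r5 : 0 < q + P by lia.
have st5 := st _ p5 (or_introl (ltc _ r5 q5)) y.
(* The range of [P] blocks just after [q] and the one ending at [cb - 2] cover the gap, which is
   shorter than [2 * P]. *)
rewrite !leq_min; split=> [/andP[/andP[/andP[/andP[h1 h2] h3] h4] h5]|[h1 h2]].
  split=> // g /andP[g1 g2].
  have [->//|[->//|g3]] : g = cb \/ g = cb - 1 \/ g <= cb - 1 - 1 by lia.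
  have [g4|g4] := leqP g (q + P).
    by apply: (st5.1 h5); lia.
  by apply: (st4.1 h4); lia.
rewrite h1 !h2 /=; [|lia|lia].
by apply/andP; split; [apply/st4 | apply/st5] => d d1 d2; apply: h2; lia.
Qed.

End Query.

(** A block has [L] offsets, so a mask has [L] bits; this keeps it within a word and within the
    table of binary lengths. *)
Lemma mask_lt cnt lev bnd levAt WM M ST : levels cnt lev bnd ->
  finv cnt lev bnd levAt WM M ST -> WM (cnt.+1 %/ L) < 2 ^ L.
Proof.
move=> LV F; rewrite (f_mask F); have [Ml|Ml] := ltnP (M (cnt.+1 %/ L)) lev; last first.
  by rewrite big_geq ?expn_gt0.
apply: leq_trans (sum_pow_lt Ml _) _ => [i Mi il|].
  have := lv_bnd LV il; have [|+ _] := f_hi F (i := i); first by rewrite Mi ltnW.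
  by lia.
rewrite leq_exp2l //; have [_ h _] := blockP cnt.+1; have := lv_bndl LV; lia.
Qed.

Lemma finv0 bnd levAt : finv 0 0 bnd levAt (fun=> 0) (fun=> 0) (fun=> 0).
Proof.
split=> //= [i|i||x y x0|g i _ _ _ y].
- by case: i.
- by case: i.
- by rewrite big_geq.
- by move=> /block_lt; have [h _ _] := blockP 1; lia.
- by split=> // h; apply: (h g); rewrite ?leqnn // -addn1 leq_add2l expn_gt0.
Qed.

(** The highest bit of the reduced mask is at most [x %% L], so only data of the block of [x] are
    read. Updates in the current block leave closed blocks alone. *)
Lemma eq_mask_level levAt levAt' WM WM' M M' x :
  WM' (x %/ L) = WM (x %/ L) -> M' (x %/ L) = M (x %/ L) ->
  (forall z, z %/ L = x %/ L -> levAt' z = levAt z) ->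
  mask_level levAt' WM' M' x = mask_level levAt WM M x.
Proof.
move=> wE mE lE; rewrite /mask_level wE mE; set m := _ %% _.
have [//|m0] := eqVneq m 0; apply: lE.
have [_ _ xE] := blockP x; have ltL := ltn_pmod x L_gt0.
have: trunc_log 2 m < (x %% L).+1.
  rewrite -(ltn_exp2l _ _ (isT : 1 < 2)); apply: leq_ltn_trans (trunc_logP _ _) _; rewrite ?lt0n //.
  by rewrite ltn_pmod ?expn_gt0.
by move=> h; rewrite divnMDl // (@divn_small (trunc_log 2 m)) ?addn0 //; apply: leq_ltn_trans ltL.
Qed.

(** * Maintenance of masks, block minima and sparse table *)

Section Updates.

Variables (cnt lev : nat) (bnd levAt WM M ST : nat -> nat).
Hypothesis LV : levels cnt lev bnd.
Hypothesis F : finv cnt lev bnd levAt WM M ST.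
Let cb := cnt.+1 %/ L.

Lemma finv_push : bnd lev <= cnt ->
  finv cnt lev.+1 (upd bnd lev.+1 cnt.+1) (upd levAt cnt.+1 lev.+1)
    (upd WM cb (WM cb + 2 ^ (cnt.+1 %% L))) M ST.
Proof.
move=> bl; have bE i : i <= lev -> upd bnd lev.+1 cnt.+1 i = bnd i.
  by move=> il; rewrite /upd ltn_eqF.
have Ml := f_mcur F; rewrite -/cb in Ml.
have [b1 _ b3] := blockP cnt.+1; rewrite -/cb in b1 b3.
split; rewrite -/cb.
- exact: leqW.
- move=> i /andP[Mi]; rewrite leq_eqVlt => /predU1P[->|il].
    by rewrite /upd !eqxx.
  have [|h1 h2] := f_hi F (i := i); first by rewrite Mi.
  rewrite bE //; split=> //; rewrite /upd; case: eqP => // bi.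
  by have := lv_mono LV (il : i <= lev) (leqnn _); rewrite bi; lia.
- by move=> i /andP[i0 iM]; rewrite bE ?(f_lo F) ?i0 //; apply: leq_trans Ml.
- rewrite {1}/upd eqxx (f_mask F) -/cb [in RHS]big_nat_recr /= ?ltnS //.
  congr (_ + _); last by rewrite /upd eqxx {2}b3 addKn.
  by apply: eq_big_nat => i /andP[_ il]; rewrite bE.
- by move=> b h; rewrite /upd gtn_eqF // (f_future F).
- move=> x y x0 xb; rewrite (eq_mask_level (levAt := levAt) (WM := WM) (M := M)) //; last first.
  + move=> z zx; rewrite /upd; case: eqP => // zE; rewrite zE -/cb in zx.
    by rewrite zx ltnn in xb.
  + by rewrite /upd ltn_eqF.
  rewrite -(f_query F) //; split=> -[h1 h2].
    move: h1; rewrite leq_eqVlt => /predU1P[yE|yl]; last by rewrite bE in h2.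
    by move: h2; rewrite yE /upd eqxx; have := block_lt xb; lia.
  by rewrite bE //; split=> //; apply: leqW.
- exact: (f_st F).
Qed.

(** As the top region is older than the block, no open region starts in it: the mask is empty, and
    the stack falls to a new minimum for the block. *)
Lemma finv_pop_old : 0 < lev -> bnd lev < cb * L ->
  finv cnt lev.-1 bnd levAt WM (upd M cb lev.-1) ST.
Proof.
move=> l0 bl; have ME : M cb = lev.
  apply/eqP; rewrite eqn_leq (f_mcur F) leqNgt; apply/negP => h.
  by have [|h1 _] := f_hi F (i := lev); [rewrite h leqnn | move: h1; rewrite -/cb; lia].
have uE : upd M cb lev.-1 cb = lev.-1 by rewrite /upd eqxx.
have uN g : g <> cb -> upd M cb lev.-1 g = M g by rewrite /upd; case: eqP.
split; rewrite -/cb ?uE //.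
- by move=> i; lia.
- by move=> i /andP[i0 il]; apply: (f_lo F); rewrite -/cb ME; lia.
- by rewrite (f_mask F) -/cb ME !big_geq.
- exact: (f_future F).
- move=> x y x0 xb; rewrite (eq_mask_level (levAt := levAt) (WM := WM) (M := M)) //; last first.
    by apply: uN; lia.
  have := f_query F y x0 xb; rewrite -/cb => q; split.
    move=> [yl yx]; have [h1 h2] := q.1 (conj (leq_trans yl (leq_pred _)) yx).
    split=> // g h; have [->|ne] := eqVneq g cb; first by rewrite uE.
    by rewrite uN ?h2 //; apply/eqP.
  move=> [h1 h2]; have yl : y <= lev.-1 by rewrite -uE h2 // xb leqnn.
  have [] := q.2; last by split.
  split=> // g h; have [->|ne] := eqVneq g cb; first by rewrite ME; lia.
  by rewrite -uN ?h2 //; apply/eqP.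
- move=> g i iL ig gcb y; rewrite (f_st F iL ig gcb).
  by split=> h d d1 d2; have := h d d1 d2; rewrite uN //; rewrite -/cb in gcb; lia.
Qed.

(** The top region has the highest bit of the mask, which is cleared. The minimum of the block is
    below [lev] already and does not change. *)
Lemma finv_pop_current : 0 < lev -> cb * L <= bnd lev ->
  finv cnt lev.-1 bnd levAt (upd WM cb (WM cb - 2 ^ (bnd lev - cb * L))) M ST.
Proof.
move=> l0 bl; have Ml : M cb < lev.
  rewrite ltnNge; apply/negP => h.
  by have := f_lo F (i := lev); rewrite -/cb l0 h => /(_ isT); lia.
split; rewrite -/cb.
- by lia.
- by move=> i h; apply: (f_hi F); rewrite -/cb; lia.
- exact: (f_lo F).
- rewrite /upd eqxx (f_mask F) -/cb -[in LHS](prednK l0) big_nat_recr /=; last by lia.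
  by rewrite prednK // addnK.
- by move=> b h; rewrite /upd gtn_eqF // (f_future F).
- move=> x y x0 xb; rewrite (eq_mask_level (levAt := levAt) (WM := WM) (M := M)) //; last first.
    by rewrite /upd ltn_eqF.
  rewrite -(f_query F) //; split=> -[h1 h2]; split=> //; first by lia.
  suff : y <> lev by lia.
  by move=> yE; rewrite yE in h2; have := block_lt xb; rewrite -/cb; lia.
- exact: (f_st F).
Qed.

(** Entry [off] combines two entries [off - 1], one from the same row and one from [2 ^ (off - 1)]
    rows earlier. The [L] ticks of a block suffice for the [L] entries of the preceding row. If the
    range would start before block 0, [f_st] claims nothing. *)
Lemma finv_tick_same : cnt.+2 %% L != 0 ->
  let pb := cnt.+2 %/ L - 1 in let off := cnt.+2 %% L in
  finv cnt.+1 lev bnd levAt WM M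
    (upd ST (pb * L + off)
      (minn (ST (pb * L + off - 1)) (ST ((pb - 2 ^ (off - 1)) * L + off - 1)))).
Proof.
move=> off0 pb off.
have [o1 o2] : cnt.+2 %/ L = cb /\ off = (cnt.+1 %% L).+1.
  have [_ _ e1] := blockP cnt.+1; have [_ _ e2] := blockP cnt.+2.
  have l1 := ltn_pmod cnt.+1 L_gt0; have l2 := ltn_pmod cnt.+2 L_gt0.
  have l3 : (cnt.+1 %% L).+1 < L.
    rewrite ltn_neqAle l1 andbT; apply/eqP => h.
    have e3 : cnt.+2 = cb.+1 * L by rewrite mulSnr -[X in _ + X]h addnS -e1.
    by move: off0; rewrite e3 modnMl.
  have e3 : cnt.+2 = cb * L + (cnt.+1 %% L).+1 by rewrite addnS -e1.
  by rewrite /off e3 divnMDl // modnMDl (divn_small l3) (modn_small l3) addn0.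
have offL : off < L by rewrite ltn_pmod.
have [_ x2 _] := blockP cnt.+2; have [x1 _ _] := blockP cnt.+1.
rewrite o1 in x2; rewrite -/cb in x1.
split; rewrite ?o1 -/cb; try by case: F.
move=> g i iL ig gcb y.
have pbE : pb = cb - 1 by rewrite /pb o1.
rewrite -/off in gcb.
have [ge|gn] := eqVneq (g * L + i) (pb * L + off).
  have gE : g = pb.
    by have := congr1 (divn^~ L) ge; rewrite !divnMDl // !divn_small // !addn0.
  have iE : i = off.
    by have := congr1 (modn^~ L) ge; rewrite !modnMDl !modn_small.
  rewrite /upd ge eqxx leq_min; subst g i.
  have p0 : pb.+1 = cb by move: gcb; rewrite pbE; lia.
  have oE : off = (off - 1).+1 by lia.
  rewrite oE expnS in ig; have P0 : 0 < 2 ^ (off - 1) by rewrite expn_gt0.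
  have oL : off - 1 < L by lia.
  rewrite {4}oE expnS.
  have s1 := f_st F oL (g := pb) _ _ y; have s2 := f_st F oL (g := pb - 2 ^ (off - 1)) _ _ y.
  rewrite -!addnBA; [|lia|lia].
  move: (2 ^ _) ig P0 s1 s2 => P ig P0 s1 s2; rewrite -/cb in s1 s2.
  have {}s1 := s1 _ _; have {}s2 := s2 _ _.
  split.
    move=> /andP[h1 h2] d d1 d2; have [dP|dP] := ltnP pb (d + P).
      by apply: (s1 _ _).1 => //; lia.
    by apply: (s2 _ _).1 => //; lia.
  move=> h; apply/andP; split; [apply/s1|apply/s2]; try lia; move=> d d1 d2; apply: h; lia.
rewrite {1}/upd (negPf gn); apply: (f_st F) => //; rewrite -/cb.
case: gcb => [|[g1 i1]]; first by left.
right; split=> //; suff: i <> off by lia.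
by move=> iE; move: gn; rewrite iE pbE -g1 subn1 eqxx.
Qed.

(** A new block starts: its minimum is the present height, and entry 0 in the row of the closed
    block is the minimum over that block alone. *)
Lemma finv_tick_new : cnt.+2 %% L = 0 ->
  finv cnt.+1 lev bnd levAt WM (upd M (cnt.+2 %/ L) lev)
    (upd ST ((cnt.+2 %/ L - 1) * L) (M (cnt.+2 %/ L - 1))).
Proof.
move=> off0.
have [o1 o2] : cnt.+2 %/ L = cb.+1 /\ (cnt.+1 %% L).+1 = L.
  have [_ _ e1] := blockP cnt.+1; have [_ _ e2] := blockP cnt.+2.
  have l1 := ltn_pmod cnt.+1 L_gt0; rewrite off0 addn0 in e2.
  have l3 : (cnt.+1 %% L).+1 = L.
    apply/eqP; rewrite eqn_leq l1 leqNgt; apply/negP => h.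
    move: off0; rewrite -addn1 e1 addn1 -addnS modnMDl modn_small //.
  split=> //; have e3 : cnt.+2 = cb.+1 * L by rewrite mulSnr -[X in _ + X]l3 addnS -e1.
  by rewrite e3 mulnK.
have [_ _ e2] := blockP cnt.+2; rewrite off0 addn0 o1 in e2.
have [x1 _ _] := blockP cnt.+1; rewrite -/cb in x1.
have uE : upd M cb.+1 lev cb.+1 = lev by rewrite /upd eqxx.
have uN g : g <= cb -> upd M cb.+1 lev g = M g by move=> h; rewrite /upd ltn_eqF.
have bl := lv_bndl LV; have Ml := f_mcur F; rewrite -/cb in Ml.
rewrite o1 subn1 /=; split; rewrite ?o1 ?off0 ?uE //.
- by move=> i; lia.
- move=> i /andP[_ il]; rewrite -e2; have := lv_mono LV il (leqnn _); lia.
- by rewrite (f_future F) // big_geq.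
- by move=> b h; apply: (f_future F); apply: ltnW.
- move=> x y x0 xb; rewrite (eq_mask_level (levAt := levAt) (WM := WM) (M := M)) //; last first.
    by apply: uN.
  (* For [x] in the block just closed, [mask_level] is now frozen at the level found while the block
     was current; only minima of later blocks can lower it. *)
  move: (xb); rewrite ltnS leq_eqVlt => /predU1P[xE|xb'].
    have [q1 q2 q3] := mask_level_current LV F x0 xE.
    move: (mask_level _ _ _ _) q1 q2 q3 => j q1 q2 q3; split=> [[yl yx]|[yj _]].
      split=> [|g h]; last first.
        have -> : g = cb.+1 by rewrite xE in h; lia.
        by rewrite uE.
      rewrite leqNgt; apply/negP => jy; have jl : j < lev by lia.
      by have := q3 jl; have := lv_mono LV jy yl; lia.
    split; first by lia.
    by apply: leq_trans q2; apply: (lv_mono LV).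
  have := f_query F y x0 xb'; rewrite -/cb => q; split.
    move=> [yl yx]; have [h1 h2] := q.1 (conj yl yx); split=> // g h.
    have [->|ne] := eqVneq g cb.+1; first by rewrite uE.
    by rewrite uN ?h2 //; lia.
  move=> [h1 h2]; apply: q.2; split=> // g h.
  by have := h2 g; rewrite uN; [apply; lia | lia].
- move=> g i iL ig gcb y.
  have gc : g <= cb by lia.
  have -> : (forall d, g < d + 2 ^ i -> d <= g -> y <= upd M cb.+1 lev d) <->
            (forall d, g < d + 2 ^ i -> d <= g -> y <= M d).
    by split=> h d d1 d2; have := h d d1 d2; rewrite uN //; apply: leq_trans gc.
  case: gcb => [g1|[g1 i0]].
    have ne : g * L + i <> cb * L.
      by move=> ge; have := congr1 (divn^~ L) ge; rewrite divnMDl // mulnK // divn_small //; lia.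
    rewrite {1}/upd; case: eqP => // _; apply: (f_st F) => //; rewrite -/cb; lia.
  have [-> ->] : g = cb /\ i = 0 by lia.
  rewrite addn0 {1}/upd eqxx expn0; split=> [h d d1 d2|h]; last by apply: h; rewrite ?addn1.
  by have -> : d = cb by lia.
Qed.

End Updates.

End Find.

(** * Positions in a cut sequent *)

Fixpoint subforms (X : formula) : seq formula :=
  X :: match X with
       | Atom _ => [::]
       | Tensor A B | Par A B => subforms A ++ subforms B
       end.

Definition root_label (X : formula) : label :=
  match X with
  | Atom a => LAtom a
  | Tensor _ _ => LTensor
  | Par _ _ => LPar
  end.

Lemma map_root_label X : map root_label (subforms X) = tree_labels X.
Proof. by elim: X => //= A IHA B IHB; rewrite map_cat IHA IHB. Qed.

Lemma size_subforms X : size (subforms X) = tree_size X.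
Proof. by rewrite /tree_size -map_root_label size_map. Qed.

Lemma tree_size_gt0 X : 0 < tree_size X.
Proof. by case: X. Qed.

Lemma tree_sizeE X : tree_size X = (match X with Atom _ => 0
  | Tensor A B | Par A B => tree_size A + tree_size B end).+1.
Proof. by case: X => //= A B; rewrite /tree_size /= size_cat. Qed.

Arguments tree_size : simpl never.

Definition default : formula := Atom One.

(** In prefix order a subtree is a contiguous segment that begins at its root. *)
Lemma drop_subforms X i : i < tree_size X ->
  exists s, drop i (subforms X) = subforms (nth default (subforms X) i) ++ s.
Proof.
have bin A B j : (forall i, i < tree_size A -> exists s,
    drop i (subforms A) = subforms (nth default (subforms A) i) ++ s) ->
  (forall i, i < tree_size B -> exists s,
    drop i (subforms B) = subforms (nth default (subforms B) i) ++ s) ->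
  j < tree_size A + tree_size B -> exists s, drop j (subforms A ++ subforms B) =
    subforms (nth default (subforms A ++ subforms B) j) ++ s.
  move=> IHA IHB jl; rewrite drop_cat nth_cat size_subforms; case: ltnP => jA.
    by have [s ->] := IHA j jA; exists (s ++ subforms B); rewrite catA.
  by apply: IHB; lia.
elim: X i => [a|A IHA B IHB|A IHA B IHB] i; rewrite tree_sizeE.
- by rewrite ltnS leqn0 => /eqP->; exists [::].
- by case: i => [_|i il]; [exists [::]; rewrite cats0 | apply: bin].
- by case: i => [_|i il]; [exists [::]; rewrite cats0 | apply: bin].
Qed.

Section Forest.

Variable comps : seq formula.

Definition forest : seq formula := flatten (map subforms comps).

Definition sub (i : nat) : formula := nth default forest i.

Let n := size forest.

Definition close i := i + tree_size (sub i).

Definition right_arg i :=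
  match sub i with Tensor A _ | Par A _ => i.+1 + tree_size A | Atom _ => 0 end.

Lemma drop_forest i : i < n -> exists s, drop i forest = subforms (sub i) ++ s.
Proof.
rewrite /n /sub /forest; elim: comps i => [|X Xs IH] i //=.
rewrite size_cat size_subforms => il; rewrite drop_cat nth_cat size_subforms; case: ltnP => iX.
  by have [s ->] := drop_subforms iX; exists (s ++ flatten (map subforms Xs)); rewrite catA.
by apply: IH; lia.
Qed.

Lemma close_leq i : i < n -> i < close i <= n.
Proof.
move=> il; have [s /(congr1 size)] := drop_forest il.
rewrite size_drop size_cat size_subforms /close -/n.
by have := tree_size_gt0 (sub i); lia.
Qed.

Definition is_par i := if sub i is Par _ _ then true else false.
Definition is_tensor i := if sub i is Tensor _ _ then true else false.

Lemma args_close i : i < n -> is_par i || is_tensor i ->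
  [/\ i.+1 < right_arg i, right_arg i < n, right_arg i = close i.+1 &
      close i = close (right_arg i)].
Proof.
move=> il bi; have [A [B sE]] : exists A B, sub i = Tensor A B \/ sub i = Par A B.
  by move: bi; rewrite /is_par /is_tensor; case: (sub i) => // A B _; exists A, B; auto.
have [s] := drop_forest il; have A0 := tree_size_gt0 A; have B0 := tree_size_gt0 B.
have -> : subforms (sub i) = sub i :: subforms A ++ subforms B by case: sE => ->.
move=> dE; have nthE j : sub (i + j) = nth default (sub i :: subforms A ++ subforms B ++ s) j.
  by rewrite /sub -nth_drop dE /= -catA.
have sA : sub i.+1 = A by rewrite -addn1 nthE /= nth_cat size_subforms A0; case: (A).
have sB : sub (i.+1 + tree_size A) = B.
  rewrite addSnnS nthE /= nth_cat size_subforms ltnn subnn.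
  by rewrite nth_cat size_subforms B0; case: (B).
have tsE : tree_size (sub i) = (tree_size A + tree_size B).+1.
  by case: sE => ->; rewrite tree_sizeE.
have -> : right_arg i = i.+1 + tree_size A by rewrite /right_arg; case: sE => ->.
rewrite /close sA sB tsE; split=> //; try lia.
by have := congr1 size dE; rewrite size_drop /= !size_cat !size_subforms -/n; lia.
Qed.

Lemma close_nested i j : i < n -> i <= j -> j < close i -> close j <= close i.
Proof.
move=> il ij jc; have [s dE] := drop_forest il.
have jX : j - i < tree_size (sub i) by rewrite /close in jc; lia.
have [s' ds] := drop_subforms jX.
have -> : close j = j + tree_size (nth default (subforms (sub i)) (j - i)).
  rewrite /close; congr (_ + tree_size _).
  by rewrite -{1}(subnKC ij) /sub -nth_drop dE nth_cat size_subforms jX.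
have := congr1 size ds; rewrite size_drop size_cat !size_subforms /close; lia.
Qed.

(** If [j] is in the left subtree of [i], its arguments lie strictly between those of [i]; otherwise
    they come after [right_arg i]. Hence a single cell of [bPar] suffices for each vertex. *)
Lemma arg_unique i j y z : i < j -> j < n -> is_par i || is_tensor i ->
  is_par j || is_tensor j ->
  y = i.+1 \/ y = right_arg i -> z = j.+1 \/ z = right_arg j -> y <> z.
Proof.
move=> ij jn bi bj; have il : i < n := ltn_trans ij jn.
have [ri1 ri2 rE _] := args_close il bi; have [rj1 rj2 _ cjE] := args_close jn bj.
have zc : right_arg j < close j by rewrite cjE; case/andP: (close_leq rj2).
have := close_nested (ltn_trans ri1 ri2) ij; rewrite -rE.
by move=> cj [] -> [] ->; case: (ltnP j (right_arg i)) cj => [_ /(_ isT)|]; lia.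
Qed.

(** The recurrence by which the ends of subtrees are computed from right to left. *)
Lemma close_rec i : i < n ->
  close i = if is_par i || is_tensor i then close (right_arg i) else i.+1.
Proof.
move=> il; case: ifP => [/(args_close il)[]//|]; rewrite /close /is_par /is_tensor.
by case: (sub i) => // a; rewrite addn1.
Qed.

Definition tensor_edges (i : nat) : seq (nat * nat) :=
  if is_tensor i then [:: (i, i.+1); (i, right_arg i)] else [::].

Definition par_list : seq nat := [seq i <- iota 0 n | is_par i].

Definition node_edges (s : nat -> bool) (p : nat * formula) : seq (nat * nat) :=
  match p.2 with
  | Atom _ => [::]
  | Tensor A _ => [:: (p.1, p.1.+1); (p.1, p.1.+1 + tree_size A)]
  | Par A _ => [:: (p.1, if s p.1 then p.1.+1 else p.1.+1 + tree_size A)]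
  end.

Lemma switched_treeE s o X : switched_tree s o X =
  flatten (map (node_edges s) (zip (iota o (tree_size X)) (subforms X))).
Proof.
elim: X o => [a|A IHA B IHB|A IHA B IHB] o //=.
  rewrite size_cat iotaD zip_cat ?size_iota ?size_subforms //.
  by rewrite map_cat flatten_cat -IHA -IHB.
rewrite size_cat iotaD zip_cat ?size_iota ?size_subforms //.
by rewrite map_cat flatten_cat -IHA -IHB.
Qed.

Lemma switched_forestE s o Xs : switched_forest s o Xs =
  flatten (map (node_edges s)
    (zip (iota o (size (flatten (map subforms Xs)))) (flatten (map subforms Xs)))).
Proof.
elim: Xs o => //= X Xs IH o; rewrite size_cat size_subforms iotaD.
by rewrite zip_cat ?size_iota ?size_subforms // map_cat flatten_cat -IH -switched_treeE.
Qed.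

Lemma perm_flatten_cat (T : eqType) (I : Type) (f g : I -> seq T) (s : seq I) :
  perm_eq (flatten [seq f i ++ g i | i <- s]) (flatten (map f s) ++ flatten (map g s)).
Proof.
elim: s => //= i s IH; rewrite -!catA perm_cat2l.
by rewrite perm_sym perm_catCA perm_cat2l perm_sym.
Qed.

(** Separates the edges common to all switchings from the one edge that each par contributes. *)
Lemma perm_switched_forest s : perm_eq (switched_forest s 0 comps)
  (flatten (map tensor_edges (iota 0 n)) ++
   [seq (o, if s o then o.+1 else right_arg o) | o <- par_list]).
Proof.
rewrite switched_forestE -/forest.
have -> : zip (iota 0 n) forest = [seq (i, sub i) | i <- iota 0 n].
  apply: (@eq_from_nth _ (0, default)).
    by rewrite size_zip size_map size_iota minnn.
  move=> i; rewrite size_zip size_iota minnn => il.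
  by rewrite nth_zip ?size_iota // (nth_map 0) ?size_iota // nth_iota.
rewrite -map_comp.
have -> : [seq (o, if s o then o.+1 else right_arg o) | o <- par_list] =
  flatten [seq (if is_par i then [:: (i, if s i then i.+1 else right_arg i)] else [::])
          | i <- iota 0 n].
  by rewrite /par_list; elim: (iota 0 n) => //= i t <-; case: (is_par i).
rewrite (eq_map (_ : _ =1 fun i => tensor_edges i ++
  (if is_par i then [:: (i, if s i then i.+1 else right_arg i)] else [::]))).
  exact: perm_flatten_cat.
move=> i; rewrite /= /node_edges /tensor_edges /is_tensor /is_par /right_arg /=.
by case: (sub i).
Qed.

End Forest.

(** * The edges and the matching of a net in terms of positions *)

Section Net.

Variables (G : cut_sequent) (f : leaf_function G).

Let n := size (labels G).
Let C := components G.

Definition lab (i : nat) : label := nth LPar (labels G) i.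

Lemma labelsE : labels G = map root_label (forest C).
Proof.
rewrite /labels /forest -/C; elim: C => //= X Xs IH.
by rewrite map_cat map_root_label -IH.
Qed.

Lemma size_forest : size (forest C) = n.
Proof. by rewrite /n labelsE size_map. Qed.

Lemma labE i : i < n -> lab i = root_label (sub C i).
Proof. by move=> il; rewrite /lab labelsE (nth_map default) ?size_forest. Qed.

Lemma label_ofE (v : vertex G) : label_of v = lab v.
Proof. by rewrite /label_of (tnth_nth LPar). Qed.

Lemma neg_leafP i : i < n -> is_neg (lab i) -> exists l : neg_leaf G, val (val l) = i.
Proof.
move=> il ni; have ni' : is_neg (label_of (Ordinal il : vertex G)) by rewrite label_ofE.
by exists (Sub (Ordinal il : vertex G) ni').
Qed.

Lemma targetE (l : neg_leaf G) : target f (val (val l)) = val (val (f l)).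
Proof.
rewrite /target; case: pickP => [l' /eqP/val_inj/val_inj->//|/(_ l)].
by rewrite eqxx.
Qed.

Lemma is_neg_lab (l : neg_leaf G) : is_neg (lab (val (val l))).
Proof. by rewrite -label_ofE; apply: (valP l). Qed.

Lemma target_lt i : i < n -> is_neg (lab i) -> target f i < n.
Proof. by move=> il ni; have [l <-] := neg_leafP il ni; rewrite targetE ltn_ord. Qed.

Definition leaf_edge (i : nat) : seq (nat * nat) :=
  if is_neg (lab i) then [:: (i, target f i)] else [::].

Lemma perm_leaf_function_edges :
  perm_eq (leaf_function_edges f) (flatten (map leaf_edge (iota 0 n))).
Proof.
have -> : flatten (map leaf_edge (iota 0 n)) =
    [seq (i, target f i) | i <- iota 0 n & is_neg (lab i)].
  by rewrite /leaf_edge; elim: (iota 0 n) => //= i t ->; case: (is_neg _).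
rewrite /leaf_function_edges.
have -> : [seq (val (val l), val (val (f l))) | l <- enum {: neg_leaf G}] =
    [seq (i, target f i) | i <- [seq val (val l) | l <- enum {: neg_leaf G}]].
  by rewrite -map_comp; apply: eq_map => l; rewrite /= targetE.
apply: perm_map; apply: uniq_perm.
- by rewrite map_inj_uniq ?enum_uniq // => l l' /val_inj/val_inj.
- by rewrite filter_uniq ?iota_uniq.
move=> i; rewrite mem_filter mem_iota add0n; apply/mapP/andP => [[l _ ->]|[ni il]].
  by split; [apply: is_neg_lab | rewrite ltn_ord].
by have [l <-] := neg_leafP il ni; exists l; rewrite ?mem_enum.
Qed.

Definition plain_edges_at i := tensor_edges C i ++ leaf_edge i.

Definition plain_edges_from i := flatten (map plain_edges_at (iota i (n - i))).

Definition plain_edges := plain_edges_from 0 ++ cut_edges G.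

Lemma plain_edges_fromS i : i < n ->
  plain_edges_from i = plain_edges_at i ++ plain_edges_from i.+1.
Proof. by move=> il; rewrite /plain_edges_from subnS -{1}(ltn_predK (_ : 0 < n - i)) ?subn_gt0. Qed.

Lemma perm_switching s : perm_eq (switching_edges G s ++ leaf_function_edges f)
  (switch plain_edges (par_list C) S (right_arg C) s).
Proof.
rewrite /switching_edges /switch /plain_edges -/C.
have h1 := perm_switched_forest C s; rewrite size_forest in h1.
have h2 := perm_leaf_function_edges.
have h3 := perm_flatten_cat (tensor_edges C) leaf_edge (iota 0 n).
rewrite /plain_edges_from subn0.
apply/permP => p; have := permP h1 p; have := permP h2 p; have := permP h3 p.
rewrite !count_cat /plain_edges_at => -> -> ->.
set a := count p (flatten _); set b := count p (map _ _); set c := count p (cut_edges G); set d := count p (flatten _); lia.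
Qed.

Lemma cut_edges_from_below o As (n' : nat) :
  o + sumn (map tree_size (flatten [seq [:: A; dual A] | A <- As])) <= n' ->
  endpoints_below n' (cut_edges_from o As).
Proof.
elim: As o => //= A As IH o le; have := tree_size_gt0 A; have := tree_size_gt0 (dual A).
by move=> d0 a0; rewrite IH; [rewrite andbT; apply/andP; split; lia | lia].
Qed.

Lemma size_forest_sumn Xs : size (forest Xs) = sumn (map tree_size Xs).
Proof. by rewrite /forest; elim: Xs => //= X Xs IH; rewrite size_cat size_subforms IH. Qed.

Lemma plain_edges_below : endpoints_below n plain_edges.
Proof.
rewrite /endpoints_below all_cat; apply/andP; split; last first.
  apply: cut_edges_from_below; rewrite -size_forest size_forest_sumn.
  by rewrite /C /components map_cat sumn_cat.
apply/allP => e /flattenP[es /mapP[i]]; rewrite mem_iota subn0 => /= il ->.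
have iF : i < size (forest C) by rewrite size_forest.
rewrite mem_cat /tensor_edges /leaf_edge => /orP[].
  case ti: (is_tensor _ _) => //.
  have pt : is_par C i || is_tensor C i by rewrite ti orbT.
  have [r0 r1 _ _] := args_close iF pt; rewrite size_forest in r1; have r2 := ltn_trans r0 r1.
  by rewrite !inE => /orP[] /eqP->; rewrite /= il ?r1 ?r2.
by case ni: (is_neg _) => //; rewrite inE => /eqP-> /=; rewrite il target_lt.
Qed.

(** Every par contributes one edge to any switching, so the number of edges does not depend on
    [s]. *)
Lemma switching_linked : 0 < n ->
  switching f <-> (size plain_edges + size (par_list C)).+1 = n /\
    forall s u v, u < n -> v < n ->
      linked (edge_rel (switch plain_edges (par_list C) S (right_arg C) s)) u v.
Proof.
move=> n0; have ends s : endpoints_below n (switching_edges G s ++ leaf_function_edges f).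
  rewrite /endpoints_below (perm_all _ (perm_switching s)) all_cat.
  have := plain_edges_below; rewrite /endpoints_below => -> /=.
  apply/allP => e /mapP[o]; rewrite mem_filter mem_iota add0n => /andP[po /= ol] -> /=.
  have pt : is_par C o || is_tensor C o by rewrite po.
  have [h0 h1 _ _] := args_close ol pt; rewrite size_forest in ol h1.
  by rewrite ol; case: ifP => // _; apply: ltn_trans h0 h1.
have sz s : size (switching_edges G s ++ leaf_function_edges f) =
    size plain_edges + size (par_list C).
  by rewrite (perm_size (perm_switching s)) size_cat size_map.
have lk s u v : linked (edge_rel (switching_edges G s ++ leaf_function_edges f)) u v <->
    linked (edge_rel (switch plain_edges (par_list C) S (right_arg C) s)) u v.
  by split; apply: linked_mono => a b h; apply: linked_step; move: h;
    rewrite /edge_rel (perm_mem (perm_switching s)).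
split=> [sw|[szE con] s].
  split; first by have [] := (is_treeP n0 (ends (fun=> true))).1 (sw _); rewrite sz.
  by move=> s u v un vn; apply/lk; have [_] := (is_treeP n0 (ends s)).1 (sw s); apply.
apply/(is_treeP n0 (ends s)); rewrite sz; split=> // u v un vn.
exact/lk/con.
Qed.

Definition is_dual (l : label) : bool := if l is LAtom (Dual _) then true else false.
Definition is_var (l : label) : bool := if l is LAtom (Var _) then true else false.

(** The three conditions are for all variables together. Equality of names splits injectivity and
    surjectivity into statements for each variable. *)
Lemma matchingP : matching f <->
  [/\ forall i, i < n -> is_dual (lab i) ->
        is_var (lab (target f i)) && (name (lab i) == name (lab (target f i))),
      forall i j, i < n -> j < n -> is_dual (lab i) -> is_dual (lab j) ->
        target f i = target f j -> i = j &
      forall r, r < n -> is_var (lab r) ->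
        exists i, [/\ i < n, is_dual (lab i) & target f i = r]].
Proof.
have dual_neg l : is_dual l -> is_neg l by case: l => // -[].
split=> [mt|[m1 m2 m3] P].
- split.
  + move=> i il di; have [l lE] := neg_leafP il (dual_neg _ di); subst i.
    move: di; rewrite -label_ofE; case lP: (label_of _) => [[|P||]||] //= _.
    have [h _ _] := mt P; have := h l lP.
    by rewrite targetE -label_ofE => -> /=; rewrite eqxx.
  + move=> i j il jl di dj tij.
    have [l lE] := neg_leafP il (dual_neg _ di); subst i.
    have [l' lE'] := neg_leafP jl (dual_neg _ dj); subst j.
    have ff : f l = f l' by apply/val_inj/val_inj; rewrite -!targetE.
    move: di dj; rewrite -!label_ofE.
    case lP: (label_of (val l)) => [[|P||]||] //= _.
    case lP': (label_of (val l')) => [[|P'||]||] //= _.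
    have [h h' _] := mt P; have [k _ _] := mt P'.
    have := h l lP; rewrite ff (k l' lP') => -[eP]; rewrite eP in lP'.
    by rewrite (h' l l').
  + move=> r rl vr; have vr' : is_pos (label_of (Ordinal rl : vertex G)).
      by rewrite label_ofE /=; case: (lab r) vr => // -[].
    pose q : pos_leaf G := Sub (Ordinal rl : vertex G) vr'.
    move: vr; case rP: (lab r) => [[P|||]||] //= _.
    have [_ _ h] := mt P; have [|l lP fl] := h q; first by rewrite label_ofE.
    exists (val (val l)); rewrite ltn_ord -label_ofE lP targetE fl; split=> //.
- have dualE (l : neg_leaf G) : label_of (val l) = LAtom (Dual P) -> is_dual (lab (val (val l))).
    by rewrite -label_ofE => ->.
  split.
  + move=> l lP; have := m1 (val (val l)) (ltn_ord _) (dualE l lP).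
    rewrite targetE -!label_ofE lP /=.
    by case: (label_of _) => [[Q|||]||] //= /eqP->.
  + move=> l l' lP lP' ff; apply/val_inj/val_inj.
    by apply: m2; rewrite ?ltn_ord ?dualE // !targetE ff.
  + move=> r rP; have [|i [il di ti]] := m3 (val (val r)) (ltn_ord _).
      by rewrite -label_ofE rP.
    have [l lE] := neg_leafP il (dual_neg _ di); subst i.
    have fl : f l = r by apply/val_inj/val_inj; rewrite -targetE.
    exists l => //; have := m1 _ il di.
    rewrite ti -!label_ofE rP /=; move: di; rewrite -label_ofE.
    by case: (label_of _) => [[|Q||]||] //= _ /eqP->.
Qed.

End Net.

(** * Total correctness of programs *)

Definition setr (r : nat -> nat) (x v : nat) : nat -> nat :=
  fun y => if y == x then v else r y.

(** A whole bank is replaced, so that the other banks remain equal as functions; the invariants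
    compare banks as functions. *)
Definition updm (m : nat -> nat -> nat) (a i x : nat) : nat -> nat -> nat :=
  fun b => if b == a then upd (m a) i x else m b.

Arguments setr r x v y /.
Arguments updm m a i x b /.

Lemma set_mem_updm r m a i x : set_mem (State r m) a i x = State r (updm m a i x).
Proof.
congr State; apply: functional_extensionality => b; apply: functional_extensionality => j.
by rewrite /updm /upd /=; case: eqP => [->|].
Qed.

Definition assertion := (nat -> nat) -> (nat -> nat -> nat) -> Prop.

Definition wp (W : nat) (p : program) (T : nat) (Q : assertion) : assertion :=
  fun r m => exists r' m' t, [/\ exec W p (State r m) (State r' m') t, t <= T & Q r' m'].

Lemma wp_weaken W p T T' (Q Q' : assertion) r m : T <= T' ->
  (forall r' m', Q r' m' -> Q' r' m') -> wp W p T Q r m -> wp W p T' Q' r m.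
Proof.
move=> TT QQ [r' [m' [t [ex tT q]]]]; exists r', m', t; split=> //; last exact: QQ.
exact: leq_trans tT TT.
Qed.

Lemma wp_seq W p q T1 T2 Q r m :
  wp W p T1 (wp W q T2 Q) r m -> wp W (Seq p q) (T1 + T2) Q r m.
Proof.
move=> [r1 [m1 [t1 [ex1 le1 [r2 [m2 [t2 [ex2 le2 q2]]]]]]]].
exists r2, m2, (t1 + t2); split=> //; [exact: ExecSeq ex1 ex2 | exact: leq_add].
Qed.

(** Computes preconditions of loop-free code. Each computed value gets a name through an equation,
    which keeps long instruction sequences from building up nested expressions. *)
Fixpoint wps (W : nat) (p : program) (Q : assertion) : assertion := fun r m =>
  match p with
  | Skip => Q r m
  | Const x k => k < W /\ Q (setr r x k) m
  | Op op x y z => forall v, v = eval_binop op (r y) (r z) ->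
      v < W /\ Q (setr r x v) m
  | Get x a y => forall v, v = m a (r y) -> Q (setr r x v) m
  | Put a x y => Q r (updm m a (r x) (r y))
  | Seq p q => wps W p (wps W q Q) r m
  | If x p q => (r x <> 0 -> wps W p Q r m) /\ (r x = 0 -> wps W q Q r m)
  | While _ _ => False
  end.

Fixpoint cost (p : program) : nat :=
  match p with
  | Seq p q => cost p + cost q
  | If _ p q => (maxn (cost p) (cost q)).+1
  | _ => 1
  end.

Lemma wps_mono W p (Q Q' : assertion) r m :
  (forall r' m', Q r' m' -> Q' r' m') -> wps W p Q r m -> wps W p Q' r m.
Proof.
elim: p Q Q' r m => //= [|x k|op x y z|x a y|a x y|p IHp q IHq|x p IHp q IHq] Q Q' r m QQ.
- exact: QQ.
- by case=> h /QQ.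
- by move=> h v /h[? /QQ].
- by move=> h v /h/QQ.
- exact: QQ.
- by apply: IHp => r' m'; apply: IHq.
- by case=> h1 h2; split=> [/h1|/h2]; [apply: IHp|apply: IHq].
Qed.

Lemma wps_wp W p Q r m : wps W p Q r m -> wp W p (cost p) Q r m.
Proof.
elim: p Q r m => //= [|x k|op x y z|x a y|a x y|p IHp q IHq|x p IHp q IHq] Q r m.
- by move=> q; exists r, m, 1; split=> //; apply: ExecSkip.
- by move=> [kW q]; exists (setr r x k), m, 1; split=> //; apply: (ExecConst (State r m)).
- move=> /(_ _ erefl)[vW q].
  by exists (setr r x (eval_binop op (r y) (r z))), m, 1; split=> //; apply: (ExecOp (st := State r m)).
- move=> /(_ _ erefl) q.
  by exists (setr r x (m a (r y))), m, 1; split=> //; apply: (ExecGet W (State r m)).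
- move=> q; exists r, (updm m a (r x) (r y)), 1; split=> //.
  by rewrite -set_mem_updm; apply: (ExecPut W (State r m)).
- move=> h; apply: wp_seq; apply: IHp; apply: wps_mono h => r' m'; exact: IHq.
- case=> h1 h2; have [x0|x0] := eqVneq (r x) 0.
    have [r' [m' [t [ex le q']]]] := IHq _ _ _ (h2 x0).
    exists r', m', t.+1; split=> //; first exact: ExecIfFalse ex.
    by rewrite ltnS (leq_trans le) ?leq_maxr.
  have [r' [m' [t [ex le q']]]] := IHp _ _ _ (h1 (elimN eqP x0)).
  exists r', m', t.+1; split=> //; first exact: ExecIfTrue ex.
  by rewrite ltnS (leq_trans le) ?leq_maxl.
Qed.

Definition decreases (J : nat -> assertion) (k : nat) : assertion :=
  fun r m => exists2 k', k' < k & J k' r m.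

(** The loop index [k] bounds the remaining passes. Each pass costs the body and one test, and a
    last test ends the loop. *)
Lemma wp_while W x p (J : nat -> assertion) k r m :
  (forall k r m, J k r m -> r x != 0 -> wps W p (decreases J k) r m) -> J k r m ->
  wp W (While x p) ((cost p).+1 * k + 1) (fun r' m' => (exists k', J k' r' m') /\ r' x = 0) r m.
Proof.
move=> step; elim/ltn_ind: k r m => k IH r m Jk.
have [x0|x0] := eqVneq (r x) 0.
  exists r, m, 1; split; [exact: ExecWhileFalse | by rewrite addn1 | by split; first exists k].
have [r1 [m1 [t1 [ex1 le1 [k' lt_k J1]]]]] := wps_wp (step k r m Jk x0).
have [r2 [m2 [t2 [ex2 le2 q2]]]] := IH k' lt_k r1 m1 J1.
exists r2, m2, (t1 + t2).+1; split=> //; first exact: ExecWhileTrue ex1 ex2.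
have : (cost p).+1 * k'.+1 <= (cost p).+1 * k by rewrite leq_mul2l lt_k orbT.
by rewrite mulnS; lia.
Qed.

Arguments cost : simpl never.

(* Proves that a computed value does not overflow, with only the listed facts left for [lia]. *)
Tactic Notation "fits" constr(inW) ":" ne_hyp_list(hs) :=
  split; [apply: inW; clear -hs; lia|].

Fixpoint block (ps : seq program) : program :=
  match ps with
  | [::] => Skip
  | [:: p] => p
  | p :: ps' => Seq p (block ps')
  end.

(** * The exploration loop *)

(* Arcs are numbered from 1, and 0 ends a list of arcs.  [bEnd] holds the position
   after the subtree of a vertex, so that the right premise of [o] is at [bEnd o.+1];
   [bPar y] is [o.+1] if [y] is a premise of the par [o]; [bPow j.+1] is [2 ^ j] and
   [bLen x] the binary length of [x]. *)
Notation rN := 0 (only parsing).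
Notation rOne := 3 (only parsing).
Notation rTwo := 4 (only parsing).
Notation rL := 5 (only parsing).
Notation rGo := 20 (only parsing).
Notation rCnt := 21 (only parsing).
Notation rLev := 22 (only parsing).
Notation rCur := 23 (only parsing).
Notation rAp := 24 (only parsing).
Notation rVtx := 25 (only parsing).
Notation rFr := 26 (only parsing).
Notation rPj := 27 (only parsing).

Notation bCode := 0 (only parsing).
Notation bName := 1 (only parsing).
Notation bTarget := 2 (only parsing).
Notation bPow := 3 (only parsing).
Notation bLen := 4 (only parsing).
Notation bEnd := 5 (only parsing).
Notation bHit := 6 (only parsing).
Notation bHead := 7 (only parsing).
Notation bNxt := 8 (only parsing).
Notation bTgt := 9 (only parsing).
Notation bPar := 10 (only parsing).
Notation bNum := 11 (only parsing).
Notation bSeen := 12 (only parsing).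
Notation bBnd := 13 (only parsing).
Notation bApx := 14 (only parsing).
Notation bHd := 15 (only parsing).
Notation bItem := 16 (only parsing).
Notation bNnx := 17 (only parsing).
Notation bLevAt := 18 (only parsing).
Notation bWM := 19 (only parsing).
Notation bM := 20 (only parsing).
Notation bST := 21 (only parsing).

Notation Sub := Defs.Sub (only parsing).

Definition push_node (l w : nat) : program := block
  [:: Put bItem rFr w; Get 30 bHd l; Put bNnx rFr 30; Put bHd l rFr;
      Op Add rFr rFr rOne].

Definition arc_code : program := block
  [:: Get 31 bTgt rCur; push_node rLev 31; Get rCur bNxt rCur].

(** For a visit number in register 32, leaves its block in 33 and [mask_level] in 40. The remainder
    modulo a power of two is formed by division, and the highest bit is read from [bLen]. The offset
    is raised by 2, one for the exponent in [mask_level] and one for the shift in [bPow]. *)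
Definition mask_code : program := block
  [:: Op Div 33 32 rL; Op Mul 34 33 rL; Op Sub 35 32 34; Op Add 35 35 rTwo;
      Get 35 bPow 35; Get 36 bWM 33; Op Div 37 36 35; Op Mul 37 37 35;
      Op Sub 36 36 37;
      If 36 (block [:: Get 36 bLen 36; Op Sub 36 36 rOne; Op Add 36 36 34;
                       Get 40 bLevAt 36])
            (Get 40 bM 33)].

(** With truncated subtraction, [x - (x - y)] is the minimum of [x] and [y]. *)
Definition min_code (a : nat) : program := block
  [:: Op Sub a 40 a; Op Sub 40 40 a].

Definition range_code : program := block
  [:: Op Add 34 rCnt rOne; Op Div 34 34 rL; Op Sub 35 34 33;
      If 35 (block
        [:: Get 36 bM 34; min_code 36; Op Sub 34 34 rOne; Op Sub 35 34 33;
            If 35 (block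
              [:: Get 36 bM 34; min_code 36; Op Sub 34 34 rOne; Op Sub 35 34 33;
                  If 35 (block
                    [:: Get 36 bLen 35; Get 37 bPow 36; Op Sub 36 36 rOne;
                        Op Mul 38 34 rL; Op Add 38 38 36; Get 38 bST 38; min_code 38;
                        Op Add 38 33 37; Op Mul 38 38 rL; Op Add 38 38 36;
                        Get 38 bST 38; min_code 38]) Skip]) Skip]) Skip].

Definition premise_code : program := block
  [:: Op Sub 31 rPj rOne; Const rPj 0; Get 32 bSeen 31;
      If 32 (block [:: mask_code; range_code; push_node 40 31])
            (block [:: Get 33 bNum rVtx; Put bSeen 31 33])].

Definition open_code : program := block
  [:: Op Add rLev rLev rOne; Op Add 31 rCnt rOne; Put bBnd rLev 31;
      Put bApx rLev rVtx; push_node rLev rAp; Put bLevAt 31 rLev;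
      Op Div 32 31 rL; Op Mul 33 32 rL; Op Sub 33 31 33; Op Add 33 33 rOne;
      Get 34 bPow 33; Get 35 bWM 32; Op Add 35 35 34; Put bWM 32 35; Const rAp 0].

Definition apex_code : program := block
  [:: Get 31 bNum rAp; If 31 (Const rAp 0) open_code].

Definition tick_code : program := block
  [:: Op Add 33 rCnt rOne; Op Div 34 33 rL; Op Mul 35 34 rL; Op Sub 35 33 35;
      Op Sub 36 34 rOne; Op Mul 37 36 rL; Op Add 37 37 35;
      If 35 (block
        [:: Op Sub 38 37 rOne; Get 38 bST 38; Get 39 bPow 35; Op Sub 39 36 39;
            Op Mul 39 39 rL; Op Add 39 39 35; Op Sub 39 39 rOne; Get 39 bST 39;
            Op Sub 39 38 39; Op Sub 38 38 39; Put bST 37 38])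
      (block [:: Get 38 bM 36; Put bST 37 38; Put bM 34 rLev])].

(** A par is recognized by its code 5, the only one that 4 does not truncate to 0. *)
Definition visit_code : program := block
  [:: Get rVtx bItem 31; Op Add rCnt rCnt rOne; Put bNum rVtx rCnt;
      Get rCur bHead rVtx; Get rPj bPar rVtx; Get 33 bCode rVtx; Const 34 4;
      Op Sub 33 33 34; If 33 (Op Add rAp rVtx rOne) (Const rAp 0); tick_code].

Definition node_code : program := block
  [:: Get 32 bItem 31; Get 33 bNnx 31; Put bHd rLev 33; Get 33 bNum 32;
      If 33 Skip visit_code].

Definition close_code : program := block
  [:: Op Sub rLev rLev rOne; Op Add 33 rCnt rOne; Op Div 33 33 rL;
      Op Mul 34 33 rL; Op Sub 35 34 32;
      If 35 (Put bM 33 rLev)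
        (block [:: Op Sub 35 32 34; Op Add 35 35 rOne; Get 35 bPow 35;
                   Get 36 bWM 33; Op Sub 36 36 35; Put bWM 33 36])].

Definition complete_code : program :=
  If rLev (block
    [:: Get 31 bApx rLev; Op Add 31 31 rOne; Get 31 bEnd 31; Get 31 bNum 31;
        Get 32 bBnd rLev; Op Sub 31 32 31; If 31 (Const rGo 0) close_code])
  (Const rGo 0).

Definition explore_body : program :=
  If rCur arc_code (If rPj premise_code (If rAp apex_code
    (block [:: Get 31 bHd rLev; If 31 node_code complete_code]))).

Section Main.

Variables (n W K A L : nat) (pl : seq (nat * nat)) (pars : seq nat).
Variables (m0 : nat -> nat -> nat) (src : nat -> nat).

Let rgt o := m0 bEnd o.+1.

Hypothesis graph : par_graph n pl pars S rgt (m0 bPar).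
Hypothesis adj : adjacency A src (m0 bHead) (m0 bNxt).
Hypothesis arc_pl : arcs_in pl A src (m0 bTgt).
Hypothesis pl_arc : arcs_cover pl A src (m0 bTgt).
Hypothesis L_gt0 : 0 < L.
Hypothesis nL : n < 2 ^ L.
Hypothesis Ln : 2 ^ L <= 2 * n.
Hypothesis powE : forall j, j <= L -> m0 bPow j.+1 = 2 ^ j.
Hypothesis lenE : forall x, 0 < x <= 2 * n -> m0 bLen x = (trunc_log 2 x).+1.
Hypothesis codeE : forall v, v < n -> m0 bCode v <= 5 /\ (v \in pars) = (m0 bCode v == 5).
Hypothesis WK : K + 10 * n + 20 <= W.

Definition abs (r : nat -> nat) (m : nat -> nat -> nat) : explore :=
  Explore (r rCnt) (r rLev) (r rCur) (r rPj) (r rAp) (r rVtx) (r rFr)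
    (m bNum) (m bSeen) (m bBnd) (m bApx) (m bHd) (m bItem) (m bNnx).

Definition statics (r : nat -> nat) (m : nat -> nat -> nat) : Prop :=
  [/\ r rN = n, r rOne = 1, r rTwo = 2, r rL = L & forall b, b <= 10 -> m b = m0 b].

(** [finv] describes only the entries that matter. The machine also handles other ones, such as
    sparse table entries whose range starts before block 0, and these must not overflow either. *)
Definition small (m : nat -> nat -> nat) : Prop :=
  [/\ forall z, m bLevAt z <= n, forall z, m bWM z < 2 ^ L,
      forall z, m bM z <= n & forall z, m bST z <= n].

Notation inv := (inv n pl pars S rgt A src (m0 bTgt) K).
Notation potential := (potential n A src).

(** The strict bound on the potential reserves index 0 for the stopped state. *)
Definition running (k : nat) (r : nat -> nat) (m : nat -> nat -> nat) : Prop :=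
  exists wl, [/\ inv (abs r m) wl, potential (abs r m) wl < k, small m &
    finv L (r rCnt) (r rLev) (m bBnd) (m bLevAt) (m bWM) (m bM) (m bST)].

Definition all_linked : Prop := forall s u v, u < n -> v < n ->
  linked (edge_rel (switch pl pars S rgt s)) u v.

Definition looping (k : nat) (r : nat -> nat) (m : nat -> nat -> nat) : Prop :=
  statics r m /\
  ((r rGo != 0 /\ running k r m) \/
   [/\ r rGo = 0, r rCnt <= n, r rLev <= n & r rLev = 0 /\ r rCnt = n <-> all_linked]).

Lemma updm_low (m : nat -> nat -> nat) a i x : 10 < a ->
  (forall b, b <= 10 -> m b = m0 b) -> forall b, b <= 10 -> updm m a i x b = m0 b.
Proof. by move=> a10 mE b b10 /=; rewrite ltn_eqF ?mE //; apply: leq_ltn_trans a10. Qed.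

Lemma loopI k S wl p r m : inv S wl /\ potential S wl < p -> p < k ->
  abs r m = S -> statics r m -> r rGo != 0 -> small m ->
  finv L (r rCnt) (r rLev) (m bBnd) (m bLevAt) (m bWM) (m bM) (m bST) ->
  decreases looping k r m.
Proof.
move=> [I pot] pk absE st go sm F; exists p => //; split=> //; left; split=> //.
by exists wl; split; rewrite ?absE.
Qed.

(** The search and the tick use only registers above 32 as scratch space. *)
Definition keep (r r' : nat -> nat) : Prop := forall x, x <= 32 -> r' x = r x.

Lemma keep_setr r r' x v : 32 < x -> keep r r' -> keep r (setr r' x v).
Proof. by move=> x32 kp y y32 /=; rewrite ltn_eqF ?kp //; apply: leq_ltn_trans x32. Qed.

Lemma keep_refl r : keep r r.
Proof. by []. Qed.

Ltac keep_tac := repeat (apply: keep_setr => //); exact: keep_refl.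

Lemma modn_subE x d : x - x %/ d * d = x %% d.
Proof. by rewrite {1}(divn_eq x d) addKn. Qed.

Lemma wps_mask r m (Q : assertion) : statics r m -> (forall z, m bWM z < 2 ^ L) ->
  r 32 <= n -> (forall z, m bLevAt z <= n) ->
  (forall r', keep r r' -> r' 33 = r 32 %/ L ->
     r' 40 = mask_level L (m bLevAt) (m bWM) (m bM) (r 32) -> Q r' m) ->
  wps W mask_code Q r m.
Proof.
move=> [rN0 r1 r2 rL0 mE] WML xn levn HQ /=.
have off_lt := ltn_pmod (r 32) L_gt0.
have qx : r 32 %/ L * L <= r 32 by apply: leq_trunc_div.
have bx : r 32 %/ L <= r 32 by apply: leq_div.
move=> v1 /= e1; rewrite rL0 in e1; split; first by lia.
move=> v2 /= e2; rewrite rL0 e1 in e2; split; first by lia.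
move=> v3 /= e3; rewrite e2 modn_subE in e3; split; first by lia.
move=> v4 /= e4; rewrite e3 r2 in e4; split; first by lia.
move=> v5 /= e5; rewrite mE // e4 addn2 powE // in e5.
move=> v6 /= e6; have := WML v1; rewrite -e6 => v6L.
have pv : v6 %/ v5 * v5 <= v6 by apply: leq_trunc_div.
have dv : v6 %/ v5 <= v6 by apply: leq_div.
move=> v7 /= e7; split; first by lia.
move=> v8 /= e8; rewrite e7 in e8; split; first by lia.
move=> v9 /= e9; rewrite e8 modn_subE e5 e6 e1 in e9.
have v9le : v9 <= v6 by rewrite e9 -e1 -e6 leq_mod.
split; first by lia.
have mlE : mask_level L (m bLevAt) (m bWM) (m bM) (r 32) =
  if v9 != 0 then m bLevAt (v2 + trunc_log 2 v9) else m bM v1 by rewrite /mask_level -e9 e2 e1.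
split=> [/eqP v90|v90].
  move=> v10 /= e10; rewrite mE // lenE in e10; last by lia.
  have tl : trunc_log 2 v9 < L.
    rewrite -(ltn_exp2l _ _ (isT : 1 < 2)); apply: leq_ltn_trans (trunc_logP _ _) _ => //; lia.
  have LL : L < 2 ^ L by apply: ltn_expl.
  move=> v11 /= e11; rewrite e10 r1 subn1 /= in e11; split; first by lia.
  move=> v12 /= e12; split; first by lia.
  move=> v13 /= e13; apply: HQ => /=; first by keep_tac.
    by [].
  by rewrite mlE v90 e13 e12 e11 addnC.
move=> v10 /= e10; apply: HQ => /=; first by keep_tac.
  by [].
by rewrite mlE v90.
Qed.

Lemma wps_range r m (Q : assertion) : statics r m -> small m ->
  r rCnt <= n -> r 32 <= n -> r 33 = r 32 %/ L ->
  r 40 = mask_level L (m bLevAt) (m bWM) (m bM) (r 32) ->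
  (forall r', keep r r' ->
     r' 40 = find_level L (r rCnt) (m bLevAt) (m bWM) (m bM) (m bST) (r 32) -> Q r' m) ->
  wps W range_code Q r m.
Proof.
move=> [rN0 r1 r2 rL0 mE] [s1 s2 s3 s4] cn xn r33 r40 HQ /=.
have jn : r 40 <= n by rewrite r40 /mask_level; case: ifP.
have inW x : x <= 2 * n + 2 -> x < W by clear -WK; lia.
rewrite /find_level -r40 -r33 /= in HQ.
have bn : r 33 <= n by rewrite r33; apply: leq_trans (leq_div _ _) xn.
have tn : (r rCnt).+1 %/ L * L <= n.+1.
  by apply: leq_trans (leq_trunc_div _ _) _.
have cbn : (r rCnt).+1 %/ L <= n.+1 by apply: leq_trans (leq_div _ _) _.
have LL : L <= 2 * n by apply: leq_trans Ln; apply/ltnW/ltn_expl.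
move=> v1 /= e1; rewrite r1 addn1 in e1; fits inW: e1 cn.
move=> v2 /= e2; rewrite rL0 e1 in e2; split; first by apply: inW; rewrite e2; clear -cbn; lia.
rewrite -e2 in HQ tn cbn; clear r33 r40 e1 e2.
have subW a b : a <= n.+1 -> a - b < W by move=> h; apply: inW; clear -h; lia.
move=> v3 /= e3; split; first by rewrite e3; apply: subW.
rewrite -e3 in HQ.
split=> [/eqP v30|v30]; last first.
  apply: HQ; first by keep_tac.
  by rewrite v30.
rewrite (negPf v30) in HQ.
move=> v4 /= e4 v5 /= e5; split; first by rewrite e5; apply: subW; apply: leqW.
move=> v6 /= e6; rewrite e5 -minnE e4 in e6.
have v6n : v6 <= n by rewrite e6 geq_min jn.
fits inW: v6n.
rewrite -e6 in HQ.
move=> v7 /= e7; rewrite r1 in e7; split; first by rewrite e7; apply: subW.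
rewrite -e7 in HQ; have v7n : v7 <= v2 by rewrite e7 leq_subr.
move=> v8 /= e8; split; first by rewrite e8; apply: subW; apply: leq_trans cbn.
rewrite -e8 in HQ.
split=> [/eqP v80|v80]; last first.
  apply: HQ; first by keep_tac.
  by rewrite v80.
rewrite (negPf v80) in HQ.
move=> v9 /= e9 v10 /= e10; split; first by rewrite e10; apply: subW; apply: leqW.
move=> v11 /= e11; rewrite e10 -minnE e9 in e11.
have v11n : v11 <= n by rewrite e11 geq_min v6n.
fits inW: v11n.
rewrite -e11 in HQ.
move=> v12 /= e12; rewrite r1 in e12; split.
  by rewrite e12; apply: subW; apply: leq_trans cbn.
rewrite -e12 in HQ; have v12n : v12 <= v7 by rewrite e12 leq_subr.
move=> v13 /= e13; split.
  by rewrite e13; apply: subW; apply: leq_trans cbn; apply: leq_trans v7n.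
rewrite -e13 in HQ.
split=> [/eqP v130|v130]; last first.
  apply: HQ; first by keep_tac.
  by rewrite v130.
rewrite (negPf v130) in HQ.
have v13n : v13 <= n by clear -e13 e12 e7 cbn v80 e8; lia.
move=> v14 /= e14; rewrite mE // lenE in e14; last by rewrite lt0n v130; clear -v13n; lia.
have k1 : 2 ^ trunc_log 2 v13 <= v13 by apply: trunc_logP => //; rewrite lt0n.
have kL : trunc_log 2 v13 < L.
  rewrite -(ltn_exp2l _ _ (isT : 1 < 2)); apply: leq_ltn_trans k1 _.
  exact: leq_ltn_trans v13n nL.
move=> v15 /= e15; rewrite mE // e14 powE in e15; last exact: ltnW.
move=> v16 /= e16; rewrite e14 r1 subn1 /= in e16.
rewrite -e15 -e16 in HQ; rewrite -e15 in k1; rewrite -e16 in kL.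
fits inW: kL LL.
have v12L : v12 * L <= n.+1.
  by apply: leq_trans tn; rewrite leq_mul2r (leq_trans v12n) ?orbT.
move=> v17 /= e17; rewrite rL0 in e17; split; first by apply: inW; rewrite e17; clear -v12L; lia.
move=> v18 /= e18; rewrite e17 in e18; split; first by rewrite e18; clear -v12L kL LL WK; lia.
move=> v19 /= e19 v20 /= e20; split; first by rewrite e20; apply: subW; apply: leqW.
move=> v21 /= e21; rewrite e20 -minnE e19 e18 in e21.
have v21n : v21 <= n by rewrite e21 geq_min v11n.
fits inW: v21n.
rewrite -e21 in HQ.
have bP : r 33 + v15 <= v12 by clear -k1 e13 v130; lia.
move=> v22 /= e22; rewrite -e22 in HQ; rewrite -e22 in bP.
fits inW: bP v12n v7n cbn.
have v22L : v22 * L <= n.+1.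
  by apply: leq_trans v12L; rewrite leq_mul2r bP orbT.
move=> v23 /= e23; rewrite rL0 in e23; split; first by apply: inW; rewrite e23; clear -v22L; lia.
move=> v24 /= e24; rewrite e23 in e24; split; first by rewrite e24; clear -v22L kL LL WK; lia.
move=> v25 /= e25 v26 /= e26; split; first by rewrite e26; apply: subW; apply: leqW.
move=> v27 /= e27; rewrite e26 -minnE e25 e24 in e27.
have v27n : v27 <= n by rewrite e27 geq_min v21n.
fits inW: v27n.
rewrite -e27 in HQ.
by apply: HQ => /=; first by keep_tac.
Qed.

Lemma wps_tick r m (Q : assertion) : statics r m -> small m ->
  r rCnt <= n ->
  let t := (r rCnt).+1 in let pb := t %/ L - 1 in let off := t %% L in
  (forall r', keep r r' ->
     (off != 0 -> Q r' (updm m bST (pb * L + off)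
       (minn (m bST (pb * L + off - 1)) (m bST ((pb - 2 ^ (off - 1)) * L + off - 1))))) /\
     (off = 0 -> Q r' (updm (updm m bST (pb * L) (m bM pb)) bM (t %/ L) (r rLev)))) ->
  wps W tick_code Q r m.
Proof.
move=> [rN0 r1 r2 rL0 mE] [s1 s2 s3 s4] cn t pb off HQ /=.
have tL : t %/ L <= t by apply: leq_div.
have tL' : t %/ L * L <= t by apply: leq_trunc_div.
have off_lt : off < L by apply: ltn_pmod.
have LL : L < 2 ^ L by apply: ltn_expl.
have pL : pb * L <= t by apply: leq_trans tL'; rewrite leq_mul2r leq_subr orbT.
move=> v1 /= e1; rewrite r1 addn1 -/t in e1; split; first by lia.
move=> v2 /= e2; rewrite rL0 e1 in e2; split; first by lia.
move=> v3 /= e3; rewrite rL0 e2 in e3; split; first by lia.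
move=> v4 /= e4; rewrite e3 e1 modn_subE -/off in e4; split; first by lia.
move=> v5 /= e5; rewrite e2 r1 -/pb in e5; split; first by lia.
move=> v6 /= e6; rewrite rL0 e5 in e6; split; first by lia.
move=> v7 /= e7; rewrite e6 e4 in e7; split; first by lia.
split=> [/eqP v40|v40].
  move=> v8 /= e8; rewrite r1 in e8; split; first by lia.
  move=> v9 /= e9 v10 /= e10.
  (* As [bPow] is shifted by one, its entry at [off] is [2 ^ (off - 1)], the length of the two
     ranges to be combined. *)
  rewrite mE // e4 -[off](@prednK _) ?powE // in e10; [|lia|lia].
  move=> v11 /= e11; split; first by lia.
  have vL : v11 * L <= t.
    by apply: leq_trans pL; rewrite leq_mul2r e11 e5 leq_subr orbT.
  move=> v12 /= e12; rewrite rL0 in e12; split; first by lia.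
  move=> v13 /= e13; split; first by lia.
  move=> v14 /= e14; rewrite r1 in e14; split; first by lia.
  move=> v15 /= e15 v16 /= e16; have v9n : v9 <= n by rewrite e9.
  split; first by lia.
  move=> v17 /= e17; rewrite e16 -minnE in e17; split; first by lia.
  set r' := setr _ 38 _; have [|h _] := HQ r'; first by keep_tac.
  rewrite e7 e17 e9 e15 e8 e7 e14 e13 e12 e11 e10 e5 e4 -subn1.
  by apply: h; rewrite -e4.
move=> v8 /= e8; set r' := setr _ 38 _; have [|_ h] := HQ r'; first by keep_tac.
by rewrite e7 -e4 v40 addn0 e2 e8 e5; apply: h; rewrite -e4.
Qed.

(* Every pass of the machine loop performs one step of the exploration *)
Opaque mask_code range_code tick_code.

Lemma inv_levels S wl : inv S wl -> levels (cnt S) (lev S) (bnd S).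
Proof. by move=> I; split; [apply: (i_bnd0 I) | apply: (i_bnd I) | apply: (i_bndl I)]. Qed.

(** Bounds increase strictly from 1, so region [i] starts after visit number [i]. *)
Lemma lev_leq S wl : inv S wl -> lev S <= cnt S.
Proof.
move=> I; have: forall i, i <= lev S -> i < bnd S i.
  elim=> [|i IH] il; first by rewrite (i_bnd0 I).
  exact: leq_ltn_trans (IH (ltnW il)) (i_bnd I il).
by move=> /(_ _ (leqnn _)) h; rewrite -ltnS; apply: leq_trans (i_bndl I).
Qed.

Lemma cnt_leq S wl : inv S wl -> cnt S <= n.
Proof. by move=> I; rewrite -(i_cnt I) -[X in _ <= X](size_iota 0 n) count_size. Qed.

Lemma fr_lt S wl : inv S wl -> fr S + 1 < W.
Proof. by case/i_fr => _ h; clear -WK h; lia. Qed.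

Ltac statics_tac := split=> //; repeat (apply: updm_low => //).

Lemma step_arc k r m : statics r m -> r rGo != 0 -> running k r m -> r rCur <> 0 ->
  wps W arc_code (decreases looping k) r m.
Proof.
move=> st go [wl [I pot sm F]] c0 /=; have [rN0 r1 r2 rL0 mE] := st.
have /eqP c0' := c0; have frW := fr_lt I.
move=> v1 /= e1 v2 /= e2 v3 /= e3; rewrite r1 in e3; split; first by rewrite e3.
move=> v4 /= e4.
apply: (loopI (inv_arc graph adj arc_pl I c0') pot) => //; last by statics_tac.
by rewrite /abs /do_arc /= e1 e2 e3 e4 addn1 (mE 8) // (mE 9).
Qed.

Lemma step_premise k r m : statics r m -> r rGo != 0 -> running k r m ->
  r rCur = 0 -> r rPj <> 0 ->
  wps W premise_code (decreases looping k) r m.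
Proof.
move=> st go [wl [I pot sm F]] c0 p0; have [rN0 r1 r2 rL0 mE] := st.
have /eqP p0' := p0; have frW := fr_lt I; have cn := cnt_leq I.
have [o [op pjE pv]] := i_pj I p0'; rewrite /= in pjE.
have [on _ _ _] := pg_pars graph op.
move=> v1 /= e1; rewrite r1 pjE subn1 /= in e1; subst v1.
split; first by clear -on WK; lia.
split; first by clear -WK; lia.
move=> v2 /= e2; split=> [v20|v20]; last first.
  move=> v3 /= e3; rewrite v20 in e2.
  apply: (loopI (inv_seen graph I pjE (esym e2)) pot) => //; last by statics_tac.
  by rewrite /abs /do_seen /= e3.
have sn : seen (abs r m) o != 0 by rewrite /= -e2; apply/eqP.
have [y [py sy ny]] := i_seen I op sn; rewrite /= in sy.
have v2c : v2 <= r rCnt by rewrite e2 sy; apply: (leq_num I).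
have v2_gt0 : 0 < v2 by rewrite lt0n; apply/eqP.
have v2n : v2 <= n := leq_trans v2c cn.
set r0 := setr _ 32 _; case: (sm) => s1 s2 s3 s4.
have st0 : statics r0 m by [].
apply: (wps_mask st0) => [//|//|//|r3 k3 r33 r40].
have st3 : statics r3 m by split; rewrite ?k3.
have r32 : r3 32 = v2 by rewrite k3.
apply: (wps_range st3) => [//|||||r4 k4 r440].
- by rewrite k3.
- by rewrite r32.
- by rewrite r33 r32.
- by rewrite r40 r32.
have st4 : statics r4 m by split; rewrite ?k4 ?k3.
have r4E x : x <= 31 -> r4 x = setr (setr r 31 o) 27 0 x.
  move=> h; have h' : x <= 32 := leqW h; rewrite k4 // k3 // /r0 /=.
  by have [xE|//] := eqVneq x 32; rewrite xE in h.
rewrite r32 k3 //= in r440.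
have LV := inv_levels I.
have [|jl jb jb'] := find_levelP L_gt0 LV F v2_gt0 v2c; first exact: leq_ltn_trans cn nL.
rewrite -r440 in jl jb jb'.
have rFrE := r4E 26 isT; have rOneE := r4E 3 isT; rewrite /= in rFrE rOneE.
move=> v3 /= e3; move=> v4 /= e4; rewrite rFrE rOneE r1 in e4; split; first by rewrite e4.
rewrite e2 in jb jb'.
apply: (loopI (inv_wait graph I pjE sn jl jb jb') pot) => //; last first.
- by rewrite /= !r4E.
- by move: F; rewrite /= !r4E.
- by split; try (by rewrite /= r4E); repeat (apply: updm_low => //).
rewrite e3; move: (r4 40) => j.
by rewrite /abs /do_wait /= !r4E //= e4 addn1.
Qed.

Lemma step_apex k r m : statics r m -> r rGo != 0 -> running k r m ->
  r rCur = 0 -> r rPj = 0 -> r rAp <> 0 ->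
  wps W apex_code (decreases looping k) r m.
Proof.
move=> st go [wl [I pot sm F]] c0 p0 a0 /=; have [rN0 r1 r2 rL0 mE] := st.
have /eqP a0' := a0; have frW := fr_lt I; have cn := cnt_leq I; have lc := lev_leq I.
simpl in cn, lc, frW.
move=> v1 /= e1; split=> [/eqP z1|z1].
  split; first by clear -WK; lia.
  rewrite e1 in z1.
  by apply: (loopI (inv_ap0 I c0 p0 a0' z1) pot).
rewrite z1 in e1.
have [I' pot'] := inv_push graph I c0 p0 a0' (esym e1); case: sm => s1 s2 s3 s4.
have LV := inv_levels I; have LV' := inv_levels I'.
have bl : m bBnd (r rLev) <= r rCnt.
  have := i_bndl I; rewrite /= leq_eqVlt => /predU1P[fre|//].
  by have [_ _ /= h] := i_fresh I fre; rewrite h in a0.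
have F' := finv_push L_gt0 LV F bl.
have cb1 : (r rCnt).+1 %/ L <= (r rCnt).+1 by apply: leq_div.
have cb2 : (r rCnt).+1 %/ L * L <= (r rCnt).+1 by apply: leq_trunc_div.
have offL : (r rCnt).+1 %% L < L by apply: ltn_pmod.
have LL : L < 2 ^ L by apply: ltn_expl.
have maskL := mask_lt L_gt0 LV' F'; rewrite /= {1}/upd eqxx in maskL.
have lc' : (r rLev).+1 <= r rCnt := lev_leq I'.
have inW x : x <= 2 * n + 2 -> x < W by clear -WK; lia.
move=> v2 /= e2; rewrite r1 addn1 in e2; fits inW: e2 lc cn.
move=> v3 /= e3; rewrite r1 addn1 in e3; fits inW: e3 lc cn.
move=> v4 /= e4 v5 /= e5; rewrite r1 in e5; split; first by rewrite e5.
move=> v6 /= e6; rewrite rL0 e3 in e6; fits inW: e6 cb1 cn.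
move=> v7 /= e7; rewrite rL0 e6 in e7; fits inW: e7 cb2 cn.
move=> v8 /= e8; rewrite e7 e3 modn_subE in e8; fits inW: e8 offL LL Ln.
move=> v9 /= e9; rewrite e8 r1 addn1 in e9; fits inW: e9 offL LL Ln.
move=> v10 /= e10; rewrite mE // e9 powE in e10; last exact: ltnW.
move=> v11 /= e11 v12 /= e12; rewrite e11 e10 e6 in e12.
have v12L : v12 < 2 ^ L by rewrite e12.
fits inW: v12L Ln.
split; first by clear -WK; lia.
apply: (loopI (inv_push graph I c0 p0 a0' (esym e1)) pot) => //.
- by rewrite /abs /do_push /= e5 addn1 e2 e3 e4 e2.
- by statics_tac.
- split=> //= z; rewrite /upd; case: eqP => // _.
  by rewrite e2; apply: leq_trans lc' cn.
- by rewrite /= e2 e3 e6 e12.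
Qed.

Lemma step_node k r m r31 : statics r m -> r rGo != 0 -> running k r m ->
  r rCur = 0 -> r rPj = 0 -> r rAp = 0 -> r31 = m bHd (r rLev) -> r31 <> 0 ->
  wps W node_code (decreases looping k) (setr r 31 r31) m.
Proof.
move=> st go [wl [I pot sm F]] c0 p0 a0 hE h0 /=; have [rN0 r1 r2 rL0 mE] := st.
have frW := fr_lt I; have cn := cnt_leq I; have lc := lev_leq I; simpl in cn, lc, frW.
have := i_chain I (r rLev); case wlE: (wl (r rLev)) => [|w q] /=; first by rewrite -hE.
rewrite -hE => -[_ _ wE _].
have {}wlE : wl (lev (abs r m)) = w :: q by [].
have [wn _] : w < n /\ True.
  by split=> //; case: (i_cand I (leqnn _) (_ : w \in _)) => //; rewrite wlE inE eqxx.
move=> v1 /= e1 v2 /= e2 v3 /= e3; rewrite wE in e1.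
split=> [/eqP v30|v30].
  rewrite e3 e1 in v30.
  apply: (loopI (inv_skip I wlE v30) pot) => //; last by statics_tac.
  by rewrite /abs /do_skip /= e2 hE.
rewrite e3 e1 in v30.
have IV := inv_visit graph adj I wlE v30 c0 p0 a0; have [I' _] := IV.
have LV := inv_levels I; have LV' := inv_levels I'.
have cn' : (r rCnt).+1 <= n := cnt_leq I'.
have [c5 cE] := codeE wn.
have inW x : x <= 2 * n + 5 -> x < W by clear -WK; lia.
move=> v4 /= e4; rewrite wE in e4; subst v4.
move=> v5 /= e5; rewrite r1 addn1 in e5; split; first by rewrite e5; apply: inW; clear -cn'; lia.
move=> v6 /= e6 v7 /= e7 v8 /= e8; split; first by apply: inW; clear; lia.
move=> v9 /= e9; rewrite e8 mE // in e9; fits inW: e9 c5.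
(* The branches for a par and for any other vertex differ only in the value [x] put into [rAp]. *)
have tick : forall x r0, (forall y, y <= 27 -> r0 y = setr (setr (setr (setr (setr r rVtx w) rCnt v5) rCur v6) rPj v7) rAp x y) ->
    x = (if w \in pars then w.+1 else 0) ->
    wps W tick_code (decreases looping k) r0
      (updm (updm m bHd (r rLev) v2) bNum w v5).
  move=> x r0 r0E xE; case: (sm) => s1 s2 s3 s4.
  have st0 : statics r0 (updm (updm m bHd (r rLev) v2) bNum w v5).
    by split; rewrite ?r0E //; repeat (apply: updm_low => //).
  have r0c : r0 rCnt = (r rCnt).+1 by rewrite r0E //= e5.
  have r0l : r0 rLev = r rLev by rewrite r0E.
  apply: (wps_tick st0) => [//||r' kp]; first by rewrite r0c.
  have r'E y : y <= 27 -> r' y = setr (setr (setr (setr (setr r rVtx w) rCnt v5) rCur v6) rPj v7) rAp x y.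
    by move=> h; rewrite kp ?r0E //; apply: leq_trans h _.
  have loop m' : small m' -> finv L (r rCnt).+1 (r rLev) (m' bBnd) (m' bLevAt) (m' bWM) (m' bM) (m' bST) ->
      (forall b, b < 18 -> m' b = updm (updm m bHd (r rLev) v2) bNum w v5 b) ->
      decreases looping k r' m'.
    move=> sm' F' m'E.
    apply: (loopI IV pot) => //; last first.
    - by rewrite !r'E //= e5.
    - by rewrite !r'E.
    - split; rewrite ?r'E // => b b10; rewrite m'E; last by apply: leq_ltn_trans b10 _.
      by move: b b10; repeat (apply: updm_low => //).
    by rewrite /abs /do_visit /= !r'E //= !m'E //= e5 e6 e7 e2 -hE xE (mE 7) // (mE 10).
  rewrite r0c r0l; split=> off.
    apply: loop => [||b b18] /=; last by rewrite [b == 21]ltn_eqF // (leq_trans b18).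
      split=> //= z; rewrite /upd; case: eqP => // _.
      by rewrite geq_min s4.
    exact: (finv_tick_same L_gt0 F off).
  apply: loop => [||b b18] /=; last first.
  - by rewrite [b == 21]ltn_eqF ?[b == 20]ltn_eqF // (leq_trans b18).
  - exact: (finv_tick_new L_gt0 LV F off).
  split=> //= z; rewrite /upd; case: eqP => // _.
  exact: leq_trans lc cn.
split=> [v90|v90].
  move=> v10 /= e10; rewrite r1 addn1 in e10; fits inW: e10 wn.
  apply: (tick v10).
    by case=> // y h /=; do 32 (case: y h => // y h).
  by rewrite cE e10; case: eqP => // h; move: v90; rewrite e9; clear -c5 h; lia.
split; first by apply: inW; clear; lia.
apply: (tick 0).
  by case=> // y h /=; do 32 (case: y h => // y h).
by rewrite cE; case: eqP => // h; move: v90; rewrite e9 h.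
Qed.

Lemma step_complete k r m r31 : statics r m -> r rGo != 0 -> running k r m ->
  r rCur = 0 -> r rPj = 0 -> r rAp = 0 -> r31 = m bHd (r rLev) -> r31 = 0 ->
  wps W complete_code (decreases looping k) (setr r 31 r31) m.
Proof.
move=> st go [wl [I pot sm F]] c0 p0 a0 hE h0 /=; have [rN0 r1 r2 rL0 mE] := st.
have frW := fr_lt I; have cn := cnt_leq I; have lc := lev_leq I; simpl in cn, lc, frW.
have wl0 : wl (lev (abs r m)) = [::].
  by apply/(chain_nil (i_chain I _)); rewrite /= -hE.
have k0 : 0 < k by apply: leq_ltn_trans pot.
have stop r' : r' rGo = 0 -> r' rCnt <= n -> r' rLev <= n -> statics r' m -> (r' rLev = 0 /\ r' rCnt = n <-> all_linked) ->
    decreases looping k r' m.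
  by move=> g0 cn' ln' st' ans; exists 0 => //; split=> //; right.
have not_linked : (r rLev = 0 /\ r rCnt <> n) \/
    (0 < r rLev /\ num (abs r m) (rgt (apx (abs r m) (r rLev))) < m bBnd (r rLev)) -> ~ all_linked.
  by move=> h /(stuck_not_linked graph pl_arc I c0 p0 a0 wl0 h).
have inW x : x <= 2 * n + 5 -> x < W by clear -WK; lia.
split=> [/eqP l0|l0]; last first.
  split; first by apply: inW.
  apply: stop => //=; first (by apply: leq_trans lc cn); split=> [[_ cE]|lk].
    exact: accept_linked I l0 cE.
  split=> //; apply/eqP; apply/negPn/negP => /eqP cN.
  by apply: not_linked lk; left.
have l0' : 0 < r rLev by rewrite lt0n.
have kl : (r rLev).-1 < r rLev by lia.
have [po oR _] := i_apx I kl; rewrite /= (prednK l0') in po oR.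
have [on _ _ rn] := pg_pars graph po.
have bcn : m bBnd (r rLev) <= (r rCnt).+1 := i_bndl I.
move=> v1 /= e1 v2 /= e2; rewrite e1 r1 addn1 in e2; fits inW: e2 on.
move=> v3 /= e3; rewrite e2 mE // in e3.
move=> v4 /= e4 v5 /= e5 v6 /= e6; fits inW: e6 e5 bcn cn.
split=> [/eqP v60|v60].
  split; first by apply: inW.
  apply: stop => //=; first (by apply: leq_trans lc cn); split=> [[h _]|lk]; first by rewrite h in l0.
  suff h : ~ all_linked by case: (h lk).
  apply: not_linked; right; split=> //=.
  by rewrite /rgt -e3 -e4 -e5; clear -v60 e6; lia.
have br : bnd (abs r m) (lev (abs r m)) <= num (abs r m) (rgt (apx (abs r m) (lev (abs r m)))).
  by rewrite /= /rgt -e3 -e4 -e5; clear -v60 e6; lia.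
have IP := inv_pop I wl0 l0' c0 p0 a0 br.
have LV := inv_levels I.
have cb1 : (r rCnt).+1 %/ L <= (r rCnt).+1 by apply: leq_div.
have cb2 : (r rCnt).+1 %/ L * L <= (r rCnt).+1 by apply: leq_trunc_div.
have offL : (r rCnt).+1 < (r rCnt).+1 %/ L * L + L by have [] := blockP L_gt0 (r rCnt).+1.
have LL : L < 2 ^ L by apply: ltn_expl.
move=> v7 /= e7; rewrite r1 subn1 in e7; fits inW: e7 lc cn.
move=> v8 /= e8; rewrite r1 addn1 in e8; fits inW: e8 cn.
move=> v9 /= e9; rewrite e8 rL0 in e9; fits inW: e9 cb1 cn.
move=> v10 /= e10; rewrite e9 rL0 in e10; fits inW: e10 cb2 cn.
move=> v11 /= e11; fits inW: e11 e10 cb2 cn.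
case: (sm) => s1 s2 s3 s4.
split=> [/eqP v110|v110].
  have bo : m bBnd (r rLev) < (r rCnt).+1 %/ L * L by clear -e11 v110 e10 e5; lia.
  apply: (loopI IP pot) => //.
  - by rewrite /abs /do_pop /= e7.
  - by statics_tac.
  - split=> //= z; rewrite /upd; case: eqP => // _.
    by rewrite e7; clear -lc cn; lia.
  - by rewrite /= e7 e9; apply: finv_pop_old.
have bc : (r rCnt).+1 %/ L * L <= m bBnd (r rLev) by clear -e11 v110 e10 e5; lia.
move=> v12 /= e12; rewrite e5 e10 in e12.
have v12L : v12 < L by clear -e12 offL bcn; lia.
fits inW: v12L LL Ln.
move=> v13 /= e13; rewrite r1 addn1 in e13; fits inW: e13 v12L LL Ln.
move=> v14 /= e14; rewrite mE // e13 powE in e14; last exact: ltnW.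
move=> v15 /= e15 v16 /= e16.
have v16L : v16 < 2 ^ L by apply: leq_ltn_trans (s2 v9); rewrite e16 e15 leq_subr.
fits inW: v16L Ln.
apply: (loopI IP pot) => //.
- by rewrite /abs /do_pop /= e7.
- by statics_tac.
- by split=> //= z; rewrite /upd; case: eqP.
- by rewrite /= e7 e16 e15 e14 e12 e9; apply: finv_pop_current.
Qed.

Lemma step_explore k r m : looping k r m -> r rGo != 0 ->
  wps W explore_body (decreases looping k) r m.
Proof.
move=> [st [[go run]|[g0 _ _ _]]] g; last by rewrite g0 in g.
rewrite /explore_body; split=> [c0|c0]; first exact: step_arc.
split=> [p0|p0]; first exact: step_premise.
split=> [a0|a0]; first exact: step_apex.
move=> v /= e; split=> h.
  exact: step_node.
exact: step_complete.
Qed.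

End Main.

(** * Building the tables *)

Notation rConcls := 1 (only parsing).
Notation rCuts := 2 (only parsing).
Notation rArcs := 6 (only parsing).
Notation rEdges := 7 (only parsing).
Notation rBad := 8 (only parsing).
Notation rPos := 10 (only parsing).

(** The new arc has the largest number and goes to the front, so the lists stay decreasing. *)
Lemma adjacency_add A src head nxt u : adjacency A src head nxt ->
  adjacency A.+1 (upd src A.+1 u) (upd head u A.+1) (upd nxt A.+1 (head u)).
Proof.
case=> h1 h2 h3 h4 h5 h6; split.
- by move=> v; rewrite /upd; case: eqP => // _; apply: leqW.
- move=> v; rewrite /upd; case: (eqVneq v u) => [->|_]; first by rewrite eqxx.
  by move=> hv; rewrite ltn_eqF ?h2 // ltnS.
- move=> e /andP[e0]; rewrite leq_eqVlt => /predU1P[->|eA].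
    by rewrite /upd !eqxx.
  rewrite {2}/upd ltn_eqF // /upd; case: eqP => _; first exact: leqW.
  by apply: h3; rewrite e0.
- move=> e /andP[e0]; rewrite leq_eqVlt /upd => /predU1P[->|eA].
    by rewrite eqxx ltnS.
  by rewrite ltn_eqF // h4 // e0.
- move=> e /andP[e0]; rewrite leq_eqVlt => /predU1P[->|eA].
    rewrite /upd !eqxx => hu; rewrite ltn_eqF ?h2 // ltnS //.
  have eA' : 0 < e <= A by rewrite e0.
  rewrite /upd (ltn_eqF eA) => ne; rewrite ltn_eqF ?h5 //.
  by apply: ltn_trans (h4 _ eA') eA.
- move=> e e' /andP[e0]; rewrite leq_eqVlt => /predU1P[->|eA] e'e.
    rewrite /upd eqxx (ltn_eqF e'e) => <-; have [->//|e'0] := posnP e'.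
    by apply: h3; rewrite e'0.
  rewrite /upd (ltn_eqF eA) (ltn_eqF (ltn_trans e'e eA)).
  by apply: h6; rewrite // e0.
Qed.

Definition edge_table A (head nxt tgt : nat -> nat) (es : seq (nat * nat)) : Prop :=
  exists src, [/\ adjacency A src head nxt, arcs_in es A src tgt, arcs_cover es A src tgt &
    A = 2 * size es].

Lemma edge_table_add A head nxt tgt es u w : edge_table A head nxt tgt es ->
  edge_table A.+2 (upd (upd head u A.+1) w A.+2)
    (upd (upd nxt A.+1 (head u)) A.+2 (upd head u A.+1 w))
    (upd (upd tgt A.+1 w) A.+2 u) ((u, w) :: es).
Proof.
move=> [src [ad h1 h2 AE]].
exists (upd (upd src A.+1 u) A.+2 w); split.
- exact: (adjacency_add w (adjacency_add u ad)).
- move=> e /andP[e0]; rewrite /upd; case: eqP => [_ _|ne2 e2].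
    by right; rewrite inE eqxx.
  case: eqP => [_|ne1]; first by left; rewrite inE eqxx.
  by have [h|h] := h1 e ltac:(lia); [left|right]; rewrite inE h orbT.
- have lift x y e : 0 < e <= A -> src e = x /\ tgt e = y ->
      0 < e <= A.+2 /\ (upd (upd src A.+1 u) A.+2 w e = x /\ upd (upd tgt A.+1 w) A.+2 u e = y).
    by move=> eA h; rewrite /upd !ltn_eqF; [split=> //; lia | lia | lia].
  move=> x y; rewrite inE => /predU1P[[-> ->]|/h2[[e eA h] [e' eA' h']]]; last first.
    have [i1 i2] := lift _ _ _ eA h; have [i3 i4] := lift _ _ _ eA' h'.
    by split; [exists e | exists e'].
  split; [exists A.+1; first by lia | exists A.+2; first by lia].
    by rewrite /upd eqxx ltn_eqF.
  by rewrite /upd eqxx.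
- by rewrite /=; lia.
Qed.

Lemma edge_table0 head nxt tgt : (forall x, head x = 0) -> edge_table 0 head nxt tgt [::].
Proof.
move=> h0; exists (fun=> 0); split=> // [|e]; last by lia.
by split=> [u|u|e|e|e|e e']; rewrite ?h0 //; lia.
Qed.

(** The binary length of [x] is one more than that of [x %/ 2]. The first number of length [l] is
    [2 ^ (l - 1)]; an empty cell of [bPow] shows that it has just been reached. *)
Definition table_body : program := block
  [:: Op Div 12 rPos rTwo; Get 12 bLen 12; Op Add 12 12 rOne; Put bLen rPos 12;
      Get 13 bPow 12; If 13 Skip (Put bPow 12 rPos); Op Add rPos rPos rOne;
      Op Sub 11 11 rOne].

Definition table_inv (n : nat) (ri : nat -> nat) (mi : nat -> nat -> nat) (k : nat) : assertion :=
  fun r m => 0 < r rPos /\ [/\ forall x, x <= 2 -> r x = ri x, r rOne = 1 /\ r rTwo = 2,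
    r 11 = k /\ r rPos + k = (2 * n).+1,
    (forall x, m bLen x = if 0 < x < r rPos then (trunc_log 2 x).+1 else 0) /\
    (forall j, m bPow j = if (0 < j) && (2 ^ j.-1 < r rPos) then 2 ^ j.-1 else 0) &
    forall b, b != bLen -> b != bPow -> m b = mi b].

Lemma table_step W n ri mi k r m : 2 * n + 3 < W ->
  table_inv n ri mi k r m -> r 11 != 0 ->
  wps W table_body (decreases (table_inv n ri mi) k) r m.
Proof.
move=> WN [i0 [rE [r1 r2] [r11 rk] [lenE powE] mE]] k0 /=.
rewrite r11 in k0.
have tl : (if 0 < r rPos %/ 2 < r rPos then (trunc_log 2 (r rPos %/ 2)).+1 else 0) = trunc_log 2 (r rPos).
  have [->//|i1] : r rPos = 1 \/ 1 < r rPos by lia.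
  rewrite (trunc_log2S i1) -divn2.
  by rewrite divn_gt0 // i1 ltn_Pdiv.
have tlb : trunc_log 2 (r rPos) < r rPos.
  by apply: leq_trans (ltn_expl _ (isT : 1 < 2)) (trunc_logP _ _).
have tlp : 2 ^ trunc_log 2 (r rPos) <= r rPos by apply: trunc_logP.
have tlq : r rPos < 2 ^ (trunc_log 2 (r rPos)).+1 by apply: trunc_log_ltn.
move=> v1 /= e1; rewrite r2 in e1; split; first by rewrite e1; apply: leq_ltn_trans (leq_div _ _) _; lia.
move=> v2 /= e2; rewrite lenE e1 tl in e2.
move=> v3 /= e3; rewrite r1 addn1 e2 in e3; split; first by clear -tlb e3 rk WN; lia.
move=> v4 /= e4; rewrite powE e3 /= in e4.
have step m' : (forall j, m' bPow j = if j == v3 then 2 ^ v3.-1 else m bPow j) ->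
    m' bLen = upd (m bLen) (r rPos) v3 -> (forall b, b != bLen -> b != bPow -> m' b = m b) ->
    forall v5, v5 = r rPos + r rOne -> forall v6, v6 = r 11 - r rOne ->
    decreases (table_inv n ri mi) k
      (setr (setr (setr (setr (setr (setr r 12 v1) 12 v2) 12 v3) 13 v4) 10 v5) 11 v6) m'.
  move=> m'p m'l m'E v5 -> v6 ->; exists k.-1; first by lia.
  rewrite r1 addn1 r11; split=> //; split=> /=.
  - by case=> [|[|[]]] // *; apply: rE.
  - by [].
  - by lia.
  - split=> [x|j].
      rewrite m'l /upd lenE e3; have [->|ne] := eqVneq x (r rPos); first by rewrite i0 leqnn.
      by rewrite [x < _.+1]ltnS [x <= r _]leq_eqVlt (negPf ne).
    rewrite m'p powE e3; have [->|ne] := eqVneq j; first by rewrite /= ltnS tlp.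
    (* The bound moves up by one, so a power can newly enter only if it is the present number; its
       exponent would then be the logarithm treated before. *)
    case: j ne => //= j ne; suff h : 2 ^ j <> r rPos.
      by rewrite [in RHS](_ : (2 ^ j < (r rPos).+1) = (2 ^ j < r rPos)) // ltnS leq_eqVlt; case: eqP.
    move=> h; move: ne; rewrite -h trunc_expnK // eqxx //.
  - by move=> b b1 b2; rewrite m'E // mE.
have fin m' : (forall j, m' bPow j = if j == v3 then 2 ^ v3.-1 else m bPow j) ->
    m' bLen = upd (m bLen) (r rPos) v3 -> (forall b, b != bLen -> b != bPow -> m' b = m b) ->
    forall v5, v5 = r rPos + r rOne -> v5 < W /\ forall v6, v6 = r 11 - r rOne -> v6 < W /\
    decreases (table_inv n ri mi) k
      (setr (setr (setr (setr (setr (setr r 12 v1) 12 v2) 12 v3) 13 v4) 10 v5) 11 v6) m'.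
  move=> h1 h2 h3 v5 e5; split; first by clear -e5 r1 rk WN; lia.
  move=> v6 e6; split; first by clear -e6 r11 rk WN; lia.
  exact: step e5 _ e6.
split=> v40; apply: fin => //=.
- move=> j; case: eqP => // ->; rewrite powE e3 /=.
  by move: v40; rewrite e4; case: ifP.
- by move=> b b1 b2; rewrite (negPf b1).
- move=> j; rewrite /upd e3 /=; case: eqP => // _.
  move: e4; rewrite v40; case: ltnP => [_ h|h _]; last by apply/eqP; rewrite eqn_leq h tlp.
  by have := expn_gt0 2 (trunc_log 2 (r rPos)); rewrite -h.
- by move=> b b1 b2; rewrite (negPf b1) (negPf b2).
Qed.

Definition table_code : program := Seq
  (block [:: Const rOne 1; Const rTwo 2; Const rPos 1; Op Add 11 rN rN])
  (While 11 table_body).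

Lemma wp_table W n r m : 2 * n + 3 < W -> r rN = n ->
  (forall x, m bLen x = 0) -> (forall x, m bPow x = 0) ->
  wp W table_code (4 + ((cost table_body).+1 * (2 * n) + 1)) (fun r' m' =>
    [/\ forall x, x <= 2 -> r' x = r x, r' rOne = 1 /\ r' rTwo = 2,
        forall x, 0 < x <= 2 * n -> m' bLen x = (trunc_log 2 x).+1,
        forall j, 2 ^ j <= 2 * n -> m' bPow j.+1 = 2 ^ j &
        forall b, b != bLen -> b != bPow -> m' b = m b]) r m.
Proof.
move=> WN rN0 len0 pow0; apply: wp_seq; apply: wps_wp => /=.
split; first by lia.
split; first by lia.
split; first by lia.
move=> v /= e; rewrite rN0 in e; split; first by lia.
have init : table_inv n r m (2 * n) (setr (setr (setr (setr r rOne 1) rTwo 2) rPos 1) 11 v) m.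
  split=> //; split=> //=.
  - by case=> [|[|[]]].
  - by split; lia.
  - split=> [x|j]; [rewrite len0; case: ifP => //; lia | rewrite pow0].
    by have := expn_gt0 2 j.-1; case: ifP => //; lia.
apply: wp_weaken (wp_while (J := table_inv n r m) (fun k r m => table_step WN) init) => //.
move=> r' m' [[k [p0 [h1 h2 [h3 h4] [h5 h6] h7]]] h8]; split=> //.
- by move=> x x0; rewrite h5; case: ifP => //; lia.
- by move=> j j0; rewrite h6 /=; case: ifP => //; lia.
Qed.

(** * Parsing the forest from right to left *)

Definition add_arcs (u w : nat) : program := block
  [:: Op Add rArcs rArcs rOne; Put bTgt rArcs w; Get 18 bHead u; Put bNxt rArcs 18;
      Put bHead u rArcs;
      Op Add rArcs rArcs rOne; Put bTgt rArcs u; Get 18 bHead w; Put bNxt rArcs 18;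
      Put bHead w rArcs].

(** Register 13 adds up the defects: the code of the target, which is 0 for a variable; the
    difference of the names, as the sum of both truncated differences; and a flag for a target hit
    before. *)
Definition match_code : program := block
  [:: Get 13 bCode 15; Get 16 bName 10; Get 17 bName 15; Op Sub 18 16 17;
      Op Add 13 13 18; Op Sub 18 17 16; Op Add 13 13 18; Get 18 bHit 15;
      Op Add 13 13 18; Put bHit 15 rOne; If 13 (Const rBad 1) Skip].

(** Among the codes of leaves, the odd ones are the negative. Of these, 1 is a dual variable and 3
    is [Bot], which is told apart by subtracting from 3. *)
Definition leaf_code : program := block
  [:: Op Add 14 10 rOne; Put bEnd 10 14; Op Div 14 11 rTwo; Op Mul 14 14 rTwo;
      Op Sub 14 11 14;
      If 14 (block [:: Get 15 bTarget 10; add_arcs 10 15; Op Add rEdges rEdges rOne;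
                       Const 13 3; Op Sub 13 13 11; If 13 match_code Skip])
            Skip].

(** Going backwards, the ends of both argument subtrees are known when the connective is met: the
    end of the left one is the root of the right one, whose end is that of the whole. *)
Definition node_table_code : program := block
  [:: Op Add 14 10 rOne; Get 15 bEnd 14; Get 16 bEnd 15; Put bEnd 10 16;
      Op Sub 13 11 12;
      If 13 (block [:: Put bPar 14 14; Put bPar 15 14; Op Add rEdges rEdges rOne])
            (block [:: add_arcs 10 15; add_arcs 10 14; Op Add rEdges rEdges rTwo])].

Definition parse_body : program := block
  [:: Op Sub 10 10 rOne; Get 11 bCode 10; Const 12 4; Op Sub 13 12 11;
      If 13 leaf_code node_table_code].

Lemma low_set (ri r : nat -> nat) b x v : b < x -> (forall y, y <= b -> r y = ri y) ->
  forall y, y <= b -> setr r x v y = ri y.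
Proof. by move=> bx h y yb /=; rewrite ltn_eqF ?h //; apply: leq_ltn_trans bx. Qed.

Lemma mem_set (mi m : nat -> nat -> nat) a j v : 4 < a <= 10 ->
  (forall b, b <= 4 \/ 10 < b -> m b = mi b) ->
  forall b, b <= 4 \/ 10 < b -> updm m a j v b = mi b.
Proof. by move=> a5 h b b5 /=; case: eqP => [ba|_]; [lia | apply: h]. Qed.

Ltac low_tac := repeat (apply: low_set => //).
Ltac mem_tac := repeat (apply: mem_set => //).

Section Parse.

Variables (G : cut_sequent) (f : leaf_function G) (W : nat).

Let n := size (labels G).
Let C := components G.
Let sf := sub C.

Lemma size_plain_edges_at i : i < n -> size (plain_edges_at f i) <= 2.
Proof.
move=> il; rewrite /plain_edges_at /tensor_edges /leaf_edge labE // /is_tensor.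
by case: (sub (components G) i) => [[]||].
Qed.

Lemma size_plain_edges_from i : i <= n -> size (plain_edges_from f i) <= 2 * (n - i).
Proof.
move=> il; move jE : (n - i) => j; elim: j i il jE => [|j IH] i il jE.
  by rewrite /plain_edges_from -/n jE.
have i_lt : i < n by lia.
rewrite plain_edges_fromS // size_cat.
have := size_plain_edges_at i_lt; have := IH i.+1 i_lt; lia.
Qed.

Hypothesis W_size : 30 * n + 30 <= W.
Hypothesis W_name : forall i, i < n -> name (lab G i) + 10 < W.

Definition presented (m : nat -> nat -> nat) : Prop :=
  [/\ forall i, i < n -> m bCode i = code (lab G i),
      forall i, i < n -> m bName i = name (lab G i) &
      forall i, m bTarget i = target f i].

Definition dual_at j := is_dual (lab G j).

Definition matched j := is_var (lab G (target f j)) && (name (lab G j) == name (lab G (target f j))).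

(** The conditions that can be tested leaf by leaf, agreement and injectivity. Surjectivity has to
    wait until all hits are recorded. *)
Definition matches_from i : Prop :=
  (forall j, i <= j < n -> dual_at j -> matched j) /\
  (forall j j', i <= j < n -> i <= j' < n -> dual_at j -> dual_at j' ->
     target f j = target f j' -> j = j').

Definition premises o y : Prop := y = o.+1 \/ y = right_arg C o.

Record parsed (ri : nat -> nat) (mi : nat -> nat -> nat) (i : nat)
    (r : nat -> nat) (m : nat -> nat -> nat) : Prop := Parsed {
  pr_low : forall x, x <= 5 -> r x = ri x;
  pr_pos : r rPos = i /\ i <= n;
  pr_mem : forall b, b <= 4 \/ 10 < b -> m b = mi b;
  pr_edges : edge_table (r rArcs) (m bHead) (m bNxt) (m bTgt) (plain_edges_from f i);
  pr_count : r rEdges = size (plain_edges_from f i) + count (is_par C) (iota i (n - i));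
  pr_end : forall j, i <= j < n -> m bEnd j = close C j;
  pr_par : forall y o, m bPar y = o.+1 -> [/\ i <= o < n, is_par C o & premises o y];
  pr_prem : forall o y, i <= o < n -> is_par C o -> premises o y -> m bPar y = o.+1;
  pr_hit : forall t, m bHit t <= 1 /\
    (m bHit t != 0 <-> exists2 j, i <= j < n & dual_at j /\ target f j = t);
  pr_bad : r rBad = 0 <-> matches_from i
}.

Lemma count_iotaS (P : pred nat) i : i < n ->
  count P (iota i (n - i)) = P i + count P (iota i.+1 (n - i.+1)).
Proof. by move=> il; have -> : n - i = (n - i.+1).+1 by lia. Qed.

Lemma parsed_par_free ri mi i r m y : parsed ri mi i.+1 r m -> i < n ->
  is_par C i || is_tensor C i -> premises i y -> m bPar y = 0.
Proof.
move=> P il bi py; case E: (m bPar y) => [//|o].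
have [/andP[io on] po pz] := pr_par P E; exfalso.
have oF : o < size (forest C) by rewrite size_forest.
by apply: (arg_unique io oF bi (z := y) _ py pz) => //; rewrite po.
Qed.

Lemma parse_step ri mi i r m : presented mi -> ri rOne = 1 -> ri rTwo = 2 ->
  parsed ri mi i.+1 r m ->
  wps W parse_body (fun r' m' => parsed ri mi i r' m') r m.
Proof.
move=> [codeE nameE targE] ri1 ri2 P; case: (P) => low [pos il] memE ed cntE endE parE premE hitE badE.
have iF : i < size (forest C) by rewrite size_forest.
have r1 : r rOne = 1 by rewrite low.
have r2 : r rTwo = 2 by rewrite low.
have labi : lab G i = root_label (sf i) by rewrite labE.
have szE := size_plain_edges_from il.
have [_ [_ _ _ AE]] := ed.
have cnt_le : count (is_par C) (iota i.+1 (n - i.+1)) <= n - i.+1.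
  by rewrite -[X in _ <= X](size_iota i.+1) count_size.
have inW x : x <= 20 * n + 20 -> x < W by clear -W_size; lia.
have ids j : i <= j < n -> j = i \/ i < j < n.
  by move=> /andP[]; rewrite leq_eqVlt => /predU1P[->|-> ->]; [left|right].
have not_dual : ~~ dual_at i -> matches_from i <-> matches_from i.+1.
  move=> nd; split=> [[h1 h2]|[h1 h2]]; split.
  - by move=> j jn; apply: h1; lia.
  - by move=> j j' jn jn'; apply: h2; lia.
  - by move=> j /ids[->|jn] // dj; [rewrite dj in nd | apply: h1].
  - move=> j j' /ids[->|jn] /ids[->|jn'] // dj dj'; try by rewrite ?dj ?dj' in nd.
    exact: h2.
have not_dual_hit t : ~~ dual_at i ->
    (exists2 j, i <= j < n & dual_at j /\ target f j = t) <->
    (exists2 j, i < j < n & dual_at j /\ target f j = t).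
  move=> nd; split=> -[j jn [dj tj]]; last by exists j; [lia|].
  by case: (ids j jn) => [ji|jn']; [subst j; rewrite dj in nd | exists j].
pose tracked (r' : nat -> nat) (m' : nat -> nat -> nat) :=
  (forall t, m' bHit t <= 1 /\
    (m' bHit t != 0 <-> exists2 j, i <= j < n & dual_at j /\ target f j = t)) /\
  (r' rBad = 0 <-> matches_from i).
(* The obligations common to all kinds of vertices; the fields of [parsed] are recovered from the
   changes made at [i]. *)
have finish r' m' : (forall y, y <= 5 -> r' y = ri y) -> r' rPos = i ->
    (forall b, b <= 4 \/ 10 < b -> m' b = mi b) ->
    edge_table (r' rArcs) (m' bHead) (m' bNxt) (m' bTgt)
      (plain_edges_at f i ++ plain_edges_from f i.+1) ->
    r' rEdges = r rEdges + size (plain_edges_at f i) + is_par C i ->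
    m' bEnd = upd (m bEnd) i (close C i) ->
    m' bPar = (if is_par C i then upd (upd (m bPar) i.+1 i.+1) (right_arg C i) i.+1 else m bPar) ->
    tracked r' m' -> parsed ri mi i r' m'.
  move=> f1 f2 f3 f4 f5 f6 f7 [f8 f9]; split=> //.
  - by split=> //; apply: ltnW.
  - by rewrite plain_edges_fromS.
  - by rewrite plain_edges_fromS // size_cat count_iotaS // f5 cntE; lia.
  - move=> j /ids[->|jn]; first by rewrite f6 /upd eqxx.
    by rewrite f6 /upd gtn_eqF ?endE //; case/andP: jn.
  - move=> y o; rewrite f7; case: ifP => pi.
      rewrite /upd; case: eqP => [->|_]; first by case=> <-; rewrite leqnn; split=> //; right.
      case: eqP => [->|_]; first by case=> <-; rewrite leqnn; split=> //; left.
      by move=> /parE[/andP[io on] po pz]; rewrite (ltnW io) on.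
    by move=> /parE[/andP[io on] po pz]; rewrite (ltnW io) on.
  - move=> o y /ids[->|jn] po py.
      by rewrite f7 po /upd; case: py => ->; rewrite ?eqxx //; case: eqP.
    rewrite f7; case: ifP => pi; last exact: premE.
    have bi : is_par C i || is_tensor C i by rewrite pi.
    have free z : premises i z -> (y == z) = false.
      move=> pz; apply/eqP => yz; have := parsed_par_free P il bi pz.
      by rewrite -yz (premE o).
    by rewrite /upd !free ?(premE o) //; [left|right].
have unmatched r' m' : ~~ dual_at i -> m' bHit = m bHit -> r' rBad = r rBad -> tracked r' m'.
  move=> nd hE bE; split; last by rewrite bE badE not_dual.
  by move=> t; rewrite hE; have [h1 h2] := hitE t; split=> //; rewrite h2 not_dual_hit.
have closeE := close_rec iF.
have peE : plain_edges_at f i = tensor_edges C i ++ leaf_edge f i by [].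
rewrite /tensor_edges /leaf_edge /is_tensor -/sf in peE.
have parE' : is_par C i = if sf i is Par _ _ then true else false by [].
rewrite /is_tensor parE' -/sf in closeE.
have ndE : dual_at i = is_dual (lab G i) by [].
rewrite /parse_body /=.
move=> v1 /= e1; rewrite pos r1 subn1 /= in e1; subst v1.
fits inW: il.
move=> v2 /= e2; rewrite memE in e2; last by left.
rewrite codeE // labi in e2.
split; first by apply: inW; lia.
move=> v3 /= e3.
case sE: (sf i) e2 labi closeE peE parE' => [a|A B|A B] /= e2 labi closeE peE parE'; rewrite labi in ndE peE.
- have c3 : v2 <= 3 by rewrite e2; case: (a).
  fits inW: e3.
  split=> v30; last by clear -e3 v30 c3; lia.
  move=> v4 /= e4; rewrite r1 addn1 in e4; fits inW: e4 il.
  move=> v5 /= e5; rewrite r2 in e5; fits inW: e5 c3.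
  move=> v6 /= e6; rewrite r2 in e6; fits inW: e5 e6 c3.
  move=> v7 /= e7; fits inW: e7 c3.
  have v7E : v7 = is_neg (LAtom a) by rewrite e7 e6 e5 e2; case: (a).
  have [ni|ni] := boolP (is_neg (LAtom a)); rewrite ?ni ?(negPf ni) in v7E peE; last first.
    split=> v70; first by rewrite v7E in v70.
    apply: finish; [low_tac|by []|mem_tac|by rewrite peE|by rewrite /= peE parE' !addn0| | | ].
    + by rewrite /= closeE e4.
    + by rewrite parE'.
    + by apply: unmatched; rewrite // ndE; case: (a) ni.
  split=> v70; last by rewrite v7E in v70.
  move=> v8 /= e8; rewrite memE in e8; last by left.
  rewrite targE in e8.
  have tn : v8 < n by rewrite e8; apply: target_lt => //; rewrite labi.
  have ed' := edge_table_add i v8 ed.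
  rewrite -e8 in peE; rewrite /= in peE.
  move=> v9 /= e9; rewrite r1 addn1 in e9; fits inW: e9 AE szE il.
  move=> v10 /= e10 v11 /= e11; rewrite r1 addn1 e9 in e11.
  fits inW: e11 AE szE il.
  move=> v12 /= e12 v13 /= e13; rewrite r1 addn1 in e13.
  fits inW: e13 cntE cnt_le szE il.
  split; first by apply: inW; lia.
  rewrite -e11 -e9 -e12 -e10 in ed'.
  move=> v14 /= e14; fits inW: e14.
  split=> v140; last first.
    apply: finish; [low_tac|by []|mem_tac|by rewrite peE|by rewrite /= peE parE' e13 addn0 addn1| | | ].
    + by rewrite /= closeE e4.
    + by rewrite parE'.
    + by apply: unmatched; rewrite // ndE; move: e14 c3; rewrite e2 v140; case: (a).
  have da : is_dual (LAtom a).
    by move: e14 v140 ni; rewrite e2; case: (a) => //= -> /=.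
  have mname j : j < n -> mi bName j + 10 < W by move=> jn; rewrite nameE //; apply: W_name.
  have mcode : mi bCode v8 <= 5 by rewrite codeE //; case: (lab G v8) => [[]||].
  have hit1 := (hitE v8).1; have n1 := mname _ il; have n2 := mname _ tn.
  move=> v15 /= e15; rewrite memE in e15; last by left.
  move=> v16 /= e16; rewrite memE in e16; last by left.
  move=> v17 /= e17; rewrite memE in e17; last by left.
  move=> v18 /= e18; split; first by clear -e18 e16 n1; lia.
  move=> v19 /= e19; split; first by clear -e19 e18 e16 e15 mcode n1; lia.
  move=> v20 /= e20; split; first by clear -e20 e17 n2; lia.
  move=> v21 /= e21; split; first by clear -e21 e20 e19 e18 e17 e16 e15 mcode n1 n2; lia.
  move=> v22 /= e22 v23 /= e23.
  split; first by clear -e23 e22 hit1 e21 e20 e19 e18 e17 e16 e15 mcode n1 n2; lia.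
  have v23E : v23 = 0 <-> matched i /\ m bHit v8 = 0.
    rewrite /matched -e8 -nameE // -nameE // -e16 -e17.
    have -> : is_var (lab G v8) = (v15 == 0).
      by rewrite e15 codeE //; case: (lab G v8) => [[]||].
    split=> [h|[/andP[/eqP h1 /eqP h2] h3]]; last by clear -e23 e22 e21 e20 e19 e18 h1 h2 h3; lia.
    by split; [apply/andP; split; apply/eqP|]; clear -e23 e22 e21 e20 e19 e18 h; lia.
  have di : dual_at i by rewrite ndE.
  have hits t : upd (m bHit) v8 (r rOne) t <= 1 /\
      (upd (m bHit) v8 (r rOne) t != 0 <-> exists2 j, i <= j < n & dual_at j /\ target f j = t).
    rewrite r1 /upd; case: eqP => [->|ne].
      by split=> //; split=> // _; exists i; rewrite ?leqnn.
    have [h1 h2] := hitE t; split=> //; rewrite h2; split=> -[j jn [dj tj]].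
      by exists j; [lia|].
    by case: (ids j jn) => [ji|jn']; [subst j; case: ne; rewrite e8 | exists j].
  split=> v230.
    split; first by apply: inW; lia.
    apply: finish; [low_tac|by []|mem_tac|by rewrite peE|by rewrite /= peE parE' e13 addn0 addn1| | |split; [exact: hits|]].
    + by rewrite /= closeE e4.
    + by rewrite parE'.
    + split=> // -[m1 m2]; case: v230; apply/v23E; split.
        by apply: m1; rewrite ?leqnn.
      have [_ h2] := hitE v8; case: (eqVneq (m bHit v8) 0) => // /h2[j jn [dj tj]].
      have := m2 i j; rewrite leqnn il /= => /(_ isT) h.
      by have := h ltac:(lia) di dj; rewrite tj e8 => /(_ erefl); lia.
  have [ma h0] := v23E.1 v230.
  (* An unset hit mark means that no later dual leaf has this target, so injectivity extends to
     [i]. *)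
  have free j : i < j < n -> dual_at j -> target f j <> target f i.
    move=> jn dj tj; have [_ h2] := hitE v8.
    suff : m bHit v8 != 0 by rewrite h0.
    by apply/h2; exists j; rewrite // tj -e8.
  apply: finish; [low_tac|by []|mem_tac|by rewrite peE|by rewrite /= peE parE' e13 addn0 addn1| | |split; [exact: hits|]].
  + by rewrite /= closeE e4.
  + by rewrite parE'.
  + rewrite /= badE; split=> -[m1 m2]; split.
    * by move=> j /ids[->|jn] //; apply: m1.
    * move=> j j' /ids[->|jn] /ids[->|jn'] // dj dj' tt; last exact: m2.
        by case: (free j').
      by case: (free j).
    * by move=> j jn; apply: m1; lia.
    * by move=> j j' jn jn'; apply: m2; lia.
all: have bi : is_par C i || is_tensor C i by rewrite /is_par /is_tensor -/sf sE.
all: have [a1 a2 rE _] := args_close iF bi; rewrite size_forest -/n in a2.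
all: have a3 := ltn_trans a1 a2.
all: fits inW: e3.
all: split=> v30; first by clear -e3 v30 e2; lia.
all: move=> v4 /= e4; rewrite r1 addn1 in e4; subst v4; fits inW: il.
all: move=> v5 /= e5; rewrite endE -?rE in e5; last by lia.
all: subst v5; move=> v6 /= e6; rewrite endE -?closeE in e6; last by lia.
all: subst v6; move=> v7 /= e7; fits inW: e7 e2.
- split=> v70; first by clear -e7 e2 v70; lia.
  have ed' := edge_table_add i i.+1 (edge_table_add i (right_arg C i) ed).
  have sz2 : size (plain_edges_from f i.+1) <= 2 * n by clear -szE; lia.
  move=> v8 /= e8; rewrite r1 addn1 in e8; fits inW: e8 AE sz2.
  move=> v9 /= e9 v10 /= e10; rewrite r1 addn1 e8 in e10.
  fits inW: e10 AE sz2.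
  move=> v11 /= e11 v12 /= e12; rewrite r1 addn1 e10 in e12.
  fits inW: e12 AE sz2.
  move=> v13 /= e13 v14 /= e14; rewrite r1 addn1 e12 in e14.
  fits inW: e14 AE sz2.
  move=> v15 /= e15 v16 /= e16; rewrite r2 in e16.
  fits inW: e16 cntE cnt_le sz2.
  apply: finish; [low_tac|by []|mem_tac| |by rewrite /= peE parE' e16 addn0|by []|by rewrite parE'|by apply: unmatched; rewrite ?ndE].
  rewrite peE /= e14 -e12 -e10 -e8 in ed' *.
  by rewrite e15 e13 e11 e9.
- split=> v70; last by clear -e7 e2 v70; lia.
  move=> v8 /= e8; rewrite r1 in e8; fits inW: e8 cntE cnt_le szE il.
  apply: finish; [low_tac|by []|mem_tac|by rewrite peE|by rewrite /= peE parE' e8 addn0|by []|by rewrite parE'|by apply: unmatched; rewrite ?ndE].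
Qed.

End Parse.

(** Only dual leaves set marks in [bHit]; a variable leaf, of code 0, without a mark is missed by
    the matching. *)
Definition hit_body : program := block
  [:: Op Sub rPos rPos rOne; Get 11 bCode rPos;
      If 11 Skip (block [:: Get 12 bHit rPos; If 12 Skip (Const rBad 1)])].

(** The input does not say where the cut pairs begin; the position is found by jumping over the
    conclusions from root to root. *)
Definition skip_body : program := block
  [:: Get rPos bEnd rPos; Op Sub 11 11 rOne].

Definition cut_body : program := block
  [:: Get 12 bEnd rPos; add_arcs rPos 12; Op Add rEdges rEdges rOne;
      Get rPos bEnd 12; Op Sub 11 11 rOne].

Section Tables.

Variables (G : cut_sequent) (f : leaf_function G) (W : nat).

Let n := size (labels G).
Let C := components G.

Lemma size_cut_edges_from o As : size (cut_edges_from o As) = size As.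
Proof. by elim: As o => //= A As IH o; rewrite IH. Qed.

Lemma size_components : size (components G) <= n.
Proof.
rewrite /n -(size_forest G) size_forest_sumn; elim: (components G) => //= A As IH.
by have := tree_size_gt0 A; lia.
Qed.

Lemma size_concls_cuts : size (concls G) + size (cuts G) <= n.
Proof.
apply: leq_trans size_components; rewrite size_cat leq_add2l.
by elim: (cuts G) => //= A As IH; lia.
Qed.

Lemma size_plain_edges : size (plain_edges f) <= 3 * n.
Proof.
rewrite size_cat size_cut_edges_from; have := size_plain_edges_from f (leq0n n).
by have := size_concls_cuts; rewrite -/n; lia.
Qed.

Hypothesis W_size : 30 * n + 30 <= W.

Variables (ri : nat -> nat) (mi : nat -> nat -> nat).
Hypothesis ri_one : ri rOne = 1.
Hypothesis mi_presented : presented f mi.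

Record tabled (es : seq (nat * nat)) (r : nat -> nat) (m : nat -> nat -> nat) : Prop := Tabled {
  tb_low : forall x, x <= 5 -> r x = ri x;
  tb_mem : forall b, b <= 4 \/ 10 < b -> m b = mi b;
  tb_edges : edge_table (r rArcs) (m bHead) (m bNxt) (m bTgt) es;
  tb_count : r rEdges = size es + count (is_par C) (iota 0 n);
  tb_end : forall j, j < n -> m bEnd j = close C j;
  tb_par : forall y o, m bPar y = o.+1 -> [/\ o < n, is_par C o & premises G o y];
  tb_prem : forall o y, o < n -> is_par C o -> premises G o y -> m bPar y = o.+1;
  tb_bad : r rBad = 0 <-> matching f
}.

Definition hit_inv (r0 : nat -> nat) (m0 : nat -> nat -> nat) (k : nat) : assertion :=
  fun r m => [/\ forall x, x <= 7 -> r x = r0 x, m = m0, r rPos = k /\ k <= n &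
    r rBad = 0 <-> r0 rBad = 0 /\ (forall j, k <= j < n -> m0 bCode j = 0 -> m0 bHit j <> 0)].

Lemma hit_step r0 m0 k r m : r0 rOne = 1 -> hit_inv r0 m0 k r m -> r rPos != 0 ->
  wps W hit_body (decreases (hit_inv r0 m0) k) r m.
Proof.
move=> r01 [rE -> [pos kn] badE] p0 /=.
have k0 : 0 < k by rewrite -pos lt0n.
have r1 : r rOne = 1 by rewrite rE.
move=> v1 /= e1; rewrite pos r1 subn1 in e1; split; first by clear -e1 kn W_size; lia.
have next (P : Prop) : (P <-> (m0 bCode v1 = 0 -> m0 bHit v1 <> 0)) ->
    (r rBad = 0 /\ P) <->
    (r0 rBad = 0 /\ (forall j, k.-1 <= j < n -> m0 bCode j = 0 -> m0 bHit j <> 0)).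
  move=> PE; rewrite badE PE; split=> [[[b0 h] h']|[b0 h]].
    split=> // j jk; have [->|ne] := eqVneq j v1; first exact: h'.
    by apply: h; move: jk ne; rewrite e1; clear -k0; lia.
  split; first by split=> // j jk; apply: h; clear -jk; lia.
  by apply: h; rewrite e1; clear -k0 kn; lia.
have fin r' : (forall x, x <= 7 -> r' x = r0 x) -> r' rPos = v1 -> forall P : Prop,
    (P <-> (m0 bCode v1 = 0 -> m0 bHit v1 <> 0)) -> (r' rBad = 0 <-> r rBad = 0 /\ P) ->
    decreases (hit_inv r0 m0) k r' m0.
  move=> h1 h2 P h3 h4; exists k.-1; first by rewrite ltn_predL.
  split=> //; first by rewrite h2 e1; split=> //; clear -kn; lia.
  by rewrite h4 next.
move=> v2 /= e2; split=> v20.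
  apply: (fin (setr _ _ _) _ _ True _ _); [by low_tac | by [] | by split=> // _ h; case: v20; rewrite e2 | by split; [split|case]].
move=> v3 /= e3; split=> v30.
  apply: (fin (setr _ _ _) _ _ True _ _); [by low_tac | by [] | by split=> // _ _; rewrite -e3 | by split; [split|case]].
split; first by clear -W_size; lia.
apply: (fin (setr _ _ _) _ _ False _ _); [by low_tac | by [] | | by split; [|case]].
by split=> // h; apply: h; rewrite -?e2 -?e3.
Qed.

Lemma tabled_hits r0 m0 r m : parsed f ri mi 0 r0 m0 -> hit_inv r0 m0 0 r m ->
  tabled (plain_edges_from f 0) r m.
Proof.
move=> P [rE -> _ badE]; case: P => low [_ _] memE ed cntE endE parE premE hitE badE0.
split=> //.
- by move=> x x5; rewrite rE ?low //; apply: leq_trans x5 _.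
- by rewrite rE.
- by rewrite rE // cntE subn0.
- rewrite badE badE0 (matchingP f); have [codeE _ _] := mi_presented.
  have mcode : m0 bCode = mi bCode by apply: memE; left.
  have var0 j : j < n -> m0 bCode j = 0 <-> is_var (lab G j).
    by move=> jn; rewrite mcode codeE //; case: (lab G j) => [[]||].
  split=> [[[h1 h2] h3]|[h1 h2 h3]].
    split=> [i il di|i j il jl di dj|t tl vt]; first exact: h1.
      exact: h2.
    have [_ ht] := hitE t; have /eqP/ht[j jn [dj tj]] := h3 t tl ((var0 t tl).2 vt).
    by exists j.
  split; first by split=> [j jn dj|j j' jn jn' dj dj'];  [apply: h1 | apply: h2].
  move=> t tl ct; apply/eqP/(hitE t).2.
  by have [j [jn dj tj]] := h3 t tl ((var0 t tl).1 ct); exists j.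
Qed.

Lemma tabled_set es r m x v : 8 < x -> tabled es r m -> tabled es (setr r x v) m.
Proof.
move=> x8 T; have lowE y : y <= 8 -> setr r x v y = r y.
  by move=> y8; rewrite /= ltn_eqF //; apply: leq_ltn_trans x8.
case: T => *; split; rewrite ?lowE // => y y5; rewrite lowE; auto.
Qed.

Lemma sub_offset pre X post : C = pre ++ X :: post ->
  sub C (sumn (map tree_size pre)) = X /\ sumn (map tree_size pre) < n.
Proof.
move=> CE; rewrite -size_forest_sumn; split.
  rewrite /sub CE /forest map_cat flatten_cat nth_cat ltnn subnn /=.
  by rewrite nth_cat size_subforms tree_size_gt0; case: (X).
rewrite /n -(size_forest G) -/C CE /forest map_cat flatten_cat size_cat /= size_cat size_subforms.
by have := tree_size_gt0 X; rewrite /forest; lia.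
Qed.

Definition skip_inv es tail (k : nat) : assertion := fun r m =>
  exists pre rest, [/\ C = pre ++ rest ++ tail, size rest = k, r 11 = k,
    r rPos = sumn (map tree_size pre) & tabled es r m].

Lemma skip_step es tail k r m : skip_inv es tail k r m -> r 11 != 0 ->
  wps W skip_body (decreases (skip_inv es tail) k) r m.
Proof.
move=> [pre [rest [CE szE r11 pos T]]] k0 /=; rewrite r11 in k0.
case: rest CE szE => [|X rest] CE szE; first by rewrite -szE in k0.
have [sX sn] := sub_offset CE.
move=> v1 /= e1; rewrite pos (tb_end T sn) /close sX in e1.
move=> v2 /= e2; rewrite r11 (tb_low T) // ri_one subn1 in e2.
have kn : k <= n by have := size_components; rewrite -/C CE !size_cat szE; clear; lia.
split; first by clear -e2 kn W_size; lia.
exists k.-1; first by rewrite ltn_predL lt0n.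
exists (rcons pre X), rest; split=> //; first by rewrite cat_rcons.
- by rewrite -szE.
- by rewrite /= e1 map_rcons sumn_rcons.
- by do 2 (apply: tabled_set => //).
Qed.

(** New edges are put in front of [es], so the plain edges are reached up to order only. *)
Definition cut_inv (k : nat) : assertion := fun r m =>
  exists pre rest es, [/\ C = pre ++ flatten [seq [:: A; dual A] | A <- rest],
    size rest = k /\ r 11 = k, r rPos = sumn (map tree_size pre), tabled es r m &
    perm_eq (es ++ cut_edges_from (r rPos) rest) (plain_edges f)].

Lemma cut_step k r m : cut_inv k r m -> r 11 != 0 ->
  wps W cut_body (decreases cut_inv k) r m.
Proof.
move=> [pre [rest [es [CE [szE r11] pos T pE]]]] k0 /=; rewrite r11 in k0.
case: rest CE szE pE => [|X rest] /= CE szE pE; first by rewrite -szE in k0.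
have [sX sn] := sub_offset CE.
have CE' : C = rcons pre X ++ dual X :: flatten [seq [:: A; dual A] | A <- rest].
  by rewrite cat_rcons.
have [sX' sn'] := sub_offset CE'; rewrite map_rcons sumn_rcons in sX' sn'.
have r1 : r rOne = 1 by rewrite (tb_low T).
have [_ [_ _ _ AE]] := tb_edges T.
have esn : size es + (size rest).+1 <= 3 * n.
  have := size_plain_edges; rewrite -(perm_size pE) size_cat /= size_cut_edges_from; lia.
have cn : count (is_par C) (iota 0 n) <= n.
  by rewrite -[X in _ <= X](size_iota 0) count_size.
have cntE := tb_count T.
move=> v1 /= e1; rewrite (tb_end T) ?pos // /close sX in e1.
have ed' := edge_table_add (r rPos) v1 (tb_edges T).
have inW x : x <= 20 * n + 20 -> x < W by clear -W_size; lia.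
move=> v2 /= e2; rewrite r1 addn1 in e2; fits inW: e2 AE esn.
move=> v3 /= e3 v4 /= e4; rewrite r1 addn1 e2 in e4; fits inW: e4 AE esn.
move=> v5 /= e5 v6 /= e6; rewrite r1 addn1 in e6; fits inW: e6 cntE cn esn.
rewrite -e4 -e2 -e5 -e3 in ed'.
move=> v7 /= e7; rewrite (tb_end T) ?e1 // /close sX' in e7.
move=> v8 /= e8; rewrite r11 r1 subn1 in e8; fits inW: e8 szE esn.
exists k.-1; first by rewrite ltn_predL lt0n.
exists (pre ++ [:: X; dual X]), rest, ((r rPos, v1) :: es); split.
- by rewrite -catA.
- by rewrite -szE; split=> //; rewrite -szE in e8.
- by rewrite /= e7 map_cat sumn_cat /=; lia.
- case: T => low memE _ _ endE parE premE badE; split=> //.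
  + by low_tac.
  + by mem_tac.
  + by rewrite /= e6 cntE.
- rewrite /= e7 -pos in pE *.
  rewrite e1 -pos; apply: perm_trans pE.
  by rewrite -cat_cons -cat1s -catA perm_catCA /= .
Qed.

End Tables.

(** * The decision procedure *)

Definition parse_code : program := Seq
  (block [:: Get rL bLen rN; Const rArcs 0; Const rEdges 0; Const rBad 0; Const 9 0;
             Op Add rPos rN 9])
  (While rPos parse_body).

Definition hit_code : program := Seq
  (block [:: Const 9 0; Op Add rPos rN 9]) (While rPos hit_body).

Definition skip_code : program := Seq
  (block [:: Const rPos 0; Const 9 0; Op Add 11 rConcls 9]) (While 11 skip_body).

Definition cut_code : program := Seq
  (block [:: Const 9 0; Op Add 11 rCuts 9]) (While 11 cut_body).

(** Register 13 becomes the distance of [rEdges + 1] from the number of vertices, as the sum of both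
    truncated differences. *)
Definition count_code : program := block
  [:: Op Add 12 rEdges rOne; Op Sub 13 12 rN; Op Sub 14 rN 12;
      Op Add 13 13 14; If 13 (Const rBad 1) Skip].

Definition start_code : program := block
  [:: Const 9 0; Put bBnd 9 rOne; Put bItem rOne 9; Put bHd 9 rOne; Const rFr 2;
      Const rCnt 0; Const rLev 0; Const rCur 0; Const rAp 0; Const rVtx 0;
      Const rPj 0; Const rGo 1].

Definition result_code : program := block
  [:: Op Sub 11 rN rCnt; Op Sub 12 rCnt rN; Op Add 11 11 12;
      Op Add 11 11 rLev; If 11 (Const 0 0) (Const 0 1)].

(** The exploration is started only after matching and edge count have been confirmed, since its
    verdict presupposes the count. *)
Definition decide_code : program := If rBad (Const 0 0)
  (Seq start_code (Seq (While rGo explore_body) result_code)).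

Definition verifier : program :=
  Seq table_code (Seq parse_code (Seq hit_code (Seq skip_code (Seq cut_code
    (Seq count_code decide_code))))).

Section Correctness.

Variables (G : cut_sequent) (f : leaf_function G) (W : nat).

Let n := size (labels G).
Let C := components G.
Let L := (trunc_log 2 n).+1.

Lemma size_labels_gt0 : 0 < n.
Proof.
by have := size_concls_cuts G; have := concls_neq0 G; rewrite -/n; lia.
Qed.

Hypothesis W_size : 30 * n + 30 <= W.
Hypothesis W_name : forall i, i < n -> name (lab G i) + 10 < W.

Lemma inW x : x <= 30 * n + 20 -> x < W.
Proof. by clear -W_size; lia. Qed.

Record ready (ri : nat -> nat) (mi : nat -> nat -> nat) : Prop := Ready {
  rd_n : ri rN = n;
  rd_concls : ri rConcls = size (concls G);
  rd_cuts : ri rCuts = size (cuts G);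
  rd_one : ri rOne = 1;
  rd_two : ri rTwo = 2;
  rd_L : ri rL = L;
  rd_presented : presented f mi;
  rd_len : forall x, 0 < x <= 2 * n -> mi bLen x = (trunc_log 2 x).+1;
  rd_pow : forall j, j <= L -> mi bPow j.+1 = 2 ^ j;
  rd_zero : forall b, 10 < b -> mi b = fun=> 0
}.

(** The lower bound lets [L] sparse table entries per row suffice; the upper one keeps masks within
    the table of binary lengths. *)
Lemma exp_L : n < 2 ^ L /\ 2 ^ L <= 2 * n.
Proof.
rewrite /L; split; first exact: trunc_log_ltn.
by rewrite expnS leq_mul2l /=; apply: trunc_logP => //; apply: size_labels_gt0.
Qed.

Lemma presented_input : presented f (Defs.mem (input f)).
Proof.
split=> //= i il; rewrite /lab; first by rewrite (nth_map LPar).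
by rewrite (nth_map LPar).
Qed.

Lemma wp_parse r m : r rN = n -> r rConcls = size (concls G) -> r rCuts = size (cuts G) ->
  r rOne = 1 -> r rTwo = 2 -> presented f m ->
  (forall x, 0 < x <= 2 * n -> m bLen x = (trunc_log 2 x).+1) ->
  (forall j, 2 ^ j <= 2 * n -> m bPow j.+1 = 2 ^ j) ->
  (forall b, 4 < b -> m b = fun=> 0) ->
  wp W parse_code (6 + ((cost parse_body).+1 * n + 1)) (fun r' m' =>
    exists ri mi, ready ri mi /\ parsed f ri mi 0 r' m') r m.
Proof.
move=> h0 h1 h2 h3 h4 pres lenE powE zeroE; apply: wp_seq; apply: wps_wp => /=.
have n0 := size_labels_gt0.
move=> v1 /= e1; rewrite h0 lenE in e1; last by clear -n0; lia.
split; first by apply: inW.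
split; first by apply: inW.
split; first by apply: inW.
split; first by apply: inW.
move=> v2 /= e2; rewrite h0 addn0 in e2; fits inW: e2.
set r0 := setr _ rPos v2.
have rd : ready r0 m.
  split=> //= [j jL|b b10]; last by apply: zeroE; apply: leq_trans b10.
  by apply: powE; apply: leq_trans exp_L.2; rewrite leq_exp2l.
have init : parsed f r0 m n r0 m.
  split=> //.
  - by rewrite /= /plain_edges_from -/n subnn; apply: edge_table0 => x; rewrite zeroE.
  - by rewrite /plain_edges_from -/n subnn.
  - by move=> j; lia.
  - by move=> y o; rewrite zeroE.
  - by move=> o y; lia.
  - by move=> t; rewrite zeroE //; split=> //; split=> // -[j]; lia.
  - by split=> // _; split=> [j|j j']; lia.
have step k r1 m1 : parsed f r0 m k r1 m1 -> r1 rPos != 0 ->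
    wps W parse_body (decreases (parsed f r0 m) k) r1 m1.
  case: k => [|k] P; have [-> _] := pr_pos P; first by [].
  move=> _; have := parse_step W_size W_name pres h3 h4 P; apply: wps_mono => r' m' P'.
  by exists k.
apply: wp_weaken (wp_while (J := parsed f r0 m) step init) => // r' m' [[k P] p0].
by exists r0, m; split=> //; have [pos _] := pr_pos P; rewrite -pos p0 in P.
Qed.

Lemma wp_hit ri mi r m : ready ri mi -> parsed f ri mi 0 r m ->
  wp W hit_code (2 + ((cost hit_body).+1 * n + 1)) (fun r' m' =>
    tabled f ri mi (plain_edges_from f 0) r' m') r m.
Proof.
move=> rd P; apply: wp_seq; apply: wps_wp => /=.
have rE := pr_low P; have rN0 : r rN = n by rewrite rE ?(rd_n rd).
have r1 : r rOne = 1 by rewrite rE ?(rd_one rd).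
split; first by apply: inW.
move=> v /= e; rewrite rN0 addn0 in e; fits inW: e.
set r0 := setr _ rPos v.
have init : hit_inv G r m n r0 m.
  split=> // [x x7|]; first by rewrite /r0; do 7 case: x x7 => [//|x] x7; case: x x7.
  by split=> [h|[]//]; split=> // j; lia.
apply: wp_weaken (wp_while (J := hit_inv G r m) (fun k r m => hit_step W_size r1) init) => // r' m' [[k H] p0].
have k0 : k = 0 by case: H => _ _ [<- _] _.
by rewrite k0 in H; apply: tabled_hits (rd_presented rd) _ _ _ _ P H.
Qed.

Lemma wp_skip ri mi r m : ready ri mi -> tabled f ri mi (plain_edges_from f 0) r m ->
  wp W skip_code (3 + ((cost skip_body).+1 * size (concls G) + 1)) (fun r' m' =>
    exists pre, C = pre ++ flatten [seq [:: A; dual A] | A <- cuts G] /\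
      [/\ r' rPos = sumn (map tree_size pre), tabled f ri mi (plain_edges_from f 0) r' m' &
        perm_eq (plain_edges_from f 0 ++ cut_edges_from (r' rPos) (cuts G)) (plain_edges f)]) r m.
Proof.
move=> rd T; apply: wp_seq; apply: wps_wp => /=.
split; first by apply: inW.
split; first by apply: inW.
have r1 : r rConcls = size (concls G) by rewrite (tb_low T) ?(rd_concls rd).
have cn : size (concls G) <= n := leq_trans (leq_addr _ _) (size_concls_cuts G).
move=> v /= e; rewrite r1 addn0 in e; fits inW: e cn.
set tail := flatten [seq [:: A; dual A] | A <- cuts G].
set r0 := setr _ 11 v.
have init : skip_inv f ri mi (plain_edges_from f 0) tail (size (concls G)) r0 m.
  exists [::], (concls G); split=> //.
  by do 3 (apply: tabled_set => //).
apply: wp_weaken (wp_while (J := skip_inv f ri mi (plain_edges_from f 0) tail)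
  (@skip_step _ f _ W_size _ _ (rd_one rd) _ _) init) => //.
move=> r' m' [[k [pre [rest [CE szE r11 pos T']]]] p0].
have rest0 : rest = [::] by apply/nilP; rewrite /nilp szE -r11 p0.
rewrite rest0 /= in CE; exists pre; split=> //; split=> //.
rewrite pos /plain_edges /cut_edges.
suff -> : pre = concls G by [].
have CE' : concls G ++ tail = pre ++ tail by rewrite -CE.
have sz : size pre = size (concls G) by have := congr1 size CE'; rewrite !size_cat; lia.
by rewrite -(take_size_cat tail sz) -CE' take_size_cat.
Qed.

Lemma wp_cuts ri mi r m pre : ready ri mi -> tabled f ri mi (plain_edges_from f 0) r m ->
  C = pre ++ flatten [seq [:: A; dual A] | A <- cuts G] ->
  r rPos = sumn (map tree_size pre) ->
  perm_eq (plain_edges_from f 0 ++ cut_edges_from (r rPos) (cuts G)) (plain_edges f) ->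
  wp W cut_code (2 + ((cost cut_body).+1 * size (cuts G) + 1)) (fun r' m' =>
    exists2 es, perm_eq es (plain_edges f) & tabled f ri mi es r' m') r m.
Proof.
move=> rd T CE pos pE; apply: wp_seq; apply: wps_wp => /=.
split; first by apply: inW.
have r2 : r rCuts = size (cuts G) by rewrite (tb_low T) ?(rd_cuts rd).
have cn : size (cuts G) <= n := leq_trans (leq_addl _ _) (size_concls_cuts G).
move=> v /= e; rewrite r2 addn0 in e; fits inW: e cn.
set r0 := setr _ 11 v.
have init : cut_inv f ri mi (size (cuts G)) r0 m.
  exists pre, (cuts G), (plain_edges_from f 0); split=> //.
  by do 2 (apply: tabled_set => //).
apply: wp_weaken (wp_while (J := cut_inv f ri mi) (@cut_step _ f _ W_size _ _ (rd_one rd)) init) => //.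
move=> r' m' [[k [pre' [rest [es [CE' [szE r11] pos' T' pE']]]]] p0].
have rest0 : rest = [::] by apply/nilP; rewrite /nilp szE -r11 p0.
by exists es; rewrite // rest0 /= cats0 in pE' *.
Qed.

Lemma wp_if x p q T Q r m : (r x <> 0 -> wp W p T Q r m) -> (r x = 0 -> wp W q T Q r m) ->
  wp W (If x p q) T.+1 Q r m.
Proof.
move=> hp hq; have [x0|x0] := eqVneq (r x) 0.
  have [r' [m' [t [ex le q']]]] := hq x0.
  by exists r', m', t.+1; split=> //; apply: ExecIfFalse ex.
have [r' [m' [t [ex le q']]]] := hp (elimN eqP x0).
by exists r', m', t.+1; split=> //; apply: ExecIfTrue ex.
Qed.

Definition counted : Prop := (size (plain_edges f) + size (par_list C)).+1 = n.

Lemma size_par_list : size (par_list C) = count (is_par C) (iota 0 n).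
Proof. by rewrite size_filter (size_forest G). Qed.

Lemma wps_count ri mi es r m : ready ri mi -> tabled f ri mi es r m ->
  perm_eq es (plain_edges f) ->
  wps W count_code (fun r' m' => [/\ forall x, x <= 6 -> r' x = r x, m' = m &
    r' rBad = 0 <-> matching f /\ counted]) r m.
Proof.
move=> rd T pE /=.
have r1 : r rOne = 1 by rewrite (tb_low T) ?(rd_one rd).
have rN0 : r rN = n by rewrite (tb_low T) ?(rd_n rd).
have cn : count (is_par C) (iota 0 n) <= n.
  by rewrite -[X in _ <= X](size_iota 0) count_size.
have en := size_plain_edges f; rewrite -/n in en.
have cE : r rEdges = size (plain_edges f) + size (par_list C).
  by rewrite (tb_count T) (perm_size pE) size_par_list.
have rn : r rEdges <= 4 * n by rewrite cE size_par_list; clear -cn en; lia.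
move=> v1 /= e1; rewrite r1 addn1 in e1; fits inW: e1 rn.
move=> v2 /= e2; rewrite rN0 in e2; fits inW: e2 e1 rn.
move=> v3 /= e3; rewrite rN0 in e3; fits inW: e3 e1 rn.
move=> v4 /= e4; fits inW: e4 e3 e2 e1 rn.
have v4E : v4 = 0 <-> counted.
  by rewrite /counted -cE -e1; clear -e4 e3 e2; split; lia.
split=> v40.
  split; first by apply: inW; clear; lia.
  split=> //; first by do 7 case=> [//|].
  by split=> // -[_ /v4E].
split=> //; first by do 7 case=> [//|].
rewrite /= (tb_bad T); split=> [h|[]//].
by split=> //; apply/v4E.
Qed.

(** There are at most [3 * n] plain edges, so at most [6 * n] arcs. The initial potential is at most
    [2 * (6 * n) + 6 * n + 1], and the index must exceed it. *)
Definition explore_steps := 18 * n + 2.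

Lemma wp_decide ri mi es r0 r m : ready ri mi -> tabled f ri mi es r0 m ->
  perm_eq es (plain_edges f) -> (forall x, x <= 6 -> r x = r0 x) ->
  (r rBad = 0 <-> matching f /\ counted) ->
  wp W decide_code (cost start_code + ((cost explore_body).+1 * explore_steps + 1 + cost result_code)).+1
    (fun r' m' => r' 0 = 1 <-> proof_net f) r m.
Proof.
move=> rd T pE rE badE; have n0 := size_labels_gt0.
have [nL Ln] := exp_L; have rr0 x : x <= 5 -> r x = ri x.
  by move=> x5; rewrite rE ?(tb_low T) // ltnW.
have [r1 r2 rN0 rL0] : [/\ r rOne = 1, r rTwo = 2, r rN = n & r rL = L].
  by rewrite !rr0 // (rd_one rd) (rd_two rd) (rd_n rd) (rd_L rd).
apply: wp_if => [bad|good].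
  exists (setr r 0 0), m, 1; split=> //; first by apply: (ExecConst (State r m)); apply: inW.
  split=> // -[mt /(switching_linked _ n0)[cn _]].
  by case: bad; apply/badE.
have [mt cn] := badE.1 good.
have [src [ad arc1 arc2 AE]] := tb_edges T; rewrite -(rE rArcs) // in ad arc1 arc2 AE.
pose rgt o := m bEnd o.+1.
have parP o : o \in par_list C -> o < n /\ is_par C o.
  by rewrite mem_filter mem_iota (size_forest G) => /andP[-> /andP[_ ->]].
have par_in o : o < n -> is_par C o -> o \in par_list C.
  by move=> on po; rewrite mem_filter mem_iota (size_forest G) po on.
have par_args o : o \in par_list C -> [/\ o.+1 < right_arg C o, right_arg C o < n, o.+1 < n & rgt o = right_arg C o].
  move=> /parP[on po]; have oF : o < size (forest C) by rewrite (size_forest G).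
  have bi : is_par C o || is_tensor C o by rewrite po.
  have [a1 a2 rE' _] := args_close oF bi; rewrite (size_forest G) in a2.
  have a3 := ltn_trans a1 a2; by split=> //; rewrite /rgt (tb_end T).
have graph : par_graph n (plain_edges f) (par_list C) S rgt (m bPar).
  split=> //.
  - exact: plain_edges_below.
  - by move=> o op; have [a1 a2 a3 ->] := par_args o op; have [on _] := parP o op.
  - by move=> o op; have [a1 a2 a3 ->] := par_args o op; lia.
  - move=> y o yo; have [on po py] := tb_par T yo; have op := par_in o on po.
    split=> //; have [_ _ _ rE'] := par_args o op.
    by case: py => ->; [left | right; rewrite rE'].
  - move=> o y op py; have [on po] := parP o op; have [_ _ _ rE'] := par_args o op.
    by apply: (tb_prem T) => //; case: py => ->; [left | right; rewrite rE'].
have es_mem := perm_mem pE.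
have arc_pl : arcs_in (plain_edges f) (r rArcs) src (m bTgt).
  by move=> e; rewrite -!es_mem; apply: arc1.
have pl_arc : arcs_cover (plain_edges f) (r rArcs) src (m bTgt).
  by move=> x y; rewrite -es_mem; apply: arc2.
have powE j : j <= L -> m bPow j.+1 = 2 ^ j.
  by move=> jL; rewrite (tb_mem T) ?(rd_pow rd) //; left.
have lenE x : 0 < x <= 2 * n -> m bLen x = (trunc_log 2 x).+1.
  by move=> xn; rewrite (tb_mem T) ?(rd_len rd) //; left.
have codeE v : v < n -> m bCode v <= 5 /\ (v \in par_list C) = (m bCode v == 5).
  move=> vn; rewrite (tb_mem T); last by left.
  have [-> // _ _] := rd_presented rd; rewrite labE //.
  rewrite mem_filter mem_iota (size_forest G) vn andbT /is_par -/C.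
  by case: (sub C v) => [[]||].
have An : r rArcs <= 6 * n.
  by rewrite AE (perm_size pE) -[6]/(2 * 3) -mulnA leq_mul2l size_plain_edges.
(* Two for the first free cell, one for each arc, three for each vertex, as [i_fr] requires at the
   start. *)
pose K := r rArcs + 3 * n + 2.
have WK : K + 10 * n + 20 <= W by rewrite /K; clear -W_size An n0; lia.
pose J := looping n K (r rArcs) L (plain_edges f) (par_list C) m src.
have Wstep k r3 m3 : J k r3 m3 -> r3 rGo != 0 ->
    wps W explore_body (decreases J k) r3 m3.
  exact: (step_explore graph ad arc_pl pl_arc _ nL Ln powE lenE codeE WK).
have linkedE : all_linked n (plain_edges f) (par_list C) m <->
    forall s u v, u < n -> v < n ->
      linked (edge_rel (switch (plain_edges f) (par_list C) S (right_arg C) s)) u v.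
  rewrite /all_linked; have swE s : switch (plain_edges f) (par_list C) S (fun o => m bEnd o.+1) s =
      switch (plain_edges f) (par_list C) S (right_arg C) s.
    congr (_ ++ _); apply/eq_in_map => o op; have [_ _ _ h] := par_args o op.
    by rewrite -h.
  by split=> h s u v un vn; have := h s u v un vn; rewrite swE.
have zero b : 10 < b -> m b = fun=> 0.
  by move=> b10; rewrite (tb_mem T) ?(rd_zero rd) //; right.
apply: wp_seq; apply: wps_wp => /=.
split; first by apply: inW.
fits inW: n0.
do 6 (split; first by apply: inW).
fits inW: n0.
set r3 := setr _ rGo 1; set m3 := updm _ bHd _ _.
have init : J explore_steps r3 m3.
  split; first by split=> //; repeat (apply: updm_low => //).
  left; split=> //.
  have [I pot] := @inv_start n (plain_edges f) (par_list C) S rgt (m bPar) (r rArcs) src (m bTgt)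
    graph K 0 (m3 bNum) (m3 12) (m3 bBnd) (m3 14) (m3 bHd) (m3 bItem) (m3 17)
    ltac:(by move=> x; rewrite /m3 /= zero) ltac:(by move=> x; rewrite /m3 /= zero)
    ltac:(by rewrite /m3 /= /upd r1) ltac:(by rewrite /m3 /= /upd r1)
    ltac:(by move=> i i0; rewrite /m3 /= /upd zero // gtn_eqF)
    ltac:(by rewrite /m3 /= /upd r1) ltac:(by rewrite /m3 /= zero) (leqnn _).
  exists start_lists; split=> //.
  - by apply: leq_ltn_trans pot _; rewrite /explore_steps; clear -An; lia.
  - by split=> z; rewrite /m3 /= zero // expn_gt0.
  - by rewrite /m3 /= !(zero 19) // !(zero 20) // !(zero 21) //; apply: finv0.
apply: wp_seq; apply: wp_weaken (wp_while (J := J) Wstep init) => // r4 m4 [[k H] go].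
case: H => -[s0 s1 _ _ _] [[g _]|[_ cn4 ln4 ans]]; first by rewrite go in g.
apply: wps_wp => /=.
move=> v1 /= e1; rewrite s0 in e1; fits inW: e1.
move=> v2 /= e2; rewrite s0 in e2; fits inW: e2 cn4.
move=> v3 /= e3; fits inW: e3 e2 e1 cn4.
move=> v4 /= e4; fits inW: e4 e3 e2 e1 cn4 ln4.
have v4E : v4 = 0 <-> proof_net f.
  rewrite /proof_net switching_linked // -linkedE -ans.
  split=> [v40|[_ [_ [l0 c0]]]]; last by clear -e4 e3 e2 e1 l0 c0; lia.
  by split=> //; split=> //; clear -v40 e4 e3 e2 e1; lia.
split=> v40; (split; first by apply: inW; clear; lia) => /=.
  by split=> // /v4E.
by split=> // _; apply/v4E.
Qed.

Definition run_time : nat :=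
  4 + ((cost table_body).+1 * (2 * n) + 1) +
  (6 + ((cost parse_body).+1 * n + 1) +
  (2 + ((cost hit_body).+1 * n + 1) +
  (3 + ((cost skip_body).+1 * size (concls G) + 1) +
  (2 + ((cost cut_body).+1 * size (cuts G) + 1) +
  (cost count_code +
  (cost start_code + ((cost explore_body).+1 * explore_steps + 1 + cost result_code)).+1))))).

Lemma wp_verifier : wp W verifier run_time (fun r m => r 0 = 1 <-> proof_net f)
  (reg (input f)) (Defs.mem (input f)).
Proof.
apply: wp_seq; apply: wp_weaken (wp_table (n := n) _ _ _ _) => //=; last first.
  by apply: inW; have := size_labels_gt0; clear; lia.
move=> r1 m1 [rE [r11 r12] len1 pow1 mE]; apply: wp_seq.
have zero b : 4 < b -> m1 b = fun=> 0.
  by move=> b4; rewrite mE; [case: b b4 => [|[|[|b]]] | lia | lia].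
have pres : presented f m1.
  by have [p1 p2 p3] := presented_input; split=> i; rewrite mE //; [apply: p1 | apply: p2].
apply: wp_weaken (wp_parse _ _ _ r11 r12 pres len1 pow1 zero) => //; try by rewrite rE.
move=> r2 m2 [ri [mi [rd P]]]; apply: wp_seq.
apply: wp_weaken (wp_hit rd P) => // r3 m3 T3; apply: wp_seq.
apply: wp_weaken (wp_skip rd T3) => // r4 m4 [pre [CE [pos T4 pE4]]]; apply: wp_seq.
apply: wp_weaken (wp_cuts rd T4 CE pos pE4) => // r5 m5 [es pE T5]; apply: wp_seq.
apply: wps_wp; apply: wps_mono (wps_count rd T5 pE) => r6 m6 [r6E -> badE].
exact: wp_decide rd T5 pE r6E badE.
Qed.

End Correctness.

(** * From the number of vertices to the number of leaves *)

Lemma tree_size_leaves X : tree_size X < 2 * count is_leaf (tree_labels X).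
Proof.
elim: X => [a|A IHA B IHB|A IHA B IHB] //=; rewrite (tree_sizeE) count_cat /=; lia.
Qed.

Lemma size_labels_leaves G : size (labels G) <= 2 * num_leaves G.
Proof.
rewrite /num_leaves /labels; elim: (components G) => //= X Xs IH.
rewrite size_cat count_cat; have := tree_size_leaves X; rewrite /tree_size; lia.
Qed.

(** With [l] leaves there are at most [2 * l] vertices, so [18 * n + 2] passes of the exploration
    are at most [38 * l]; the other coefficients arise likewise. *)
Definition time_factor : nat :=
  4 * cost table_body + 2 * cost parse_body + 2 * cost hit_body + 2 * cost skip_body +
  2 * cost cut_body + cost count_code + cost start_code + 38 * cost explore_body +
  cost result_code + 100.

Lemma run_time_leq G : run_time G <= time_factor * num_leaves G.
Proof.
have nl := size_labels_leaves G; have n0 := size_labels_gt0 G.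
have nc := size_concls_cuts G.
rewrite /run_time /time_factor /explore_steps.
move: (cost table_body) (cost parse_body) (cost hit_body) (cost skip_body) (cost cut_body)
  (cost count_code) (cost start_code) (cost explore_body) (cost result_code)
  => a b c d e g h i j.
move: (num_leaves G) (size (labels G)) (size (cuts G)) (size (concls G)) nl n0 nc
  => l n p q nl n0 nc.
have l0 : 0 < l by lia.
have mulW x y k : y <= k * l -> x.+1 * y <= x.+1 * (k * l) by rewrite leq_mul2l orbC => ->.
have scale x : x <= x * l by rewrite leq_pmulr.
have := mulW a (2 * n) 4 ltac:(lia); have := mulW b n 2 ltac:(lia).
have := mulW c n 2 ltac:(lia); have := mulW d q 2 ltac:(lia).
have := mulW e p 2 ltac:(lia); have := mulW i (18 * n + 2) 38 ltac:(lia).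
have := scale g; have := scale h; have := scale j.
lia.
Qed.

Theorem theorem4 :
  exists (p : program) (c k : nat),
  forall (G : cut_sequent) (f : leaf_function G),
  exists (st : state) (t : nat),
    [/\ exec (word_range k G) p (input f) st t,
        t <= c * num_leaves G &
        reg st 0 = 1 <-> proof_net f].
Proof.
exists verifier, time_factor, 6 => G f.
set N := num_leaves G + \max_(l <- labels G) name l + 2.
have nl := size_labels_leaves G.
(* There is at least one leaf, so [N >= 3] and [N ^ 6 >= 3 ^ 5 * N]. The factor 243 covers
   [30 * n + 30] with [n] at most twice the number of leaves, as well as the names plus 10. *)
have W6 : 243 * N <= word_range 6 G.
  rewrite /word_range -/N (expnS N 5) mulnC leq_mul2l; apply/orP; right.
  have N3 : 3 <= N.
    rewrite /N; move: (\max_(_ <- _) _) => b.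
    by move: (size_labels_gt0 G) nl; move: (num_leaves G) (size (labels G)) => n l; lia.
  by have := leq_exp2r 3 N (isT : 0 < 5); rewrite N3 => ->.
have Wn : 30 * size (labels G) + 30 <= word_range 6 G.
  apply: leq_trans W6; rewrite /N; move: (\max_(_ <- _) _) => b.
  by move: (num_leaves G) (size (labels G)) nl => n l; lia.
have Wname i : i < size (labels G) -> name (lab G i) + 10 < word_range 6 G.
  move=> il; apply: leq_trans W6; rewrite /N.
  have : name (lab G i) <= \max_(l <- labels G) name l.
    by rewrite (big_nth LPar) (big_mkord xpredT) (bigD1 (Ordinal il)) //= leq_maxl.
  by move: (name _) (\max_(_ <- _) _) => a b; lia.
have [r [m [t [ex le ans]]]] := wp_verifier f Wn Wname.
exists (State r m), t; split=> //; exact: leq_trans le (run_time_leq G).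
Qed.
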